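(* Let $X\neq L^\infty$ be a rearrangement invariant (r.i.) space on $[0,1]$ such that the function $y\mapsto\|F_y\|_X$, where $F_y(x):=\frac1x\chi_{[y,1]}(x)$ for $0<x\le1$, $y\in(0,1]$, belongs to the associate space $X'$. Then $\mathcal{C}\colon X\to X$ is completely continuous. In particular, this occurs for the Lorentz space $X=\Lambda(\varphi)$ whenever $\varphi\colon[0,1]\to[0,\infty)$ is an increasing, concave function with $\varphi(0)=0$ satisfying $0<\gamma_\varphi\le\delta_\varphi<1$.
   Context: $\lambda$ is Lebesgue measure on $[0,1]$; $f^*$ is the decreasing rearrangement of a measurable function $f$ on $[0,1]$ (right-continuous inverse of $\tau\mapsto\lambda(\{|f|>\tau\})$). A Banach function space (B.f.s.) $X$ on $[0,1]$ is a Banach space of ($\lambda$-a.e. classes of) measurable functions on $[0,1]$ such that $g\in X$ and $\|g\|_X\le\|f\|_X$ whenever $f\in X$ and $|g|\le|f|$ a.e. A r.i. space is a B.f.s. on $[0,1]$ such that if $g^*\le f^*$ and $f\in X$ then $g\in X$ and $\|g\|_X\le\|f\|_X$. Every r.i. space satisfies $L^\infty\subseteq X\subseteq L^1$. The Fatou property is not assumed. The associate space $X'$ consists of all measurable $g$ with $\int_0^1|f(t)g(t)|\,dt<\infty$ for every $f\in X$. The Cesàro operator is $\mathcal{C}(f)(x):=\frac1x\int_0^x f(t)\,dt$. An operator is completely continuous if it maps weakly convergent sequences to norm convergent sequences. The Lorentz space $\Lambda(\varphi)$ consists of all measurable $f$ on $[0,1]$ with $\|f\|_{\Lambda(\varphi)}:=\int_0^1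 f^*(s)\,d\varphi(s)<\infty$. The lower and upper dilation indices are $$\gamma_\varphi:=\lim_{t\to0^+}\frac{\log\left(\sup_{0<s\le1}\varphi(st)/\varphi(s)\right)}{\log t},\qquad \delta_\varphi:=\lim_{t\to+\infty}\frac{\log\left(\sup_{0<s\le1/t}\varphi(st)/\varphi(s)\right)}{\log t}.$$ *)

(* Defs.v *)
From HB Require Import structures.
From mathcomp Require Import all_boot all_order all_algebra.
From mathcomp Require Import all_classical all_reals all_analysis.

Set Implicit Arguments.
Unset Strict Implicit.
Unset Printing Implicit Defensive.

Import Order.TTheory GRing.Theory Num.Theory.
Import numFieldNormedType.Exports.

Local Open Scope classical_set_scope.
Local Open Scope ring_scope.

(** A measurable function on [0,1] is represented by a function [R -> R] that
    is measurable on [I01]; its values outside [I01] are irrelevant.  A space of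
    a.e.-classes is represented by a pair [(X, N)]: [X] is the set of all
    representatives of members of the space, and [N f] is the norm of the class
    of [f] when [f \in X] ([N] is unconstrained outside [X]).  Scalars are
    real. *)

Section FunctionSpaces.
Context {R : realType}.

Definition I01 : set R := `[0, 1]%classic.

Local Notation lambda := (@lebesgue_measure R).

(** The clause [bfs_ideal] makes [X] and [N] invariant under a.e. equality on
    [I01], so that [X] is a union of a.e.-classes. *)
Record banach_function_space (X : set (R -> R)) (N : (R -> R) -> R) : Prop := {
  bfs_measurable : forall f, X f -> measurable_fun I01 f;
  bfs_zero : X (fun=> 0);
  bfs_add : forall f g, X f -> X g -> X (f \+ g);
  bfs_scale : forall (a : R) f, X f -> X (fun x => a * f x);
  bfs_normD : forall f g, X f -> X g -> N (f \+ g) <= N f + N g;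
  bfs_normZ : forall (a : R) f, X f -> N (fun x => a * f x) = `|a| * N f;
  bfs_norm0 : forall f, X f -> N f = 0 -> ae_eq lambda I01 f (fun=> 0);
  bfs_complete : forall u : nat -> R -> R, (forall n, X (u n)) ->
    (forall e : R, 0 < e -> exists M : nat, forall m n : nat,
       (M <= m)%N -> (M <= n)%N -> N (u m \- u n) < e) ->
    exists2 f, X f & N (u n \- f) @[n --> \oo] --> (0 : R);
  bfs_ideal : forall f g : R -> R, X f -> measurable_fun I01 g ->
    {ae lambda, forall x, I01 x -> `|g x| <= `|f x|} ->
    X g /\ N g <= N f
}.

Definition distribution_function (f : R -> R) (t : R) : \bar R :=
  lambda (I01 `&` [set x | t < `|f x|]).

(** Extended-real valued: at [s = 0] it is the essential supremum of [|f|]. *)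
Definition rearrangement (f : R -> R) (s : R) : \bar R :=
  ereal_inf [set t%:E | t in
    [set t : R | 0 <= t /\ (distribution_function f t <= s%:E)%E]].

(** [ri_nontrivial] excludes the space [{0}], the only one for which the
    inclusion of [L^oo] in [X] would fail. *)
Record ri_space (X : set (R -> R)) (N : (R -> R) -> R) : Prop := {
  ri_bfs : banach_function_space X N;
  ri_nontrivial : exists2 f, X f & ~ ae_eq lambda I01 f (fun=> 0);
  ri_rearrangement : forall f g : R -> R, X f -> measurable_fun I01 g ->
    (forall s, I01 s -> (rearrangement g s <= rearrangement f s)%E) ->
    X g /\ N g <= N f
}.

Definition Linfty : set (R -> R) :=
  [set f : R -> R | measurable_fun I01 f /\
    exists M : R, {ae lambda, forall x, I01 x -> `|f x| <= M}].

Definition associate_space (X : set (R -> R)) : set (R -> R) :=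
  [set g : R -> R | measurable_fun I01 g /\
    forall f, X f -> (\int[lambda]_(t in I01) `|f t * g t|%:E < +oo)%E].

(** The topological dual of [X]; a bounded functional automatically takes equal
    values on a.e.-equal functions. *)
Definition bounded_functional (X : set (R -> R)) (N : (R -> R) -> R)
    (l : (R -> R) -> R) : Prop :=
  (forall (a : R) f g, X f -> X g ->
     l (fun x => a * f x + g x) = a * l f + l g) /\
  (exists K : R, forall f, X f -> `|l f| <= K * N f).

Definition weakly_cvg (X : set (R -> R)) (N : (R -> R) -> R)
    (u : nat -> R -> R) (f : R -> R) : Prop :=
  [/\ forall n, X (u n), X f &
    forall l, bounded_functional X N l -> l (u n) @[n --> \oo] --> l f].

Definition bounded_operator (X : set (R -> R)) (N : (R -> R) -> R)
    (T : (R -> R) -> R -> R) : Prop :=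
  [/\ forall f, X f -> X (T f),
      forall (a : R) f g, X f -> X g ->
        ae_eq lambda I01 (T (fun x => a * f x + g x))
                         (fun x => a * T f x + T g x) &
      exists K : R, forall f, X f -> N (T f) <= K * N f].

Definition completely_continuous (X : set (R -> R)) (N : (R -> R) -> R)
    (T : (R -> R) -> R -> R) : Prop :=
  bounded_operator X N T /\
  (forall u f, weakly_cvg X N u f ->
     N (T (u n) \- T f) @[n --> \oo] --> (0 : R)).

Definition Cesaro (f : R -> R) (x : R) : R :=
  x^-1 * \int[lambda]_(t in `[0, x]) f t.

Definition F_ (y x : R) : R := x^-1 * \1_(`[y, 1]%classic : set R) x.

End FunctionSpaces.

Section Lorentz.
Variable R : realType.

(** Functions [phi : [0,1] -> [0,oo)] that are increasing, concave and vanish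
    at 0; values outside [[0,1]] are irrelevant. *)
Record lorentz_weight := LorentzWeight {
  weight_fun :> R -> R;
  weight_nondecreasing : {in `[0, 1] &, {homo weight_fun : s t / s <= t}};
  weight_concave : convex_function (`[0, 1]%classic : set R^o)
                     (fun s => - weight_fun s);
  weight0 : weight_fun 0 = 0
}.

Definition clamp01 (s : R) : R := Num.max 0 (Num.min s 1).

(** The right-continuous version of [phi], extended by [0] on the left of [0]
    and by [phi 1] on the right of [1].  Its Lebesgue-Stieltjes measure is
    [d phi], with an atom of mass [phi(0+)] at [0]. *)
Definition weight_ext (phi : lorentz_weight) (s : R) : R :=
  inf [set phi (clamp01 t) | t in `]s, +oo[].

Lemma clamp01_itv s : clamp01 s \in `[0, 1].
Proof.
by rewrite in_itv/= /clamp01 le_max lexx/= ge_max ler01/= ge_min lexx orbT.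
Qed.

Lemma clamp01_homo : {homo clamp01 : s t / s <= t}.
Proof.
move=> s t st; rewrite /clamp01 ge_max !le_max lexx/=.
by rewrite le_min !ge_min st lexx !orbT.
Qed.

Lemma weight_clamp_homo (phi : lorentz_weight) :
  {homo phi \o clamp01 : s t / s <= t}.
Proof.
by move=> s t st; apply: weight_nondecreasing;
  [exact: clamp01_itv | exact: clamp01_itv | exact: clamp01_homo].
Qed.

Lemma weight_ext_has_inf (phi : lorentz_weight) s :
  has_inf [set phi (clamp01 t) | t in `]s, +oo[].
Proof.
split; first by exists (phi (clamp01 (s + 1))), (s + 1) => //=;
  rewrite in_itv/= andbT ltrDl.
exists (phi (clamp01 s)) => _ [t /= + <-].
by rewrite in_itv/= andbT => /ltW; exact: weight_clamp_homo.
Qed.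

Lemma weight_ext_nondecreasing (phi : lorentz_weight) :
  nondecreasing (weight_ext phi).
Proof.
move=> s t st; apply: lb_le_inf; first by case: (weight_ext_has_inf phi t).
move=> _ [r /= + <-]; rewrite in_itv/= andbT => tr.
apply: ge_inf; first by case: (weight_ext_has_inf phi s).
by exists r => //=; rewrite in_itv/= andbT (le_lt_trans st).
Qed.

Lemma weight_ext_right_continuous (phi : lorentz_weight) :
  right_continuous (weight_ext phi).
Proof.
move=> s; apply/(@cvgrPdist_lt _ R^o) => e e0.
have [_ [t /= + <-] te] := inf_adherent e0 (weight_ext_has_inf phi s).
rewrite in_itv/= andbT => st.
near=> r.
have sr : s < r by near: r; exact: nbhs_right_gt.
have rt : r < t by near: r; exact: nbhs_right_lt.
rewrite ler0_norm; last by rewrite subr_le0; exact/weight_ext_nondecreasing/ltW.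
rewrite opprB ltrBlDl (le_lt_trans _ te)//.
apply: ge_inf; first by case: (weight_ext_has_inf phi r).
by exists t => //=; rewrite in_itv/= andbT.
Unshelve. all: by end_near. Qed.

HB.instance Definition _ (phi : lorentz_weight) :=
  isCumulative.Build R _ R (weight_ext phi)
    (@weight_ext_nondecreasing phi) (@weight_ext_right_continuous phi).

Definition lorentz_integral (phi : lorentz_weight) (f : R -> R) : \bar R :=
  (\int[lebesgue_stieltjes_measure (weight_ext phi)]_(s in `[0%R, 1%R])
     rearrangement f s)%E.

Definition lorentz_space (phi : lorentz_weight) : set (R -> R) :=
  [set f : R -> R | measurable_fun I01 f /\ (lorentz_integral phi f < +oo)%E].

Definition lorentz_norm (phi : lorentz_weight) (f : R -> R) : R :=
  fine (lorentz_integral phi f).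

Definition lower_dilation_index (phi : R -> R) : R :=
  lim (ln (sup [set phi (s * t) / phi s | s in `]0, 1]]) / ln t @[t --> 0^'+]).

Definition upper_dilation_index (phi : R -> R) : R :=
  lim (ln (sup [set phi (s * t) / phi s | s in `]0, t^-1]]) / ln t
    @[t --> +oo]).

End Lorentz.

(* Main.v *)
(* The key estimate bounds the X-norm of C(f 1_[0,d]) on [0,d] by a multiple of
   the integral over [0,d] of |f(y)| N(F_y): on dyadic intervals C f is dominated
   by multiples of the F_y, and N(F_(y/2)) <= 5 N(F_y) by rearrangement
   invariance.  If u_n tends weakly to f, then the functions (u_n - f)(y) N(F_y)
   are integrated to 0 against every bounded function, hence are uniformly
   integrable (gliding hump), which makes the part near 0 small uniformly in n.
   Away from 0, C(u_n - f) tends to 0 uniformly, because the primitives of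
   u_n - f are equicontinuous and tend to 0 pointwise.

   In Lambda(phi) the layer cake formula turns the norm into the integral over
   t > 0 of phi(lambda{|f| > t}).  The triangle inequality holds for the weights
   min(s, r), and a concave weight is a limit of positive combinations of these.
   The lower index gives that the integral of phi(y)/y over A is at most
   c phi(lambda A), and the upper index gives N(F_y) <= K phi(y)/y; together
   they put y |-> N(F_y) in the associate space. *)
Require Import Defs.
From HB Require Import structures.
From mathcomp Require Import all_boot all_order all_algebra.
From mathcomp Require Import all_classical all_reals all_analysis.
From mathcomp Require Import measurable_realfun ring lra.

Set Implicit Arguments.
Unset Strict Implicit.
Unset Printing Implicit Defensive.

Import Order.TTheory GRing.Theory Num.Theory.
Import numFieldNormedType.Exports.

Local Open Scope classical_set_scope.
Local Open Scope ring_scope.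

(** * Uniform integrability of weakly null sequences *)

(** The role of [F_] comes from Fubini: the Cesaro mean of f at x is the integral of f(y) F_y(x)
    over y, so a Minkowski inequality would bound its norm by the integral of |f(y)| N(F_y). In the
    absence of the Fatou property such an inequality is not immediate, and infinitely many functions
    can be summed in [X] only through completeness; hence the dyadic sums in place of integrals, and
    [bfs_series_bound] beneath the abstract half. The same bound shows that each member of the
    associate space gives a bounded functional, so weak convergence may be tested against N(F_y)
    h(y) for bounded measurable h. The weight 1 is tested as well, for the primitives. That it is
    admissible, i.e. that [X] lies in L^1, is deduced from the hypothesis: N(F_y) is bounded below
    on (0,1/2], and a reflection carries [1/2,1] to that interval.

    For Lorentz spaces each index is used through a single dilation factor: one t < 1 with phi(ts)
    <= q phi(s), q < 1, and one t > 1 with phi(st) <= M phi(s), M < t. Both integral estimates then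
    come from iterating one such inequality geometrically, and their constants are fixed points of
    the resulting recursions. *)

Lemma measurable_sgr (R : realType) : measurable_fun [set: R] (@Num.sg R).
Proof.
apply: nondecreasing_measurable => // x y xy.
by case: (ltrgt0P x) xy => [x0|x0|->]; case: (ltrgt0P y) => [y0|y0|->] => xy;
  rewrite ?sgr0 ?(gtr0_sg x0) ?(ltr0_sg x0) ?(gtr0_sg y0) ?(ltr0_sg y0); lra.
Qed.

Lemma measurable_fun_if_mem d (T : measurableType d) (R : realType)
    (D B : set T) (f g : T -> R) : measurable B ->
  measurable_fun D f -> measurable_fun D g ->
  measurable_fun D (fun x => if x \in B then f x else g x).
Proof.
move=> mB mf mg mD; apply: (measurable_fun_if mD) => //.
- apply: (measurable_fun_bool true).
  by rewrite preimage_mem_true; exact: measurableI.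
- by apply: measurable_funS mf => // x [].
- by apply: measurable_funS mg => // x [].
Qed.

Section gliding_hump.
Context d (T : measurableType d) (R : realType).
Variables (mu : {measure set T -> \bar R}) (D : set T).
Hypothesis mD : measurable D.

Lemma integrable_mul_le1 (v h : T -> R) :
  mu.-integrable D (EFin \o v) -> measurable_fun D h ->
  (forall x, D x -> `|h x| <= 1) -> mu.-integrable D (EFin \o (v \* h)).
Proof.
move=> iv mh h1; apply: (le_integrable mD _ _ iv).
  apply/measurable_EFinP/measurable_funM => //.
  by apply/measurable_EFinP; exact: measurable_int iv.
by move=> x Dx; rewrite /= lee_fin normrM ler_piMr// h1.
Qed.

Lemma Rintegral_normr_le (A B : set T) (v : T -> R) :
  measurable A -> measurable B -> A `<=` B -> mu.-integrable B (EFin \o v) ->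
  \int[mu]_(x in A) `|v x| <= \int[mu]_(x in B) `|v x|.
Proof.
move=> mA mB AB iv.
have iB := integrable_norm iv.
have iA : mu.-integrable A (EFin \o (fun x => `|v x|)) by exact: integrableS iB.
rewrite /Rintegral fine_le//.
- exact: integrable_fin_num iA.
- exact: integrable_fin_num iB.
- by apply: ge0_subset_integral => //=; exact: measurable_int iB.
Qed.

Variables (v : nat -> T -> R) (A : nat -> set T).
Hypothesis iv : forall n, mu.-integrable D (EFin \o v n).
Hypothesis mA : forall k, measurable (A k).
Hypothesis AD : forall k, A k `<=` D.
Hypothesis Ani : forall k m, (k <= m)%N -> A m `<=` A k.
Hypothesis vA : forall n (e : R), 0 < e ->
  exists k, \int[mu]_(x in A k) `|v n x| < e.
Hypothesis vweak : forall h : T -> R, measurable_fun D h ->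
  (forall x, D x -> `|h x| <= 1) ->
  \int[mu]_(x in D) (v n x * h x) @[n --> \oo] --> (0 : R).

(** A state of the recursive construction: a level and a test function bounded by 1, left at 0 on
    the set of that level, where later steps may still change it. *)
Let good (s : nat * (T -> R)) :=
  [/\ measurable_fun D s.2, forall x, D x -> `|s.2 x| <= 1 &
      forall x, A s.1 x -> s.2 x = 0].

Let iA n k : mu.-integrable (A k) (EFin \o v n).
Proof. exact: integrableS (iv n). Qed.

(** The inequality holds pointwise. On [A m], where [g] is arbitrary within the bound 1, the left
    side is |v| - 2|v| = -|v|: the factor 2 cancels the hump term and pays for the worst sign.
    Leaving [g] free there lets the estimate survive all later steps. *)
Let hump_le n (h g : T -> R) k m : good (k, h) ->
  measurable_fun D g -> (forall x, D x -> `|g x| <= 1) ->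
  (k <= m)%N ->
  (forall x, D x -> ~ A m x -> g x = if x \in A k then Num.sg (v n x) else h x) ->
  \int[mu]_(x in D) (v n x * h x) + \int[mu]_(x in A k) `|v n x|
    - 2 * \int[mu]_(x in A m) `|v n x| <= \int[mu]_(x in D) (v n x * g x).
Proof.
move=> [/= mh h1 h0] mg g1 km gE.
have ivA j : mu.-integrable D (EFin \o ((fun x => `|v n x|) \_ (A j))).
  rewrite -restrict_EFin; apply/integrable_restrict => //.
  by rewrite setIidr//; exact: integrable_norm.
have EA j : \int[mu]_(x in A j) `|v n x| =
    \int[mu]_(x in D) ((fun x => `|v n x|) \_ (A j)) x.
  by rewrite -Rintegral_mkcondr setIidr.
have i1 := integrable_mul_le1 (iv n) mh h1.
have i2 := integrable_mul_le1 (iv n) mg g1.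
have i3 : mu.-integrable D
    (EFin \o (fun x => v n x * h x + ((fun x => `|v n x|) \_ (A k)) x)).
  exact: (integrableD mD i1 (ivA k)).
have i4 : mu.-integrable D
    (EFin \o (fun x => 2 * ((fun x => `|v n x|) \_ (A m)) x)).
  exact: (integrableZl mD 2 (ivA m)).
rewrite !EA -RintegralZl// -RintegralD// -RintegralB//.
apply: le_Rintegral => //; first exact: (integrableB mD i3 i4).
move=> x Dx; rewrite /patch.
case: (asboolP (A m x)) => Am.
  have Ak := Ani km Am.
  rewrite !mem_set// (h0 x Ak) mulr0 add0r mulr_natl mulr2n opprD addrA subrr sub0r.
  by rewrite lerNl (le_trans (ler_norm _))// normrN normrM ler_piMr// g1.
rewrite (memNset Am) mulr0 subr0 (gE _ Dx Am).
case: (asboolP (A k x)) => Ak.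
  by rewrite mem_set// (h0 x Ak) mulr0 add0r normrEsg mulrC.
by rewrite (memNset Ak) addr0.
Qed.

(* Otherwise a single [h] is built, equal to the sign of suitable [v n] on
   successive humps [A k] minus [A k'], against which [v] does not tend to 0. *)
Lemma gliding_hump (e : R) : 0 < e ->
  exists k, forall n, \int[mu]_(x in A k) `|v n x| <= e.
Proof.
move=> e0; apply: contrapT => /forallNP noK.
(* The finitely many functions before [N] are all small on some late [A k'], so a function violating
   the bound at level [k'] has index at least [N]; its mass on the larger set [A k] exceeds [e]
   too. *)
have big k N : exists2 n, (N <= n)%N & e < \int[mu]_(x in A k) `|v n x|.
  suff [k' kk' sm] : exists2 k', (k <= k')%N &
      forall j, (j < N)%N -> \int[mu]_(x in A k') `|v j x| <= e.
    have /existsNP[n /negP] := noK k'; rewrite -ltNge => en.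
    exists n; last first.
      by apply: (lt_le_trans en); apply: Rintegral_normr_le => //; exact: Ani.
    by rewrite leqNgt; apply/negP => /sm; rewrite leNgt en.
  elim: N => [|N [k' kk' IH]]; first by exists k.
  have [m hm] := vA N e0.
  exists (maxn k' m); first by rewrite (leq_trans kk')// leq_maxl.
  move=> j; rewrite ltnS leq_eqVlt => /predU1P[->|jN].
    apply/ltW/(le_lt_trans _ hm)/Rintegral_normr_le => //.
    exact/Ani/leq_maxr.
  apply: le_trans (IH _ jN); apply: Rintegral_normr_le => //.
  exact/Ani/leq_maxl.
(* The lower bound is required of every [g] that agrees with the new function off the new level set,
   since the final test function is still unknown on that set. *)
pose step (s t : nat * (T -> R)) := good s ->
  [/\ good t, (s.1 < t.1)%N, forall x, D x -> ~ A s.1 x -> t.2 x = s.2 x &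
   exists2 n, (s.1 <= n)%N & forall g : T -> R, measurable_fun D g ->
     (forall x, D x -> `|g x| <= 1) ->
     (forall x, D x -> ~ A t.1 x -> g x = t.2 x) ->
     e / 4 < \int[mu]_(x in D) (v n x * g x)].
have stepP s : {t | step s t}.
  apply: cid; case: (pselect (good s)) => [gs|]; last by exists s.
  case: s gs => k h gs; have [/= mh h1 h0] := gs.
  (* Budget for [hump_le]: the old function contributes more than -e/4, the hump more than e, and
     the remainder costs at most twice e/4, which leaves more than e/4. *)
  have e4 : 0 < e / 4 by rewrite divr_gt0.
  have /cvgrPdist_lt/(_ _ e4)[N _ hN] := vweak mh h1.
  have [n nk nbig] := big k (maxn N k).
  have {hN} := hN n (leq_trans (leq_maxl _ _) nk).
  rewrite /= sub0r normrN => hn.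
  have [m0 hm0] := vA n e4.
  pose m := maxn k.+1 m0.
  have km : (k < m)%N by rewrite leq_max leqnn.
  have hm : \int[mu]_(x in A m) `|v n x| < e / 4.
    apply/(le_lt_trans _ hm0)/Rintegral_normr_le => //.
    exact/Ani/leq_maxr.
  pose h' x := if x \in A m then 0 else if x \in A k then Num.sg (v n x) else h x.
  exists (m, h') => _; split => //=.
  - split => /=.
    + do 2 (apply: measurable_fun_if_mem => //).
      apply: measurableT_comp; first exact: measurable_sgr.
      by apply/measurable_EFinP; exact: measurable_int (iv n).
    + move=> x Dx; rewrite /h'; case: ifP => _; first by rewrite normr0.
      by case: ifP => _; [rewrite normr_sg lern1 leq_b1|exact: h1].
    + by move=> x Am; rewrite /h' mem_set.
  - move=> x Dx nAk; rewrite /h' (memNset nAk) memNset//.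
    by move/(Ani (ltnW km)).
  exists n; first by rewrite (leq_trans _ nk)// leq_maxr.
  move=> g mg g1 gE.
  have gE' x : D x -> ~ A m x -> g x = if x \in A k then Num.sg (v n x) else h x.
    by move=> Dx nAm; rewrite gE// /h' (memNset nAm).
  have := hump_le gs mg g1 (ltnW km) gE'.
  move: (ler_norm (- \int[mu]_(x in D) (v n x * h x))); rewrite normrN => hn'.
  lra.
pose s0 : nat * (T -> R) := (0%N, fun=> 0).
have [s [s00 sS]] := dependent_choice stepP s0.
have gs i : good (s i).
  elim: i => [|i IH]; last by have [] := sS i IH.
  by rewrite s00; split => //= x _; rewrite normr0.
have si i : (i <= (s i).1)%N.
  by elim: i => // i IH; have [_ + _ _] := sS i (gs i); exact: leq_ltn_trans.
have sst i j x : D x -> ~ A (s i).1 x -> (s (i + j)%N).2 x = (s i).2 x.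
  move=> Dx nA; elim: j => [|j IH]; first by rewrite addn0.
  rewrite addnS; have [_ _ E _] := sS _ (gs (i + j)%N); rewrite E//.
  move=> Aij; apply: nA; move: Aij; apply: Ani.
  elim: j {IH E} => [|j IH]; first by rewrite addn0.
  rewrite addnS; have [_ /ltnW + _ _] := sS _ (gs (i + j)%N).
  exact: leq_trans.
(* The limit of the test functions: off the level set of step [i] its value is frozen from that step
   on, and on the intersection of all the level sets it is 0. *)
pose g x := if pselect (exists i, ~ A (s i).1 x) is left ex
  then (s (projT1 (cid ex))).2 x else 0.
have gE i x : D x -> ~ A (s i).1 x -> g x = (s i).2 x.
  move=> Dx nA; rewrite /g; case: pselect => [ex|]; last by case; exists i.
  case: cid => j /= nAj.
  by rewrite -(sst j i x Dx nAj) addnC (sst i j x Dx nA).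
have mg : measurable_fun D g.
  apply: (@measurable_fun_cvg _ _ _ D (fun i => (s i).2)) => [i|x Dx].
    by have [] := gs i.
  case: (pselect (exists i, ~ A (s i).1 x)) => [[i nA]|nex].
    rewrite (gE _ _ Dx nA); apply: cvg_near_cst.
    exists i => // j /= ij; rewrite -(subnKC ij); exact/sst.
  have Ax i : A (s i).1 x by apply: contrapT => nA; apply: nex; exists i.
  rewrite /g; case: pselect => // _.
  rewrite (_ : (fun i => _) = fun=> 0); first exact: cvg_cst.
  by apply/funext => i; have [_ _ ->] := gs i.
have g1 x : D x -> `|g x| <= 1.
  move=> Dx; rewrite /g; case: pselect => [ex|_]; last by rewrite normr0.
  by have [_ + _] := gs (projT1 (cid ex)); exact.
have e4 : 0 < e / 4 by rewrite divr_gt0.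
have /cvgrPdist_lt/(_ _ e4)[N _ hN] := vweak mg g1.
have [_ _ _ [n sn hn]] := sS N (gs N).
have := hN n (leq_trans (si N) sn); rewrite /= sub0r normrN.
have := hn g mg g1 (fun x Dx nA => gE N.+1 x Dx nA).
by move=> /lt_le_trans/(_ (ler_norm _))/lt_trans h /h; rewrite ltxx.
Qed.
End gliding_hump.

Lemma exists_expr_lt (R : realType) (q s : R) : 0 <= q -> q < 1 -> 0 < s ->
  exists k : nat, q ^+ k < s.
Proof.
move=> q0 q1 s0.
have /cvg_expr/cvgrPdist_lt/(_ _ s0)[k _ hk] : `|q| < 1 by rewrite ger0_norm.
by exists k; have := hk k (leqnn k); rewrite /= sub0r normrN ger0_norm ?exprn_ge0.
Qed.

(** If it failed, sets [B j] of measure below 2^-(j+1) would each carry mass above [e] of some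
    [v n]. The tail unions [A k] decrease and have measure at most 2^-k, so each fixed [v n] has
    little mass on late ones, by absolute continuity of the integral. The gliding hump then bounds
    all [v n] by [e] on one [A k], which contains [B k]. *)
Lemma weakly_null_uniformly_integrable d (T : measurableType d) (R : realType)
    (mu : {measure set T -> \bar R}) (D : set T) (v : nat -> T -> R) :
  measurable D -> (forall n, mu.-integrable D (EFin \o v n)) ->
  (forall h : T -> R, measurable_fun D h -> (forall x, D x -> `|h x| <= 1) ->
    \int[mu]_(x in D) (v n x * h x) @[n --> \oo] --> (0 : R)) ->
  forall e : R, 0 < e -> exists2 m : R, 0 < m & forall B : set T,
    measurable B -> B `<=` D -> (mu B < m%:E)%E ->
    forall n, \int[mu]_(x in B) `|v n x| <= e.
Proof.
move=> mD iv vweak e e0; apply: contrapT => noM.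
have pick_ (j : nat) : {Bn : set T * nat | [/\ measurable Bn.1, Bn.1 `<=` D,
    (mu Bn.1 < ((2 ^+ j.+1)^-1)%:E)%E & e < \int[mu]_(x in Bn.1) `|v Bn.2 x|]}.
  apply: cid; apply: contrapT => /forallNP noB; apply: noM.
  exists ((2 ^+ j.+1)^-1); first by rewrite invr_gt0 exprn_gt0.
  move=> B mB BD muB n; rewrite leNgt; apply/negP => en.
  by apply: (noB (B, n)).
pose B j := (projT1 (pick_ j)).1; pose n_ j := (projT1 (pick_ j)).2.
have mB j : measurable (B j) by rewrite /B; case: (pick_ j) => ? [].
have BD j : B j `<=` D by rewrite /B; case: (pick_ j) => ? [].
have muB j : (mu (B j) < ((2 ^+ j.+1)^-1)%:E)%E by rewrite /B; case: (pick_ j) => ? [].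
have Be j : e < \int[mu]_(x in B j) `|v (n_ j) x|.
  by rewrite /B /n_; case: (pick_ j) => ? [].
pose A k := \bigcup_(j >= k) B j.
have mA k : measurable (A k) by exact: bigcup_measurable.
have AD k : A k `<=` D by apply: bigcup_sub => j _; exact: BD.
have Ani k m : (k <= m)%N -> A m `<=` A k.
  by move=> km x [j /= mj Bx]; exists j => //=; exact: leq_trans mj.
have muA k : (mu (A k) <= ((2 ^+ k)^-1)%:E)%E.
  apply: (@le_trans _ _ (\sum_(i <oo) mu (B (k + i)%N))%E).
    apply: measure_sigma_subadditive => //.
    by move=> x [j /= kj Bx]; exists (j - k)%N => //; rewrite subnKC.
  apply: (@le_trans _ _ (\sum_(i <oo) ((2 ^+ k)^-1 / (2 ^ i.+1)%:R)%:E)%E).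
    apply: lee_nneseries => // i _; rewrite (le_trans (ltW (muB _)))// lee_fin.
    by rewrite natrX -invfM -exprD addnS.
  by apply: (epsilon_trick0 xpredT); rewrite invr_ge0 exprn_ge0.
have [|k hk] := gliding_hump mD iv mA AD Ani _ vweak e0.
  move=> n r r0.
  have ivT : mu.-integrable setT (EFin \o (v n \_ D)).
    by rewrite -restrict_EFin; apply/integrable_restrict => //; rewrite setTI.
  have [s [s0 hs]] := integral_normr_continuous ivT r0.
  have [||k] := @exists_expr_lt R 2^-1 s _ _ s0; [by rewrite invr_ge0| |].
    by rewrite invf_lt1 ?ltr1n.
  rewrite exprVn => hk.
  exists k; suff -> : \int[mu]_(x in A k) `|v n x| = \int[mu]_(x in A k) `|(v n \_ D) x|.
    by apply: hs => //; rewrite (le_lt_trans (muA k))// lte_fin.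
  by apply: eq_Rintegral => x /set_mem Ax; rewrite patchE mem_set//; exact: AD Ax.
have := Be k; rewrite ltNge => /negP; apply.
apply: le_trans (hk (n_ k)); apply: Rintegral_normr_le => //.
- by move=> x Bx; exists k => /=.
- exact: integrableS (iv _).
Qed.

(** * Banach function spaces and their associate spaces *)

Lemma ae_imply d (T : measurableType d) (R : realType)
    (mu : {measure set T -> \bar R}) (P S : T -> Prop) :
  {ae mu, forall x, P x} -> (forall x, P x -> S x) -> {ae mu, forall x, S x}.
Proof. by move=> aeP PS; apply: filterS aeP. Qed.

Lemma ae_imply2 d (T : measurableType d) (R : realType)
    (mu : {measure set T -> \bar R}) (P Q S : T -> Prop) :
  {ae mu, forall x, P x} -> {ae mu, forall x, Q x} ->
  (forall x, P x -> Q x -> S x) -> {ae mu, forall x, S x}.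
Proof. by move=> aeP aeQ PQS; apply: (filterS2 _ _ aeP aeQ). Qed.

Lemma measurable_I01 {R : realType} : measurable (I01 : set R).
Proof. exact: measurable_itv. Qed.
#[local] Hint Extern 0 (_.-measurable I01) => exact: measurable_I01 : core.

Lemma lebesgue_I01 (R : realType) : @lebesgue_measure R I01 = 1%E.
Proof. by rewrite /I01 lebesgue_measure_itv/= lte_fin ltr01 oppr0 adde0. Qed.

Lemma I01E {R : realType} (x : R) : I01 x = (0 <= x <= 1) :> Prop.
Proof. by rewrite /I01/= in_itv. Qed.

Section banach_function_space_theory.
Context (R : realType) (X : set (R -> R)) (N : (R -> R) -> R).
Hypothesis bX : banach_function_space X N.
Local Notation lambda := (@lebesgue_measure R).
Implicit Types (f g : R -> R) (u : nat -> R -> R).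

Lemma bfs_N0 : N (fun=> 0) = 0.
Proof.
have := bfs_normZ bX 0 (bfs_zero bX); by rewrite normr0 !mul0r.
Qed.

Lemma bfs_le f g : X f -> measurable_fun I01 g ->
  (forall x, I01 x -> `|g x| <= `|f x|) -> X g /\ N g <= N f.
Proof. by move=> Xf mg gf; apply: bfs_ideal => //; exact: aeW. Qed.

Lemma bfs_N_ge0 f : X f -> 0 <= N f.
Proof.
move=> Xf; have [|_] := bfs_le Xf (measurable_cst (0 : R)).
  by move=> x _; rewrite normr0.
by rewrite bfs_N0.
Qed.

Lemma bfs_opp f : X f -> X (fun x => - f x) /\ N (fun x => - f x) = N f.
Proof.
move=> Xf; have E : (fun x => - f x) = (fun x => -1 * f x).
  by apply/funext => x; rewrite mulN1r.
rewrite E; split; first exact: (bfs_scale bX).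
by rewrite (bfs_normZ bX)// normrN1 mul1r.
Qed.

Lemma bfs_sub f g : X f -> X g -> X (f \- g).
Proof. by move=> Xf Xg; apply: (bfs_add bX Xf); have [] := bfs_opp Xg. Qed.

Lemma bfs_N_subC f g : X f -> X g -> N (f \- g) = N (g \- f).
Proof.
move=> Xf Xg; have [_ <-] := bfs_opp (bfs_sub Xf Xg).
by congr N; apply/funext => x /=; rewrite opprB.
Qed.

Lemma bfs_norm f : X f -> X (fun x => `|f x|) /\ N (fun x => `|f x|) <= N f.
Proof.
move=> Xf; apply: bfs_le => //; last by move=> x _; rewrite normr_id.
by apply: measurableT_comp => //; exact: bfs_measurable bX _ Xf.
Qed.

Lemma bfs_sum u n : (forall k, X (u k)) ->
  X (fun x => \sum_(k < n) u k x) /\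
  N (fun x => \sum_(k < n) u k x) <= \sum_(k < n) N (u k).
Proof.
move=> Xu; elim: n => [|n [XS NS]].
  rewrite big_ord0 (_ : (fun _ => _) = fun=> 0).
    by split; [exact: (bfs_zero bX)|rewrite bfs_N0].
  by apply/funext => x; rewrite big_ord0.
have E : (fun x => \sum_(k < n.+1) u k x) = (fun x => \sum_(k < n) u k x) \+ u n.
  by apply/funext => x; rewrite big_ord_recr.
rewrite E big_ord_recr; split; first exact: (bfs_add bX).
by apply: le_trans (bfs_normD bX _ _) _ => //=; rewrite lerD2r.
Qed.

(* A Riesz-Fischer bound: no Fatou property is available, but completeness
   provides an upper bound in [X] of an absolutely convergent series of
   nonnegative functions. *)
Lemma bfs_series_bound u (C : R) : (forall k, X (u k)) ->
  (forall k x, I01 x -> 0 <= u k x) ->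
  (forall n, \sum_(k < n) N (u k) <= C) ->
  exists S, [/\ X S, N S <= C & forall n,
    {ae lambda, forall x, I01 x -> \sum_(k < n) u k x <= S x}].
Proof.
move=> Xu u0 uC.
pose s n x := \sum_(k < n) u k x; pose p n := \sum_(k < n) N (u k).
have Xs n : X (s n) by have [] := bfs_sum n Xu.
have s_le n m : (n <= m)%N -> forall x, I01 x -> s n x <= s m x.
  move=> /subnKC <- x Ix; elim: (m - n)%N => [|j IH]; first by rewrite addn0.
  by rewrite addnS /s big_ord_recr (le_trans IH)//= lerDl u0.
have psub n m : (n <= m)%N -> N (s m \- s n) <= p m - p n.
  move=> /subnKC <-; elim: (m - n)%N => [|j IH].
    rewrite addn0 subrr (_ : _ \- _ = fun=> 0) ?bfs_N0//.
    by apply/funext => x /=; rewrite subrr.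
  rewrite addnS (_ : _ \- _ = (s (n + j)%N \- s n) \+ u (n + j)%N); last first.
    by apply/funext => x /=; rewrite /s big_ord_recr/= addrAC.
  apply: le_trans (bfs_normD bX _ _) _ => //; first exact: bfs_sub.
  by rewrite /p big_ord_recr/= addrAC lerD2r.
have p_le n m : (n <= m)%N -> p n <= p m.
  by move=> nm; rewrite -subr_ge0 (le_trans _ (psub _ _ nm))// bfs_N_ge0//; exact: bfs_sub.
have hs : has_sup (range p).
  by split; [exists (p 0%N), 0%N|exists C => _ [n _ <-]; exact: uC].
have [S XS scvg] : exists2 S, X S & N (s n \- S) @[n --> \oo] --> (0 : R).
  apply: (bfs_complete bX) => // e e0.
  have [_ [M _ <-] hM] := sup_adherent e0 hs; exists M.
  suff H m n : (M <= m)%N -> (m <= n)%N -> N (s n \- s m) < e.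
    move=> m n Mm Mn; have [mn|nm] := leqP m n; last exact/H/ltnW.
    by rewrite bfs_N_subC//; exact: H.
  move=> Mm mn; apply: le_lt_trans (psub _ _ mn) _.
  have : p n <= sup (range p) by apply: ub_le_sup; [case: hs|exists n].
  have := p_le _ _ Mm; move: hM; lra.
exists S; split => //.
- apply/ler_addgt0Pr => e e0.
  have /cvgrPdist_lt/(_ _ e0)[M _ /(_ M (leqnn M))] := scvg.
  rewrite /= sub0r normrN ger0_norm; last exact/bfs_N_ge0/bfs_sub.
  rewrite bfs_N_subC// => hM.
  rewrite (_ : S = s M \+ (S \- s M)).
    apply: le_trans (bfs_normD bX _ _) _ => //; first exact: bfs_sub.
    by apply: lerD; [apply: le_trans (uC M); have [] := bfs_sum M Xu|exact: ltW].
  by apply/funext => x /=; rewrite addrC subrK.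
(* The excess of the n-th partial sum over [S] lies below |s m - S| for every m >= n, because the
   partial sums increase. Its norm is therefore 0, and the excess vanishes almost everywhere. *)
- move=> n; pose w (x : R) : R := Num.max (s n x - S x) 0.
  have mw : measurable_fun I01 w.
    apply: measurable_maxr; last exact: measurable_cst.
    exact: (bfs_measurable bX (bfs_sub (Xs n) XS)).
  have wle m : (n <= m)%N -> forall x, I01 x -> `|w x| <= `|(s m \- S) x|.
    move=> nm x Ix; rewrite ger0_norm ?le_max ?lexx ?orbT//.
    rewrite /w ge_max normr_ge0 andbT (le_trans _ (ler_norm _))//=.
    by rewrite lerD2r; exact: s_le.
  have Xw : X w by have [] := bfs_le (bfs_sub (Xs n) XS) mw (wle n (leqnn n)).
  have Nw : N w = 0.
    apply/eqP; rewrite eq_le bfs_N_ge0// andbT; apply/ler_addgt0Pr => e e0.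
    have /cvgrPdist_lt/(_ _ e0)[M _ /(_ _ (leq_maxr n M))] := scvg.
    rewrite /= sub0r normrN ger0_norm; last exact/bfs_N_ge0/bfs_sub.
    move/ltW; rewrite add0r; apply: le_trans.
    by have [] := bfs_le (bfs_sub (Xs (maxn n M)) XS) mw (wle _ (leq_maxl n M)).
  apply: filterS (bfs_norm0 bX Xw Nw) => x /[apply] /=.
  move=> wx; have : s n x - S x <= w x by rewrite /w le_max lexx.
  by rewrite wx subr_le0.
Qed.

(** A countable triangle inequality for the norm. The number of terms may depend on the point and on
    [e], so [g] needs to be dominated only in the limit, with no uniformity. *)
Lemma bfs_series_dominated u (C : R) g : (forall k, X (u k)) ->
  (forall k x, I01 x -> 0 <= u k x) ->
  (forall n, \sum_(k < n) N (u k) <= C) ->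
  measurable_fun I01 g ->
  {ae lambda, forall x, I01 x ->
    forall e, 0 < e -> exists n : nat, `|g x| <= \sum_(k < n) u k x + e} ->
  X g /\ N g <= C.
Proof.
move=> Xu u0 uC mg gu; have [S [XS NS sS]] := bfs_series_bound Xu u0 uC.
suff /(bfs_ideal bX XS mg)[Xg Ng] :
  {ae lambda, forall x, I01 x -> `|g x| <= `|S x|}.
  by split => //; exact: le_trans NS.
have sS' : {ae lambda, forall x, forall n, I01 x -> \sum_(k < n) u k x <= S x}.
  exact: ae_foralln.
apply: (ae_imply2 sS' gu) => x Sx gx Ix.
apply: le_trans (ler_norm _); apply/ler_addgt0Pr => e e0.
have [n /le_trans] := gx Ix e e0; apply; rewrite lerD2r; exact: Sx.
Qed.

End banach_function_space_theory.

(** * Automatic boundedness of the functionals given by the associate space *)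

Section associate_space_theory.
Context (R : realType) (X : set (R -> R)) (N : (R -> R) -> R).
Hypothesis bX : banach_function_space X N.
Local Notation lambda := (@lebesgue_measure R).
Implicit Types (f g w : R -> R) (u : nat -> R -> R).

Lemma associate_integrable f w : X f -> associate_space X w ->
  lambda.-integrable I01 (EFin \o (fun t => f t * w t)).
Proof.
move=> Xf [mw fw]; apply/integrableP; split; last exact: fw.
by apply/measurable_EFinP/measurable_funM => //; exact: bfs_measurable bX _ Xf.
Qed.

(* A positive functional on a Banach lattice is automatically bounded: if not,
   the sum of suitably scaled witnesses would have infinite integral. *)
Lemma associate_bounded w : associate_space X w -> exists2 K : R, 0 <= K &
  forall f, X f -> (\int[lambda]_(t in I01) `|f t * w t|%:E <= (K * N f)%:E)%E.
Proof.
move=> Xw; apply: contrapT => noK.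
have pick_ n : {f | X f /\
    ((n%:R * 2 ^+ n.+1 * N f)%:E < \int[lambda]_(t in I01) `|f t * w t|%:E)%E}.
  apply: cid; apply: contrapT => /forallNP nof; apply: noK.
  exists (n%:R * 2 ^+ n.+1) => [|f Xf]; first by rewrite mulr_ge0 ?exprn_ge0.
  by rewrite leNgt; apply/negP => fn; exact: (nof f).
pose f n := projT1 (pick_ n).
have Xf n : X (f n) by rewrite /f; case: (pick_ n) => ? [].
have fbig n : ((n%:R * 2 ^+ n.+1 * N (f n))%:E <
    \int[lambda]_(t in I01) `|f n t * w t|%:E)%E.
  by rewrite /f; case: (pick_ n) => ? [].
have Nf n : 0 < N (f n).
  rewrite lt_neqAle (bfs_N_ge0 bX)// andbT; apply/eqP => /esym/(bfs_norm0 bX (Xf n)) f0.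
  have := fbig n; rewrite (ae_eq_integral (cst 0%E))//.
  - rewrite integral_cst// mul0e lte_fin ltNge => /negP; apply.
    by rewrite mulr_ge0 ?(bfs_N_ge0 bX)// mulr_ge0// exprn_ge0.
  - have /measurable_int := associate_integrable (Xf n) Xw.
    by move=> /measurable_EFinP mfw; apply/measurable_EFinP; exact: measurableT_comp.
  - apply: (ae_imply f0) => t /[apply] /= ->.
    by rewrite mul0r normr0.
(* With this scaling the norms are at most 2^-(n+1), with total at most 1, while the integrals
   against [w] still exceed [n]. *)
pose c n : R := (2 ^+ n.+1 * N (f n))^-1.
have c0 n : 0 <= c n by rewrite invr_ge0 mulr_ge0 ?exprn_ge0// ltW.
have := @bfs_series_bound _ _ _ bX (fun n t => c n * `|f n t|) 1.
case.
- by move=> n; apply: (bfs_scale bX); have [] := bfs_norm bX (Xf n).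
- by move=> n x _; rewrite mulr_ge0.
- move=> n; apply: (@le_trans _ _ (\sum_(k < n) (2^-1) ^+ k.+1)).
    apply: ler_sum => k _; have [Xa Na] := bfs_norm bX (Xf k).
    rewrite (bfs_normZ bX)// ger0_norm// (le_trans (ler_wpM2l _ Na))//.
    by rewrite /c invfM -mulrA mulVf ?gt_eqF// mulr1 exprVn.
  suff -> : \sum_(k < n) (2^-1) ^+ k.+1 = 1 - (2^-1) ^+ n :> R.
    by rewrite gerBl exprn_ge0// invr_ge0.
  elim: n => [|n IH]; first by rewrite big_ord0 expr0 subrr.
  by rewrite big_ord_recr/= IH exprS; field.
move=> S [XS NS sS].
have Sw := associate_integrable XS Xw.
have fin : (\int[lambda]_(t in I01) `|S t * w t|%:E < +oo)%E by have [_] := Xw; exact.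
have big n : (n%:R%:E <= \int[lambda]_(t in I01) `|S t * w t|%:E)%E.
  have cn : c n * (n%:R * 2 ^+ n.+1 * N (f n)) = n%:R.
    by rewrite /c -mulrA mulrCA mulVf ?mulr1// gt_eqF// mulr_gt0// exprn_gt0.
  apply: (@le_trans _ _ ((c n)%:E * \int[lambda]_(t in I01) `|f n t * w t|%:E)%E).
    by rewrite -[in leLHS]cn EFinM lee_wpmul2l// ?lee_fin// ltW.
  have mfw : measurable_fun I01 (fun t => `|f n t * w t|%:E).
    have /measurable_int := associate_integrable (Xf n) Xw.
    by move=> /measurable_EFinP m; apply/measurable_EFinP; exact: measurableT_comp.
  rewrite -ge0_integralZl_EFin//.
  apply: ae_ge0_le_integral => //.
  - by move=> t _; rewrite mule_ge0// lee_fin.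
  - exact: measurable_funeM.
  - have /measurable_int := Sw.
    by move=> /measurable_EFinP m; apply/measurable_EFinP; exact: measurableT_comp.
  - apply: (ae_imply (sS n.+1)) => t + It; move/(_ It) => St.
    rewrite -EFinM lee_fin !normrM mulrA ler_wpM2r//.
    apply: le_trans (le_trans St (ler_norm _)).
    by rewrite big_ord_recr/= lerDr sumr_ge0// => k _; rewrite mulr_ge0.
have finn : (\int[lambda]_(t in I01) `|S t * w t|%:E)%E \is a fin_num.
  by rewrite ge0_fin_numE// integral_ge0.
have := big (Num.truncn (fine (\int[lambda]_(t in I01) `|S t * w t|%:E))).+1.
rewrite -(fineK finn) lee_fin leNgt => /negP; apply.
exact: truncnS_gt.
Qed.

End associate_space_theory.

(** * Weak convergence tested against the associate space *)

Section weak_convergence.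
Context (R : realType) (X : set (R -> R)) (N : (R -> R) -> R).
Hypothesis bX : banach_function_space X N.
Local Notation lambda := (@lebesgue_measure R).
Implicit Types (f g w h : R -> R) (u : nat -> R -> R).

Lemma Rintegral_le_ereal (D : set R) f (C : R) : measurable D ->
  lambda.-integrable D (EFin \o f) ->
  (\int[lambda]_(t in D) `|f t|%:E <= C%:E)%E ->
  \int[lambda]_(t in D) `|f t| <= C.
Proof.
move=> mD fi fC; rewrite /Rintegral -lee_fin fineK//.
exact: integrable_fin_num (integrable_norm fi).
Qed.

Lemma integrable_measurable_norm (D : set R) f : measurable D ->
  lambda.-integrable D (EFin \o f) -> measurable_fun D (fun t => `|f t|%:E).
Proof.
move=> mD /measurable_int/measurable_EFinP mf.
by apply/measurable_EFinP; exact: measurableT_comp.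
Qed.

(** Weak convergence enters the proof only through these functionals, with [w] equal to N(F_y) for
    the part near 0 and to 1 for the primitives. The bounded factor [h] supplies the test functions
    of the gliding hump and the indicators of initial intervals. *)
Lemma associate_functional w h : associate_space X w ->
  measurable_fun I01 h -> (forall t, I01 t -> `|h t| <= 1) ->
  bounded_functional X N (fun f => \int[lambda]_(t in I01) (f t * w t * h t)).
Proof.
move=> Xw mh h1.
have fwh f : X f -> lambda.-integrable I01 (EFin \o (fun t => f t * w t * h t)).
  move=> Xf; exact: (@integrable_mul_le1 _ _ _ lambda I01 measurable_I01 (fun t => f t * w t) h
    (associate_integrable bX Xf Xw) mh h1).
split.
  move=> a f g Xf Xg; rewrite -RintegralZl//; last exact: fwh.
  rewrite -RintegralD//; [|exact: (integrableZl _ a (fwh _ Xf))|exact: fwh].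
  by apply: eq_Rintegral => t _; ring.
have [K K0 hK] := associate_bounded bX Xw.
exists K => f Xf; apply: le_trans (le_normr_Rintegral _ (fwh _ Xf)) _ => //.
apply: Rintegral_le_ereal (fwh _ Xf) _ => //.
apply: le_trans (hK f Xf); apply: ge0_le_integral => //.
- exact: integrable_measurable_norm (fwh _ Xf).
- exact: integrable_measurable_norm (associate_integrable bX Xf Xw).
- by move=> t It; rewrite lee_fin normrM ler_piMr// h1.
Qed.

Lemma weakly_cvg_uniformly_integrable w u f : associate_space X w ->
  weakly_cvg X N u f ->
  forall e : R, 0 < e -> exists2 m : R, 0 < m & forall B : set R,
    measurable B -> B `<=` I01 -> (lambda B < m%:E)%E ->
    forall n, \int[lambda]_(t in B) `|(u n t - f t) * w t| <= e.
Proof.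
move=> Xw [Xu Xf uf].
apply: (@weakly_null_uniformly_integrable _ _ _ lambda I01
  (fun n t => (u n t - f t) * w t)) => //.
  by move=> n; exact: (associate_integrable bX (bfs_sub bX (Xu n) Xf) Xw).
move=> h mh h1; have lh := associate_functional Xw mh h1.
have := uf _ lh; move/subr_cvg0.
rewrite (_ : (fun n => _ - _) =
  (fun n => \int[lambda]_(t in I01) ((u n t - f t) * w t * h t))) //.
apply/funext => n; have [lin _] := lh.
have := lin (-1) f (u n) Xf (Xu n).
rewrite mulN1r addrC => <-.
by apply: eq_Rintegral => t _; ring.
Qed.

End weak_convergence.

(** * Rearrangement invariant spaces *)

Section rearrangement_theory.
Context (R : realType).
Local Notation lambda := (@lebesgue_measure R).
Implicit Types (f g : R -> R) (A B : set R) (s t x y : R).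

Lemma measurable_inv_I01 : measurable_fun I01 (fun x : R => x^-1).
Proof.
(* The two functions agree at 0 as well, where both are 0 by convention. *)
apply: (eq_measurable_fun (fun x => x `^ (-1))).
  by move=> x /set_mem; rewrite I01E => /andP[x0 _]; rewrite powR_inv1.
exact: measurable_funS (measurable_powR (-1)).
Qed.

Lemma measurable_F y : measurable_fun I01 (F_ y : R -> R).
Proof.
apply: measurable_funM; first exact: measurable_inv_I01.
by apply: measurable_indic; exact: measurable_itv.
Qed.

Lemma measurable_superlevel f t : measurable_fun I01 f ->
  measurable (I01 `&` [set x | t < `|f x|]).
Proof.
move=> mf; have mnf : measurable_fun I01 (fun x => `|f x|) by exact: measurableT_comp.
have := mnf measurable_I01 `]t, +oo[%classic (measurable_itv _).
congr (measurable (_ `&` _)); apply/seteqP; split => x /=; rewrite in_itv/= ?andbT//.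
Qed.

Lemma rearrangement_le f g :
  (forall t, 0 <= t -> (distribution_function g t <= distribution_function f t)%E) ->
  forall s, (rearrangement g s <= rearrangement f s)%E.
Proof.
move=> gf s; apply: ereal_inf_le_tmp => _ [t [t0 ts] <-]; exists t => //.
by split => //; exact: le_trans (gf t t0) ts.
Qed.

Lemma distribution_indic A t : 0 <= t ->
  distribution_function (\1_A) t = if t < 1 then lambda (I01 `&` A) else 0%E.
Proof.
move=> t0; rewrite /distribution_function; case: ifPn => t1.
  congr (lambda (_ `&` _)); apply/seteqP; split => x /=; rewrite indicE.
    by case: (asboolP (A x)) => // nA; rewrite memNset// normr0 ltNge t0.
  by move=> Ax; rewrite mem_set// normr1.
rewrite (_ : _ `&` _ = set0) ?measure0// -subset0 => x /= [_]; rewrite indicE.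
by case: (_ \in _); rewrite ?normr1 ?normr0; [rewrite (negbTE t1)|rewrite ltNge t0].
Qed.

End rearrangement_theory.

Section rearrangement_invariant.
Context (R : realType) (X : set (R -> R)) (N : (R -> R) -> R).
Hypothesis rX : ri_space X N.
Let bX := ri_bfs rX.
Local Notation lambda := (@lebesgue_measure R).
Implicit Types (f g w : R -> R) (A B : set R).

Lemma ri_le f g : X f -> measurable_fun I01 g ->
  (forall t, 0 <= t -> (distribution_function g t <= distribution_function f t)%E) ->
  X g /\ N g <= N f.
Proof.
by move=> Xf mg gf; apply: (ri_rearrangement rX) => // s _; exact: rearrangement_le.
Qed.

Lemma ri_indic_le A B : measurable B -> X (\1_A) ->
  (lambda (I01 `&` B) <= lambda (I01 `&` A))%E ->
  X (\1_B) /\ N (\1_B) <= N (\1_A).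
Proof.
move=> mB XA BA; apply: (ri_le XA) => [|t t0]; first exact: measurable_indic.
by rewrite !distribution_indic//; case: ifP.
Qed.

(** A nonzero f exceeds 1/(n+1) in modulus on a set of positive measure for some n, and the
    indicator of this set is at most (n+1)|f|. *)
Lemma ri_exists_indic : exists2 A, measurable A /\ (0 < lambda (I01 `&` A))%E & X (\1_A).
Proof.
have [f Xf fN0] := ri_nontrivial rX.
have mf := bfs_measurable bX Xf.
pose E (n : nat) : set R := I01 `&` [set x | n.+1%:R^-1 < `|f x|].
have mE n : measurable (E n) by exact: measurable_superlevel.
have [n fn] : exists n : nat, (0 < lambda (E n))%E.
  apply: contrapT => /forallNP f0; apply: fN0.
  have : {ae lambda, forall x, forall n : nat, I01 x -> `|f x| <= n.+1%:R^-1}.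
    apply: ae_foralln => n; exists (E n); split.
    - exact: mE.
    - by apply/eqP; rewrite eq_le measure_ge0 andbT leNgt; apply/negP/f0.
    - by move=> x /= /not_implyP[Ix /negP]; rewrite -ltNge.
  move=> h; apply: (ae_imply h) => x fx Ix.
  apply/normr0_eq0/eqP; rewrite eq_le normr_ge0 andbT leNgt; apply/negP => fx0.
  have [k _ /(_ k (leqnn k))] := near_infty_natSinv_lt (PosNum fx0).
  by rewrite /= ltNge fx.
exists (E n); first by split => //; rewrite setIA setIid.
have [||//] := bfs_le bX (bfs_scale bX n.+1%:R Xf) (g := \1_(E n)).
  exact: measurable_indic.
move=> x Ix; rewrite indicE normrM; case: (asboolP (E n x)) => fx.
  by rewrite mem_set// normr1 ger0_norm// -ler_pdivrMl// mulr1 ltW//; case: fx.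
by rewrite memNset ?normr0 ?mulr_ge0.
Qed.

(** Rearrangement invariance carries the indicator of [A] to every interval no longer than the
    measure of [A]; finitely many such intervals cover [0,1], and the sum of their indicators is at
    least 1. *)
Lemma ri_cst1 : X (fun=> 1).
Proof.
have [A [mA A0] XA] := ri_exists_indic.
have fA : lambda (I01 `&` A) \is a fin_num.
  rewrite ge0_fin_numE// (@le_lt_trans _ _ (lambda I01))//.
    by apply: le_measure; rewrite ?inE//; exact: measurableI.
  by rewrite lebesgue_I01 ltry.
have A0' : 0 < fine (lambda (I01 `&` A)) by rewrite fine_gt0// A0 ltey_eq fA.
have [n _ /(_ n (leqnn n))/= nA] := near_infty_natSinv_lt (PosNum A0').
pose B k := `[k%:R / n.+1%:R, k.+1%:R / n.+1%:R]%classic : set R.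
have XB k : X (\1_(B k)).
  have [||//] := @ri_indic_le A (B k) _ XA; first exact: measurable_itv.
  apply: (@le_trans _ _ (lambda (B k))).
    apply: le_measure; rewrite ?inE//; last exact: measurable_itv.
    by apply: measurableI => //; exact: measurable_itv.
  rewrite /B lebesgue_measure_itv/= -(fineK fA).
  case: ifPn => _; last by rewrite lee_fin ltW.
  by rewrite lee_fin -mulrBl -natrB// subSnn mul1r ltW.
have [XS _] := bfs_sum bX n.+1 XB.
have [||//] := bfs_le bX XS (g := fun=> 1); first exact: measurable_cst.
move=> x; rewrite I01E => /andP[x0 x1]; rewrite normr1 ger0_norm; last by apply: sumr_ge0.
have x0' : 0 <= x * n.+1%:R by rewrite mulr_ge0.
(* The minimum matters only at x = 1, where the truncation would give n+1. *)
pose i := minn n (Num.truncn (x * n.+1%:R)).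
have iB : B i x.
  rewrite /B/= in_itv/= ler_pdivrMr ?ltr0n// ler_pdivlMr ?ltr0n//.
  have := truncn_itv x0' => /andP[tx xt]; apply/andP; split.
    by rewrite (le_trans _ tx)// ler_nat geq_minr.
  rewrite /i /minn; case: ifPn => _; last exact: ltW.
  by rewrite -[leRHS]mul1r ler_wpM2r.
rewrite (bigD1 (inord i))//= inordK ?ltnS ?geq_minl//.
by rewrite indicE mem_set// lerDl sumr_ge0.
Qed.

Lemma ri_bounded g (M : R) : measurable_fun I01 g ->
  (forall x, I01 x -> `|g x| <= M) -> X g /\ N g <= M * N (fun=> 1).
Proof.
move=> mg gM; have M0 : 0 <= M.
  by apply: le_trans (gM 0 _) => //; rewrite I01E lexx ler01.
have := bfs_normZ bX M ri_cst1; rewrite ger0_norm// => <-.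
apply: (bfs_le bX (bfs_scale bX M ri_cst1) mg).
by move=> x Ix; rewrite mulr1 (ger0_norm M0) gM.
Qed.

End rearrangement_invariant.

Lemma lebesgue_measure_onem (R : realType) (A : set R) : measurable A ->
  lebesgue_measure ((fun x => 1 - x) @^-1` A) = lebesgue_measure A.
Proof.
move=> mA.
have mf : measurable_fun setT ((fun x => 1 - x) : measurableTypeR R -> measurableTypeR R).
  by apply: measurable_funB.
rewrite -[LHS]/(pushforward lebesgue_measure
  ((fun x => 1 - x) : measurableTypeR R -> measurableTypeR R) A).
apply/esym/lebesgue_measure_unique => //= _ [[a b]] _ <-.
rewrite /pushforward/= (_ : _ @^-1` _ = `[1 - b, 1 - a[%classic).
  rewrite !lebesgue_measure_itv/= !lte_fin ltrD2l ltrN2.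
  by case: ifP => // _; rewrite -!EFinD; congr EFin; ring.
by apply/seteqP; split => x /=; rewrite !in_itv/= => /andP[ax xb]; apply/andP; split; lra.
Qed.

Section Cesaro_weight.
Context (R : realType) (X : set (R -> R)) (N : (R -> R) -> R).
Hypothesis rX : ri_space X N.
Let bX := ri_bfs rX.
Local Notation lambda := (@lebesgue_measure R).
Implicit Types (f g w : R -> R) (x y z a : R).

Lemma F_ge0 y x : 0 <= x -> 0 <= F_ y x.
Proof. by move=> x0; rewrite /F_ mulr_ge0 ?invr_ge0// indicE. Qed.

Lemma F_E y x : F_ y x = if y <= x <= 1 then x^-1 else 0.
Proof.
rewrite /F_ indicE; case: (asboolP (`[y, 1]%classic x)) => yx.
  by rewrite mem_set// mulr1; move: yx; rewrite /= in_itv/= => ->.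
by rewrite memNset// mulr0; move: yx; rewrite /= in_itv/= => /negP/negbTE ->.
Qed.

Lemma F_in y : 0 < y -> X (F_ y).
Proof.
move=> y0; have [||//] := ri_bounded rX (g := F_ y) (M := y^-1).
  exact: measurable_F.
move=> x; rewrite I01E F_E => /andP[x0 x1]; case: ifPn => [/andP[yx _]|_].
  by rewrite ger0_norm ?invr_ge0// lef_pV2// posrE (lt_le_trans y0).
by rewrite normr0 invr_ge0 ltW.
Qed.

Lemma F_anti y z : 0 < y -> y <= z -> N (F_ z) <= N (F_ y).
Proof.
move=> y0 yz; have [||//] := bfs_le bX (F_in y0) (g := F_ z).
  exact: measurable_F.
move=> x; rewrite I01E => /andP[x0 x1]; rewrite !ger0_norm ?F_ge0// !F_E x1 !andbT.
case: ifPn => [zx|_]; first by rewrite (le_trans yz zx).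
by case: ifPn => // _; rewrite invr_ge0.
Qed.

(** F_(a/2) exceeds F_a only on [a/2, a[, by at most 2/a. The interval [a/2, a] is shorter than
    [a, 2a], whose indicator is at most 2a F_a and which lies in [0,1] because a <= 1/2. The
    constant is 1 + (2/a)(2a) = 5. *)
Lemma F_half a : 0 < a -> a <= 2^-1 -> N (F_ (a / 2)) <= 5 * N (F_ a).
Proof.
move=> a0 a12; have a20 : 0 < a / 2 by rewrite divr_gt0.
have aa : a <= 2 * a by lra.
have mI (b c : R) : measurable_fun I01 (\1_(`[b, c]%classic : set R) : R -> R).
  by apply: measurable_indic; exact: measurable_itv.
have [X1 N1] : X (\1_(`[a, 2 * a]%classic : set R)) /\
    N (\1_(`[a, 2 * a]%classic : set R)) <= 2 * a * N (F_ a).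
  have := bfs_normZ bX (2 * a) (F_in a0); rewrite ger0_norm ?mulr_ge0 ?(ltW a0)// => <-.
  apply: (bfs_le bX) => //; first by apply: (bfs_scale bX); exact: F_in.
  move=> x; rewrite I01E => /andP[x0 x1]; rewrite indicE.
  case: (asboolP (`[a, 2 * a]%classic x)) => [ax|nax]; last first.
    by rewrite memNset// normr0.
  rewrite mem_set// normr1; move: ax; rewrite /= in_itv/= => /andP[ax xa].
  have xp : 0 < x by exact: lt_le_trans ax.
  rewrite F_E ax x1/= ger0_norm ?mulr_ge0 ?invr_ge0//; last by rewrite ltW.
  by rewrite ler_pdivlMr// mul1r.
have [X2 N2] : X (\1_(`[a / 2, a]%classic : set R)) /\
    N (\1_(`[a / 2, a]%classic : set R)) <= N (\1_(`[a, 2 * a]%classic : set R)).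
  apply: (ri_indic_le rX) => //.
  rewrite (setIidr (_ : `[a, 2 * a]%classic `<=` I01)); last first.
    by move=> x; rewrite I01E/= in_itv/= => /andP[ax xa]; apply/andP; split; lra.
  rewrite (setIidr (_ : `[a / 2, a]%classic `<=` I01)); last first.
    by move=> x; rewrite I01E/= in_itv/= => /andP[ax xa]; apply/andP; split; lra.
  rewrite !lebesgue_measure_itv/= !lte_fin.
  have -> : a / 2 < a by lra.
  have -> : a < 2 * a by lra.
  by rewrite -!EFinB lee_fin; lra.
pose h := fun x => 2 / a * \1_(`[a / 2, a]%classic : set R) x.
have a20' : 0 <= 2 / a by rewrite divr_ge0// ltW.
have Xh : X h by exact: (bfs_scale bX).
have [||_ le1] := bfs_le bX (bfs_add bX (F_in a0) Xh) (g := F_ (a / 2)).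
- exact: measurable_F.
- move=> x; rewrite I01E => /andP[x0 x1] /=.
  have h0 : 0 <= h x by rewrite /h mulr_ge0.
  rewrite (ger0_norm (F_ge0 _ x0)) (ger0_norm (addr_ge0 (F_ge0 _ x0) h0)).
  have [ax|xa] := leP a x.
    rewrite !F_E x1 !andbT ax; case: ifP => _; first by rewrite lerDl.
    by rewrite addr_ge0// invr_ge0.
  rewrite (F_E a) (leNgt a) xa/= add0r F_E x1 andbT; case: ifPn => // a2x.
  rewrite /h indicE mem_set ?mulr1; last by rewrite /= in_itv/= a2x ltW.
  by rewrite -[2 / a]invf_div lef_pV2 ?posrE//; exact: lt_le_trans a2x.
apply: le_trans le1 _; apply: le_trans (bfs_normD bX (F_in a0) Xh) _.
rewrite /h (bfs_normZ bX)// ger0_norm// (_ : 5 * _ = N (F_ a) + 4 * N (F_ a)); last by ring.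
rewrite lerD2l; apply: (@le_trans _ _ (2 / a * (2 * a * N (F_ a)))).
  by rewrite ler_wpM2l// (le_trans N2).
by rewrite le_eqVlt; apply/orP; left; apply/eqP; field; rewrite gt_eqF.
Qed.

Lemma F_gt0 : 0 < N (F_ 2^-1).
Proof.
have h0 : 0 < 2^-1 :> R by rewrite invr_gt0.
rewrite lt_neqAle (bfs_N_ge0 bX (F_in h0)) andbT; apply/eqP => /esym NF0.
have [Z [mZ Z0 hZ]] := bfs_norm0 bX (F_in h0) NF0.
have : (lambda `[2^-1%R, 1%R] <= lambda Z)%E.
  apply: le_measure; rewrite ?inE//.
  move=> x /=; rewrite in_itv/= => /andP[x2 x1]; apply: hZ => /=.
  have x0 : 0 < x by exact: lt_le_trans x2.
  rewrite I01E x1 (ltW x0) => /(_ isT); rewrite F_E x2 x1/= => /eqP.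
  by rewrite gt_eqF// invr_gt0.
rewrite Z0 lebesgue_measure_itv/= lte_fin ifT; last by rewrite invf_lt1// ltr1n.
by rewrite -EFinB lee_fin; lra.
Qed.

Hypothesis XF : associate_space X (fun y => N (F_ y)).

(** On ]0, 1/2] the weight N(F_t) is at least N(F_(1/2)) > 0, by monotonicity. Near 1 the weight may
    tend to 0, so the other half of the interval has to be treated differently. *)
Lemma half_integrable f : X f -> (\int[lambda]_(t in `[0%R, 2^-1%R]) `|f t|%:E < +oo)%E.
Proof.
move=> Xf; have [mF fin] := XF.
have sub : `[0, 2^-1]%classic `<=` (I01 : set R).
  move=> x; rewrite I01E/= in_itv/= => /andP[-> x2] /=.
  by rewrite (le_trans x2)// invf_le1// ler1n.
have mf := bfs_measurable bX Xf.
have mnf : measurable_fun (`[0, 2^-1]%classic : set R) (fun t => `|f t|%:E).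
  by apply/measurable_EFinP; apply: measurableT_comp => //; exact: measurable_funS mf.
have sub' : `]0, 2^-1]%classic `<=` (I01 : set R).
  by apply: subset_trans sub; exact: subset_itv_oc_cc.
have mf' : measurable_fun (`]0, 2^-1]%classic : set R) (fun t => `|f t|%:E).
  by apply: measurable_funS mnf => //; exact: subset_itv_oc_cc.
have mfF : measurable_fun I01 (fun t => `|f t * N (F_ t)|%:E).
  by apply/measurable_EFinP; apply: measurableT_comp => //; exact: measurable_funM.
(* The point 0 is removed because F_0 need not belong to [X], and then its [N] is arbitrary. *)
rewrite -integral_itv_obnd_cbnd//.
rewrite -(@lte_pmul2l _ (N (F_ 2^-1))%:E) ?lte_fin ?F_gt0//.
rewrite gt0_muley ?lte_fin ?F_gt0// -ge0_integralZl_EFin//; last exact/ltW/F_gt0.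
apply: le_lt_trans (fin f Xf).
apply: (@le_trans _ _ (\int[lambda]_(t in `]0%R, 2^-1%R]) `|f t * N (F_ t)|%:E)%E).
  apply: ge0_le_integral => //.
  - by move=> t _; rewrite mule_ge0 ?lee_fin// ltW// F_gt0.
  - exact: measurable_funeM.
  - by apply: measurable_funS mfF.
  - move=> t; rewrite /= in_itv/= => /andP[t0 t2].
    by rewrite lee_fin normrM mulrC ler_wpM2l// (le_trans (F_anti t0 t2))// ler_norm.
by apply: ge0_subset_integral => //; exact: measurable_itv.
Qed.

Lemma onem_in f : X f -> X (fun x => f (1 - x)).
Proof.
move=> Xf; have mf := bfs_measurable bX Xf.
have I01onem : (fun x => 1 - x) @^-1` I01 = I01 :> set R.
  by apply/seteqP; split => x /=; rewrite !I01E => /andP[? ?]; apply/andP; split; lra.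
have [||//] := ri_le rX Xf (g := fun x => f (1 - x)).
  apply: (measurable_comp (F := I01)) => //; last exact: measurable_funB.
  by move=> _ [x + <-]; rewrite -[X in X x -> _]I01onem.
move=> t t0; rewrite /distribution_function -[in leRHS]lebesgue_measure_onem; last first.
  exact: measurable_superlevel.
by rewrite preimage_setI I01onem.
Qed.

(** This is the inclusion of [X] in L^1. The mass of f on ]1/2, 1] is at most the mass of t |-> f(1
    - t) on [0, 1/2], and this reflected function belongs to [X] because it has the same
    distribution function. *)
Lemma associate_cst1 : associate_space X (fun=> 1).
Proof.
split => [|f Xf]; first exact: measurable_cst.
have mf := bfs_measurable bX Xf.
have mnf : measurable_fun I01 (fun t => `|f t|%:E).
  by apply/measurable_EFinP; exact: measurableT_comp.
under eq_integral do rewrite mulr1.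
have I01U : I01 = `[0, 2^-1]%classic `|` `]2^-1, 1]%classic :> set R.
  apply/seteqP; split => x /=; rewrite I01E !in_itv/=.
    by move=> /andP[x0 x1]; have [x2|x2] := leP x 2^-1; [left|right]; rewrite ?x0 ?x1.
  by case => /andP[? ?]; apply/andP; split; lra.
rewrite I01U ge0_integral_setU//=; first last.
- apply/disj_set2P/seteqP; split => // x /=; rewrite !in_itv/= => -[/andP[_ x2]].
  by rewrite ltNge x2.
- by rewrite -I01U.
rewrite lte_add_pinfty//; first exact: half_integrable.
apply: le_lt_trans (half_integrable (onem_in Xf)).
have m12 : measurable (`[2^-1, 1]%classic : set (measurableTypeR R)) by exact: measurable_itv.
have mf12 : measurable_fun (`[2^-1, 1]%classic : set R) (fun t => `|f t|%:E).
  apply: measurable_funS mnf => // x; rewrite /= I01E in_itv/=.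
  by move=> /andP[? ?]; apply/andP; split; lra.
apply: (@le_trans _ _ (\int[lambda]_(t in `[2^-1%R, 1%R]) `|f t|%:E)%E).
  by apply: ge0_subset_integral => //; exact: subset_itv_oc_cc.
pose om := (fun x => 1 - x) : measurableTypeR R -> measurableTypeR R.
have mom : measurable_fun setT om by exact: measurable_funB.
have -> : `[0, 2^-1]%classic = om @^-1` `[2^-1, 1]%classic.
  by apply/seteqP; split => x /=; rewrite /om !in_itv/= => /andP[? ?]; apply/andP; split; lra.
rewrite -(ge0_integral_pushforward mom _ m12 (f := fun t => `|f t|%:E))//.
rewrite le_eqVlt; apply/orP; left; apply/eqP; apply: eq_measure_integral => A mA _.
exact/esym/lebesgue_measure_onem.
Qed.

End Cesaro_weight.

(** * The Cesaro operator *)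

Section initial_integral.
Context (R : realType).
Local Notation lambda := (@lebesgue_measure R).
Implicit Types (v : R -> R) (x y a e : R).

Definition absint v x : R := \int[lambda]_(t in `[0, x]) `|v t|.

Lemma itv0_sub_I01 x : x <= 1 -> `[0, x]%classic `<=` (I01 : set R).
Proof.
by move=> x1 t; rewrite I01E/= in_itv/= => /andP[-> tx]; rewrite (le_trans tx x1).
Qed.

Variable v : R -> R.
Hypothesis iv : lambda.-integrable I01 (EFin \o v).

Lemma absint_ge0 x : 0 <= absint v x.
Proof. by apply: Rintegral_ge0 => t _. Qed.

Lemma absint_le x y : x <= y -> y <= 1 -> absint v x <= absint v y.
Proof.
move=> xy y1; apply: Rintegral_normr_le => //.
- by move=> t /=; rewrite !in_itv/= => /andP[-> tx]; exact: le_trans xy.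
- by apply: integrableS iv => //; exact: itv0_sub_I01.
Qed.

Lemma absintB x y : 0 <= x -> x <= y -> y <= 1 ->
  absint v y - absint v x = \int[lambda]_(t in `]x, y]) `|v t|.
Proof.
move=> x0 xy y1; rewrite /absint Rintegral_itvB ?bnd_simp//.
apply: integrable_norm; apply: integrableS iv => //; exact: itv0_sub_I01.
Qed.

Lemma absint_small e : 0 < e ->
  exists2 d, 0 < d & forall x, 0 <= x -> x < d -> x <= 1 -> absint v x < e.
Proof.
move=> e0.
have ivT : lambda.-integrable setT (EFin \o (v \_ I01)).
  by rewrite -restrict_EFin; apply/integrable_restrict => //; rewrite setTI.
have [d [d0 hd]] := integral_normr_continuous ivT e0.
exists d => // x x0 xd x1.
suff -> : absint v x = \int[lambda]_(t in `[0, x]) `|(v \_ I01) t|.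
  apply: hd; first exact: measurable_itv.
  rewrite -[ltLHS]/(lambda `[0%R, x]%classic) lebesgue_measure_itv/= lte_fin.
  case: ifP => _; last by rewrite lte_fin.
  by rewrite -EFinB lte_fin subr0.
apply: eq_Rintegral => t /set_mem xt; rewrite patchE mem_set//.
exact: itv0_sub_I01 xt.
Qed.

End initial_integral.

Section Cesaro_estimate.
Context (R : realType) (X : set (R -> R)) (N : (R -> R) -> R).
Hypothesis rX : ri_space X N.
Hypothesis XF : associate_space X (fun y => N (F_ y)).
Let bX := ri_bfs rX.
Local Notation lambda := (@lebesgue_measure R).
Implicit Types (f g h : R -> R) (x y a e : R).

Lemma ri_integrable f : X f -> lambda.-integrable I01 (EFin \o f).
Proof.
move=> Xf; have := associate_integrable bX Xf (associate_cst1 rX XF).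
by congr (_.-integrable _ _); apply/funext => t /=; rewrite mulr1.
Qed.

(** The weight N(F_t) is smallest on ]a, b] at the right end. The functions used to dominate the
    Cesaro mean carry the left end instead; on dyadic intervals [F_half] closes this gap. *)
Lemma F_absint f a b : X f -> 0 < a -> a <= b -> b <= 1 ->
  (absint f b - absint f a) * N (F_ b) <=
  absint (fun t => f t * N (F_ t)) b - absint (fun t => f t * N (F_ t)) a.
Proof.
move=> Xf a0 ab b1; have i1 := ri_integrable Xf.
have i2 := associate_integrable bX Xf XF.
rewrite !absintB ?(ltW a0)//.
have sub : `]a, b]%classic `<=` (I01 : set R).
  by move=> t; rewrite I01E/= in_itv/= => /andP[ta tb]; apply/andP; split; lra.
have i1' : lambda.-integrable `]a, b] (EFin \o (fun t => `|f t|)).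
  by apply: integrable_norm; exact: integrableS i1.
have i2' : lambda.-integrable `]a, b] (EFin \o (fun t => `|f t * N (F_ t)|)).
  by apply: integrable_norm; exact: integrableS i2.
rewrite mulrC -RintegralZl//; apply: le_Rintegral => //.
  exact: (integrableZl _ _ i1').
move=> t; rewrite /= in_itv/= => /andP[ta tb].
by rewrite normrM mulrC ler_wpM2l// (le_trans (F_anti rX (lt_trans a0 ta) tb))// ler_norm.
Qed.

(* On the dyadic interval [ ]d/2^(k+1), d/2^k] ] the operator is compared with
   a multiple of one function [F_], so only countably many terms occur and no
   vector-valued integral is needed. *)
Lemma Cesaro_head f h (d : R) : X f -> measurable_fun I01 h -> 0 < d -> d <= 2^-1 ->
  (forall x, 0 <= x -> x <= d -> `|h x| <= x^-1 * absint f x) ->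
  (forall x, d < x -> h x = 0) ->
  X h /\ N h <= 5 * absint (fun t => f t * N (F_ t)) d.
Proof.
move=> Xf mh d0 d12 hf h0.
have d1 : d <= 1 by rewrite (le_trans d12)// invf_le1// ler1n.
have i1 := ri_integrable Xf.
have i2 := associate_integrable bX Xf XF.
set v := fun t => f t * N (F_ t) in i2 *.
pose a (k : nat) := d * 2^-1 ^+ k.
have a0 k : 0 < a k by rewrite mulr_gt0// exprn_gt0.
have aS k : a k.+1 = a k / 2 by rewrite /a exprSr mulrA.
have aSle k : a k.+1 <= a k by rewrite aS ler_pdivrMr// ler_peMr ?ler1n// ltW.
have ad k : a k <= d.
  by elim: k => [|k]; [rewrite /a expr0 mulr1|exact: le_trans].
have a1 k : a k <= 1 by exact: le_trans d1.
pose c k := absint f (a k) - absint f (a k.+1).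
have c0 k : 0 <= c k by rewrite subr_ge0 absint_le.
(* The mass [c k] of |f| on ]a k.+1, a k] reaches the mean at x only when x > a k.+1, and there
   [F_ (a k.+1) x] is exactly 1/x. After [F_half] and [F_absint] the norms telescope. *)
apply: (bfs_series_dominated bX (u := fun k x => c k * F_ (a k.+1) x)) => //.
- by move=> k; exact: (bfs_scale bX _ (F_in rX (a0 _))).
- by move=> k x; rewrite I01E => /andP[x0 _]; rewrite mulr_ge0// F_ge0.
- move=> n; apply: (@le_trans _ _ (\sum_(k < n) 5 * (absint v (a k) - absint v (a k.+1)))).
    apply: ler_sum => k _.
    rewrite (bfs_normZ bX _ (F_in rX (a0 _))) ger0_norm//.
    apply: (@le_trans _ _ (c k * (5 * N (F_ (a k))))).
      by rewrite ler_wpM2l// aS (F_half rX)// (le_trans (ad k)).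
    rewrite mulrCA ler_wpM2l//; exact: F_absint.
  have -> : \sum_(k < n) 5 * (absint v (a k) - absint v (a k.+1)) =
      5 * (absint v (a 0%N) - absint v (a n)).
    elim: n => [|n IH]; first by rewrite big_ord0 subrr mulr0.
    by rewrite big_ord_recr/= IH; ring.
  by rewrite ler_wpM2l// /a expr0 mulr1 gerBl absint_ge0.
- apply: aeW => x; rewrite I01E => /andP[x0 x1] e e0.
  have [dx|xd] := ltP d x.
    exists 0%N; rewrite h0// normr0 addr_ge0 ?(ltW e0)// big_ord0//.
  (* At x = 0 the convention 0^-1 = 0 turns the assumed bound into h 0 = 0. *)
  have [xE|xN0] := eqVneq x 0.
    by exists 0%N; rewrite big_ord0 add0r (le_trans (hf x x0 xd))// xE invr0 mul0r ltW.
  have xp : 0 < x by rewrite lt_neqAle eq_sym xN0.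
  (* The mass left below [a n] is going to be divided by x, hence the threshold e x; the resulting
     [n] depends on x. *)
  have [r r0 hr] := absint_small i1 (mulr_gt0 e0 xp).
  have [n an] : exists n, a n < r.
    have [||n hn] := @exists_expr_lt R 2^-1 (r / d) _ _ (divr_gt0 r0 d0).
    - by rewrite invr_ge0.
    - by rewrite invf_lt1 ?ltr1n.
    by exists n; rewrite /a mulrC -ltr_pdivlMr.
  exists n; apply: le_trans (hf x x0 xd) _.
  (* The sum counts the dyadic pieces whose left end is at most x; the last term is the mass not yet
     accounted for, below both x and [a m]. *)
  have key m : absint f x <= \sum_(k < m) c k * (a k.+1 <= x)%R%:R +
      absint f (Num.min x (a m)).
    elim: m => [|m IH].
      by rewrite big_ord0 add0r /a expr0 mulr1 min_l.
    apply: (le_trans IH); rewrite big_ord_recr/= -addrA lerD2l.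
    have [ax|xa] := leP (a m.+1) x.
      rewrite mulr1 /c subrK; apply: absint_le => //.
      by rewrite ge_min lexx orbT.
    by rewrite mulr0 add0r min_l// ltW// (lt_le_trans xa).
  have := key n.
  have : absint f (Num.min x (a n)) <= e * x.
    apply/ltW/(le_lt_trans _ (hr _ (ltW (a0 n)) an (a1 n))).
    by apply: absint_le => //; rewrite ge_min lexx orbT.
  have -> : \sum_(k < n) c k * F_ (a k.+1) x =
      x^-1 * \sum_(k < n) c k * (a k.+1 <= x)%R%:R.
    rewrite mulr_sumr; apply: eq_bigr => k _; rewrite F_E x1 andbT.
    by case: ifP => _; rewrite ?mulr1 ?mulr0 ?mulr0// mulrC.
  set S := \sum_(_ < _) _ => h1 h2.
  rewrite -(ler_pM2l xp) mulrA divff// mul1r mulrDr mulrA divff// mul1r.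
  by rewrite (le_trans h2)// lerD2l mulrC.
Qed.

(** Only the two pointwise bounds on [h] matter, so the lemma applies to a Cesaro mean with d = 1/2,
    for boundedness, and to a difference of two means with d and M small, for complete
    continuity. *)
Lemma Cesaro_estimate f h (d M : R) : X f -> measurable_fun I01 h ->
  0 < d -> d <= 2^-1 ->
  (forall x, 0 <= x -> x <= d -> `|h x| <= x^-1 * absint f x) ->
  (forall x, d < x -> x <= 1 -> `|h x| <= M) ->
  X h /\ N h <= 5 * absint (fun t => f t * N (F_ t)) d + M * N (fun=> 1).
Proof.
move=> Xf mh d0 d12 hf hM.
pose h1 x := if x \in `[0, d]%classic then h x else 0.
pose h2 x := if x \in `[0, d]%classic then 0 else h x.
have md : measurable (`[0, d]%classic : set R) by exact: measurable_itv.
have [|||X1 N1] := @Cesaro_head f h1 d Xf _ d0 d12.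
- exact: measurable_fun_if_mem.
- by move=> x x0 xd; rewrite /h1 mem_set ?hf// /= in_itv/= x0.
- by move=> x dx; rewrite /h1 memNset//= in_itv/= => /andP[_]; rewrite leNgt dx.
have M0 : 0 <= M.
  have d1 : d < 1 by rewrite (le_lt_trans d12)// invf_lt1// ltr1n.
  exact: le_trans (normr_ge0 _) (hM 1 d1 (lexx _)).
have [||X2 N2] := @ri_bounded _ _ _ rX h2 M.
- exact: measurable_fun_if_mem.
- move=> x; rewrite I01E => /andP[x0 x1]; rewrite /h2; case: ifPn => [_|/negP xd].
    by rewrite normr0.
  apply: hM => //; rewrite ltNge; apply/negP => xd'; apply: xd.
  by rewrite mem_set//= in_itv/= x0.
have -> : h = h1 \+ h2.
  by apply/funext => x; rewrite /h1 /h2/=; case: ifP => _; rewrite ?addr0 ?add0r.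
split; first exact: (bfs_add bX).
by apply: le_trans (bfs_normD bX X1 X2) _; rewrite lerD.
Qed.

End Cesaro_estimate.

Section Cesaro_operator.
Context (R : realType).
Local Notation lambda := (@lebesgue_measure R).
Implicit Types (f g : R -> R) (x y a e : R).

Lemma integrable_itv0 f x : lambda.-integrable I01 (EFin \o f) -> x <= 1 ->
  lambda.-integrable `[0, x] (EFin \o f).
Proof. by move=> fi x1; apply: integrableS fi => //; exact: itv0_sub_I01. Qed.

Lemma measurable_Cesaro f : lambda.-integrable I01 (EFin \o f) ->
  measurable_fun I01 (Cesaro f).
Proof.
move=> fi; apply: measurable_funM; first exact: measurable_inv_I01.
apply: subspace_continuous_measurable_fun => //.
exact: parameterized_integral_continuous.
Qed.

Lemma Cesaro_le f x : lambda.-integrable I01 (EFin \o f) -> 0 <= x -> x <= 1 ->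
  `|Cesaro f x| <= x^-1 * absint f x.
Proof.
move=> fi x0 x1; rewrite /Cesaro normrM ger0_norm ?invr_ge0//.
by rewrite ler_wpM2l ?invr_ge0// le_normr_Rintegral//; exact: integrable_itv0.
Qed.

Lemma Cesaro_linear a f g x : lambda.-integrable I01 (EFin \o f) ->
  lambda.-integrable I01 (EFin \o g) -> x <= 1 ->
  Cesaro (fun t => a * f t + g t) x = a * Cesaro f x + Cesaro g x.
Proof.
move=> /integrable_itv0 fi /integrable_itv0 gi x1; rewrite /Cesaro.
rewrite RintegralD ?RintegralZl//; first by ring.
- exact: fi.
- exact: (integrableZl _ a (fi _ x1)).
- exact: gi.
Qed.

End Cesaro_operator.

(** * Boundedness and complete continuity of the Cesaro operator *)

Section complete_continuity.
Context (R : realType) (X : set (R -> R)) (N : (R -> R) -> R).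
Hypothesis rX : ri_space X N.
Hypothesis XF : associate_space X (fun y => N (F_ y)).
Let bX := ri_bfs rX.
Local Notation lambda := (@lebesgue_measure R).
Implicit Types (f g h : R -> R) (u : nat -> R -> R) (x y a e : R).

Lemma associate_norm_le w : associate_space X w -> exists2 K, 0 <= K &
  forall f x, X f -> x <= 1 -> absint (fun t => f t * w t) x <= K * N f.
Proof.
move=> Xw; have [K K0 hK] := associate_bounded bX Xw; exists K => // f x Xf x1.
have fw := associate_integrable bX Xf Xw.
apply: le_trans (Rintegral_le_ereal measurable_I01 fw (hK f Xf)).
by apply: Rintegral_normr_le => //; exact: itv0_sub_I01.
Qed.

(** The estimate is used with d = 1/2. Beyond 1/2 the factor 1/x is below 2, and the L^1 norm of f
    is at most [K1 * N f] by the bounded functional with weight 1. *)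
Lemma Cesaro_bounded : bounded_operator X N Cesaro.
Proof.
have X1 := associate_cst1 rX XF.
have [K K0 hK] := associate_norm_le XF.
have [K1 K10 hK1] := associate_norm_le X1.
have est f : X f -> X (Cesaro f) /\
    N (Cesaro f) <= (5 * K + 2 * K1 * N (fun=> 1)) * N f.
  move=> Xf; have fi := ri_integrable rX XF Xf.
  have h21 : 2^-1 <= 1 :> R by rewrite invf_le1// ler1n.
  have h20 : 0 < 2^-1 :> R by rewrite invr_gt0.
  have [||XC NC] := Cesaro_estimate rX XF (M := 2 * K1 * N f) Xf
    (measurable_Cesaro fi) h20 (lexx _).
  - by move=> x x0 x2; apply: Cesaro_le => //; exact: le_trans h21.
  - move=> x x2 x1; have x0 : 0 < x by exact: lt_trans x2.
    apply: le_trans (Cesaro_le fi (ltW x0) x1) _.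
    rewrite -mulrA; apply: ler_pM.
    + by rewrite invr_ge0 ltW.
    + exact: absint_ge0.
    + by rewrite -[leRHS]invrK lef_pV2 ?posrE ?invr_gt0// ltW.
    + have := hK1 f x Xf x1; rewrite (_ : (fun t => f t * 1) = f)//.
      by apply/funext => t; rewrite mulr1.
  split => //; apply: le_trans NC _.
  rewrite [leRHS]mulrDl; apply: lerD; first by rewrite -mulrA ler_wpM2l// hK.
  by rewrite mulrAC.
split.
- by move=> f /est[].
- move=> a f g Xf Xg; apply: aeW => x; rewrite I01E => /andP[_ x1].
  by apply: Cesaro_linear => //; exact: ri_integrable rX XF _ _.
- by exists (5 * K + 2 * K1 * N (fun=> 1)) => f /est[].
Qed.

Lemma weakly_cvg_primitive u f e : weakly_cvg X N u f -> 0 < e ->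
  exists M : nat, forall n x, (M <= n)%N -> I01 x ->
    `|\int[lambda]_(t in `[0, x]) (u n t - f t)| <= e.
Proof.
move=> wu e0; have [Xu Xf uf] := wu.
have X1 := associate_cst1 rX XF.
have e20 : 0 < e / 2 by rewrite divr_gt0.
have [m m0 hm'] := weakly_cvg_uniformly_integrable bX X1 wu e20.
have hm (B : set R) n : measurable B -> B `<=` I01 -> (lambda B < m%:E)%E ->
    \int[lambda]_(t in B) `|u n t - f t| <= e / 2.
  move=> mB BI Bm; have := hm' B mB BI Bm n.
  by congr (_ <= _); apply: eq_Rintegral => t _; rewrite mulr1.
(* The mesh 1/(J+1) is below [m], so between x and the grid point on its left |u n - f| has mass at
   most e/2 for all n at once. Weak convergence is then needed at finitely many grid points only. *)
have [J _ /(_ J (leqnn J))/= Jm] := near_infty_natSinv_lt (PosNum m0).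
have ufi n : lambda.-integrable I01 (EFin \o (fun t => u n t - f t)).
  exact: (ri_integrable rX XF (bfs_sub bX (Xu n) Xf)).
have grid (i : nat) : exists M : nat, forall n, (M <= n)%N -> (i <= J)%N ->
    `|\int[lambda]_(t in `[0, i%:R / J.+1%:R]) (u n t - f t)| <= e / 2.
  pose y : R := i%:R / J.+1%:R.
  pose h := \1_(`[0, y]%classic : set R) : R -> R.
  have mh : measurable_fun I01 h by apply: measurable_indic; exact: measurable_itv.
  have h1 t : I01 t -> `|h t| <= 1.
    by move=> _; rewrite /h indicE; case: (_ \in _); rewrite ?normr1 ?normr0 ?ler01.
  have lh := associate_functional bX X1 mh h1.
  have /cvgrPdist_le/(_ _ e20)[M _ hM] := uf _ lh.
  exists M => n Mn iJ.
  have y1 : y <= 1 by rewrite ler_pdivrMr ?ltr0n// mul1r ler_nat ltnW.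
  have -> : \int[lambda]_(t in `[0, y]) (u n t - f t) =
      \int[lambda]_(t in I01) ((- 1 * f t + u n t) * 1 * h t).
    rewrite -(setIidr (itv0_sub_I01 y1)) Rintegral_mkcondr; apply: eq_Rintegral => t _.
    rewrite patchE /h indicE; case: ifP => _; rewrite ?mulr0//.
    by rewrite !mulr1 mulN1r addrC.
  have [lin _] := lh; rewrite (lin (-1) f (u n) Xf (Xu n)) mulN1r addrC distrC.
  exact: hM.
have [M hM] : exists M : nat, forall i n, (i <= J)%N -> (M <= n)%N ->
    `|\int[lambda]_(t in `[0, i%:R / J.+1%:R]) (u n t - f t)| <= e / 2.
  pose Mi i := projT1 (cid (grid i)).
  exists (\max_(i < J.+1) Mi i) => i n iJ Mn.
  apply: (projT2 (cid (grid i))) => //; apply: leq_trans Mn.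
  by have := leq_bigmax (F := fun i : 'I_J.+1 => Mi i) (inord i); rewrite inordK.
exists M => n x Mn; rewrite I01E => /andP[x0 x1].
have x0' : 0 <= x * J.+1%:R by rewrite mulr_ge0.
(* The grid stops at J/(J+1); the minimum assigns x = 1 to this last point. *)
pose i := minn J (Num.truncn (x * J.+1%:R)).
have iJ : (i <= J)%N by exact: geq_minl.
pose y : R := i%:R / J.+1%:R.
have y0 : 0 <= y by rewrite divr_ge0.
have yx : y <= x.
  rewrite ler_pdivrMr ?ltr0n//; have := truncn_itv x0' => /andP[tx _].
  by rewrite (le_trans _ tx)// ler_nat geq_minr.
have xy : x - y <= J.+1%:R^-1.
  rewrite lerBlDl -[X in y + X]mul1r -mulrDl ler_pdivlMr ?ltr0n//.
  rewrite natr1 /i /minn; case: ifPn => _; last by have := truncn_itv x0' => /andP[_ /ltW].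
  by rewrite -[leRHS]mul1r ler_wpM2r.
have iux : lambda.-integrable `[0, x] (EFin \o (fun t => u n t - f t)).
  exact: integrable_itv0.
have := Rintegral_itvB iux (x := y).
rewrite !bnd_simp => /(_ y0 yx) E.
rewrite -(subrK (\int[lambda]_(t in `[0, y]) (u n t - f t))
  (\int[lambda]_(t in `[0, x]) (u n t - f t))).
rewrite E (splitr e); apply: le_trans (ler_normD _ _) _; apply: lerD; last exact: hM.
have sub : `]y, x]%classic `<=` (I01 : set R).
  move=> t; rewrite I01E/= in_itv/= => /andP[ta tb].
  by rewrite (le_trans y0 (ltW ta)) (le_trans tb x1).
apply: le_trans (le_normr_Rintegral _ _) _ => //; first exact: integrableS (ufi n).
apply: hm => //.
rewrite -[ltLHS]/(lambda `]y, x]%classic) lebesgue_measure_itv/= lte_fin.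
case: ifP => _; last by rewrite lte_fin.
by rewrite -EFinB lte_fin (le_lt_trans xy).
Qed.

Lemma Cesaro_completely_continuous : completely_continuous X N Cesaro.
Proof.
split; first exact: Cesaro_bounded.
move=> u f wu; have [Xu Xf uf] := wu.
have N1 : 0 <= N (fun=> 1) by apply: (bfs_N_ge0 bX); exact: ri_cst1 rX.
apply/cvgrPdist_le => e e0.
(* The final bound is 5 e1 from the part near 0 plus e1 N(1) from the rest. *)
pose e1 := e / (5 + N (fun=> 1)).
have e10 : 0 < e1 by rewrite divr_gt0// ltr_wpDr.
have [m m0 hm] := weakly_cvg_uniformly_integrable bX XF wu e10.
pose d := Num.min (m / 2) 2^-1.
have d0 : 0 < d by rewrite lt_min divr_gt0//= invr_gt0.
have d12 : d <= 2^-1 by rewrite ge_min lexx orbT.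
have d1 : d <= 1 by rewrite (le_trans d12)// invf_le1// ler1n.
(* The factor [d] compensates the division by x > d in the Cesaro mean. *)
have [M hM] := weakly_cvg_primitive wu (mulr_gt0 e10 d0).
exists M => // n /= Mn; rewrite sub0r normrN.
have ui := ri_integrable rX XF (Xu n); have fi := ri_integrable rX XF Xf.
have uf' := bfs_sub bX (Xu n) Xf.
have ufi := ri_integrable rX XF uf'.
have CE x : x <= 1 -> (Cesaro (u n) \- Cesaro f) x = Cesaro (u n \- f) x.
  move=> x1 /=; have := Cesaro_linear (-1) fi ui x1.
  rewrite mulN1r addrC => <-; congr Cesaro.
  by apply/funext => t /=; rewrite mulN1r addrC.
have mC : measurable_fun I01 (Cesaro (u n) \- Cesaro f).
  by apply: measurable_funB; exact: measurable_Cesaro.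
have [||XC NC] := Cesaro_estimate rX XF (M := e1) uf' mC d0 d12.
- move=> x x0 xd; have x1 := le_trans xd d1.
  by rewrite CE// Cesaro_le.
- move=> x dx x1; rewrite CE// /Cesaro normrM ger0_norm ?invr_ge0 ?(ltW (lt_trans d0 dx))//.
  rewrite ler_pdivrMl ?(lt_trans d0 dx)//.
  apply: le_trans (hM n x Mn _) _; first by rewrite I01E x1 ltW// (lt_trans d0).
  by rewrite mulrC ler_wpM2r// ltW.
rewrite ger0_norm ?(bfs_N_ge0 bX)//; apply: le_trans NC _.
have hd : absint (fun t => (u n \- f) t * N (F_ t)) d <= e1.
  apply: hm; [exact: measurable_itv|exact: itv0_sub_I01|].
  rewrite -[ltLHS]/(lambda `[0, d]%classic) lebesgue_measure_itv/= lte_fin d0.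
  rewrite -EFinB lte_fin subr0 (@le_lt_trans _ _ (m / 2))//.
    by rewrite ge_min lexx.
  by rewrite ltr_pdivrMr// ltr_pMr// ltr1n.
apply: (@le_trans _ _ ((5 + N (fun=> 1)) * e1)).
  by rewrite [leRHS]mulrDl (mulrC e1) lerD2r ler_wpM2l.
by rewrite mulrC divfK// gt_eqF// ltr_wpDr.
Qed.

End complete_continuity.

(** * Lorentz spaces *)

Lemma lebesgue_measure_itv_ereal (R : realType) (a : R) (y : \bar R) :
  (lebesgue_measure [set t | (a <= t)%R /\ t%:E < y] = maxe (y - a%:E) 0)%E.
Proof.
case: y => [r| |].
- rewrite (_ : [set t | _] = `[a, r[%classic); last first.
    by apply/seteqP; split => t /=; rewrite in_itv/= lte_fin; [case=> -> ->|move/andP].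
  rewrite lebesgue_measure_itv/= lte_fin; case: ltP => ar.
    by rewrite -EFinB max_l// lee_fin subr_ge0 ltW.
  by rewrite -EFinB max_r// lee_fin subr_le0.
- rewrite (_ : [set t | _] = `[a, +oo[%classic); last first.
    by apply/seteqP; split => t /=; rewrite in_itv/= andbT; [case|rewrite ltry].
  by rewrite lebesgue_measure_itv/= ltry/= max_l// leey.
- rewrite (_ : [set t | _] = set0) ?measure0//; first by rewrite max_r// leNye.
  by rewrite -subset0 => t /= [].
Qed.

(** Tonelli for W(x) times the indicator of a <= t < g(x). It is used with W = 1 and a = 0 for the
    Stieltjes measure of [phi], with W = 1 and general a for the K-functional, and with W(y) =
    phi(y)/y for the associate space. *)
Lemma layer_cake d (T : measurableType d) (R : realType)
    (mu : {sigma_finite_measure set T -> \bar R}) (D : set T) (g W : T -> \bar R) (a : R) :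
  measurable D -> measurable_fun D g -> measurable_fun D W ->
  (forall x, D x -> 0 <= W x)%E ->
  (\int[mu]_(x in D) (W x * maxe (g x - a%:E) 0) =
   \int[lebesgue_measure]_(t in `[a, +oo[) \int[mu]_(x in D `&` [set x | t%:E < g x]) W x)%E.
Proof.
move=> mD mg mW W0.
have mgD : measurable_fun setT (g \_ D) by exact/(measurable_restrictT _ mD).
have mWD : measurable_fun setT (W \_ D) by exact/(measurable_restrictT _ mD).
have WD0 x : (0 <= (W \_ D) x)%E.
  by rewrite patchE; case: ifPn => // /set_mem; exact: W0.
pose S : set (T * measurableTypeR R) :=
  [set p | (p.2)%:E < (g \_ D) p.1]%E `&` (D `*` `[a, +oo[%classic).
have mS : measurable S.
  apply: measurableI; last by apply: measurableX => //; exact: measurable_itv.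
  rewrite -[X in measurable X]setTI; apply: measurable_lte; first exact: measurableT.
    by apply/measurable_EFinP; exact: measurable_snd.
  exact: measurableT_comp mgD measurable_fst.
pose h (p : T * measurableTypeR R) := ((W \_ D) p.1 * (\1_S p)%:E)%E.
have mh : measurable_fun setT h.
  apply: emeasurable_funM; first exact: measurableT_comp mWD measurable_fst.
  by apply/measurable_EFinP; exact: measurable_indic.
have h0 p : (0 <= h p)%E by rewrite mule_ge0// lee_fin.
have := @fubini_tonelli _ _ _ _ R mu (@lebesgue_measure R) h mh h0.
rewrite /h/= => E.
transitivity (\int[mu]_x \int[lebesgue_measure]_t ((W \_ D) x * (\1_S (x, t))%:E))%E.
  rewrite integral_mkcond; apply: eq_integral => x _.
  have mSx : measurable (xsection S x) by exact: measurable_xsection.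
  transitivity (\int[lebesgue_measure]_t ((W \_ D) x * (\1_(xsection S x) t)%:E))%E; last first.
    by apply: eq_integral => t _; rewrite !indicE mem_xsection.
  rewrite ge0_integralZl//; last by apply/measurable_EFinP; exact: measurable_indic.
  rewrite integral_indic// setIT patchE [in RHS]patchE.
  case: ifPn => [/set_mem Dx|_]; last by rewrite mul0e.
  congr (_ * _)%E; rewrite -lebesgue_measure_itv_ereal; congr (lebesgue_measure _).
  apply/seteqP; split => t /=; rewrite /xsection/= in_setE /S/= patchE mem_set//= in_itv/= andbT.
    by move=> [at_ tg]; split.
  by move=> [tg [_ at_]]; split.
rewrite E [RHS]integral_mkcond; apply: eq_integral => t _.
have itvE : (t \in `[a, +oo[%classic) = (a <= t) by rewrite mem_setE in_itv/= andbT.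
rewrite [RHS]patchE itvE; case: ifPn => at_.
  rewrite [RHS]integral_mkcond; apply: eq_integral => x _.
  rewrite indicE; case: (asboolP (S (x, t))) => [Sxt|nS].
    rewrite mem_set// mule1; move: Sxt => -[/= tg [Dx _]].
    move: tg; rewrite patchE mem_set// => tg.
    by rewrite [RHS]patchE [in RHS]mem_set// patchE mem_set.
  rewrite memNset// mule0 [RHS]patchE memNset// => -[Dx tg]; apply: nS.
  by split => /=; [rewrite patchE mem_set|rewrite in_itv/= andbT].
apply: integral0_eq => x _; rewrite indicE memNset ?mule0//.
by case=> _ [_ /=]; rewrite in_itv/= andbT (negbTE at_).
Qed.

(** * Concave weights and their Stieltjes measures *)

Section lorentz_weight_theory.
Context (R : realType) (phi : lorentz_weight R).
Implicit Types (s t u r c : R).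

Lemma weight_concaveE u s t : 0 <= u <= 1 -> 0 <= s <= 1 -> 0 <= t <= 1 ->
  u * phi s + (1 - u) * phi t <= phi (u * s + (1 - u) * t).
Proof.
move=> /andP[u0 u1] s01 t01.
have := @weight_concave _ phi (Itv01 u0 u1) s t.
rewrite !mem_setE !in_itv/= => /(_ s01 t01).
rewrite !convRE/=.
by rewrite !mulrN -opprD lerN2.
Qed.

Lemma weight_le s t : 0 <= s -> s <= t -> t <= 1 -> phi s <= phi t.
Proof.
move=> s0 st t1; apply: weight_nondecreasing => //; rewrite in_itv/=.
- by rewrite s0 (le_trans st).
- by rewrite t1 (le_trans s0).
Qed.

Lemma weight_ge0 s : 0 <= s -> s <= 1 -> 0 <= phi s.
Proof. by move=> s0 s1; rewrite -(weight0 phi) weight_le. Qed.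

(** Cross-multiplied form of the monotonicity of phi(s)/s: s is a convex combination of t and 0, and
    phi vanishes at 0. *)
Lemma weight_star s t : 0 <= s -> s <= t -> t <= 1 -> s * phi t <= t * phi s.
Proof.
move=> s0 st t1; have := le_trans s0 st; rewrite le_eqVlt => /predU1P[t0|t0].
  have -> : s = 0 by apply/eqP; rewrite eq_le s0 t0 st.
  by rewrite -t0 !mul0r.
have u01 : 0 <= s / t <= 1 by rewrite divr_ge0 ?(ltW t0)//= ler_pdivrMr// mul1r.
have t01 : 0 <= t <= 1 by rewrite (ltW t0) t1.
have o01 : 0 <= (0 : R) <= (1 : R) by rewrite lexx ler01.
have := weight_concaveE u01 t01 o01.
rewrite weight0 !mulr0 !addr0 divfK ?gt_eqF// -(ler_pM2l t0).
by rewrite mulrA (mulrC t (s / t)) divfK ?gt_eqF.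
Qed.

Lemma weight_scale c s : 1 <= c -> 0 <= s -> c * s <= 1 -> phi (c * s) <= c * phi s.
Proof.
move=> c1; rewrite le_eqVlt => /predU1P[<- _|s0 cs].
  by rewrite mulr0 weight0 mulr0.
have := weight_star (ltW s0) (ler_peMl (ltW s0) c1) cs.
by rewrite -mulrA mulrCA ler_pM2l.
Qed.

(** Left continuity of phi: the values are squeezed between (sn/s) phi(s) and phi(s). A jump of phi
    at 0 does no harm, since for s = 0 the sequence is constantly 0. *)
Lemma weight_cvg (sn : nat -> R) s : s <= 1 -> (forall n, 0 <= sn n) ->
  (forall n, sn n <= s) -> sn @ \oo --> s -> phi (sn n) @[n --> \oo] --> phi s.
Proof.
move=> s1 sn0 sns sncvg; have := le_trans (sn0 0%N) (sns 0%N).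
rewrite le_eqVlt => /predU1P[s0|s0].
  rewrite (_ : (fun n => _) = fun=> phi s); first exact: cvg_cst.
  by apply/funext => n; congr (phi _); apply/eqP; rewrite eq_le sns -s0 sn0.
apply: (@squeeze_cvgr _ _ _ _ (fun n => sn n / s * phi s) (fun=> phi s)).
- apply: nearW => n; rewrite (weight_le (sn0 n) (sns n) s1) andbT.
  by rewrite mulrAC ler_pdivrMr// [leRHS]mulrC weight_star.
- rewrite -[X in _ --> X]mul1r -(@divff _ s) ?gt_eqF//.
  by apply: cvgM; [apply: cvgM => //; exact: cvg_cst|exact: cvg_cst].
- exact: cvg_cst.
Qed.

Lemma weight_ext_lt0 s : s < 0 -> weight_ext phi s = 0.
Proof.
move=> s0; apply/eqP; rewrite eq_le; apply/andP; split.
  apply: ge_inf; first by case: (weight_ext_has_inf phi s).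
  exists 0; first by rewrite /= in_itv/= andbT.
  by rewrite /clamp01 max_l ?weight0// ge_min lexx.
apply: lb_le_inf; first by case: (weight_ext_has_inf phi s).
move=> _ [t _ <-]; have := clamp01_itv t; rewrite in_itv/= => /andP[? ?].
exact: weight_ge0.
Qed.

Lemma clamp01_id s : 0 <= s -> s <= 1 -> clamp01 s = s.
Proof. by move=> s0 s1; rewrite /clamp01 min_l// max_r. Qed.

Lemma weight_ext_itv s c : 0 <= s -> s < c -> c <= 1 ->
  phi s <= weight_ext phi s <= phi c.
Proof.
move=> s0 sc c1; apply/andP; split.
  apply: lb_le_inf; first by case: (weight_ext_has_inf phi s).
  move=> _ [t /= + <-]; rewrite in_itv/= andbT => st.
  have := weight_clamp_homo phi (ltW st).
  by rewrite /= (clamp01_id s0)// (le_trans (ltW sc)).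
apply: ge_inf; first by case: (weight_ext_has_inf phi s).
exists c; first by rewrite /= in_itv/= andbT.
by rewrite clamp01_id// (le_trans s0 (ltW sc)).
Qed.

Local Notation mu := (lebesgue_stieltjes_measure (weight_ext phi)).

Lemma weight_measure_oc s t : s <= t ->
  (mu `]s, t] = (weight_ext phi t - weight_ext phi s)%:E)%E.
Proof.
move=> st; rewrite /lebesgue_stieltjes_measure/= /measure_extension/=.
by rewrite measurable_mu_extE//; [exact: wlength_itv_bnd|exact: is_ocitv].
Qed.

(** Starting at -1, where [weight_ext] is 0, keeps the possible atom at 0 inside the interval.
    Exhausting by half-open intervals approaches c from the left, so left continuity of phi gives
    the exact value. *)
Lemma weight_measure_oo c : c <= 1 -> 0 <= c -> mu `]-1, c[ = (phi c)%:E.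
Proof.
move=> c1 c0.
(* With the step (c + 1)/(n + 1) the first interval is empty and no right end falls below -1. *)
pose F n := `](-1), (c - (c + 1) / n.+1%:R)]%classic : set R.
have UF : `]-1, c[%classic = \bigcup_n F n.
  apply/seteqP; split => x /=; rewrite ?in_itv/=.
    move=> /andP[x1 xc].
    have e0 : 0 < (c - x) / (c + 1) by rewrite divr_gt0 ?subr_gt0//; lra.
    have [n _ /(_ n (leqnn n))/= hn] := near_infty_natSinv_lt (PosNum e0).
    exists n => //; rewrite /F/= in_itv/= x1/= lerBrDr -lerBrDl.
    rewrite mulrC -ler_pdivlMr; [exact: ltW|lra].
  move=> [n _]; rewrite /F/= in_itv/= => /andP[-> /le_lt_trans]; apply.
  by rewrite gtrBl divr_gt0//; lra.
have mF n : measurable (F n) by exact: measurable_itv.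
have : (mu \o F) n @[n --> \oo] --> mu (\bigcup_n F n).
  apply: nondecreasing_cvg_mu; [exact: mF|by apply: bigcup_measurable => ? _; exact: mF|].
  move=> n m nm; apply/subsetPset => x; rewrite /F/= !in_itv/= => /andP[-> xn]/=.
  rewrite (le_trans xn)// lerD2l lerN2 ler_pM2l ?lef_pV2 ?posrE ?ltr0n ?ler_nat//.
  by rewrite ltr_wpDl.
rewrite -UF => /cvg_unique; apply => //.
pose x n := c - (c + 1) / n.+1%:R; pose s n := Num.max 0 (x n).
have xc n : x n < c by rewrite gtrBl divr_gt0//; lra.
have xcvg : x n @[n --> \oo] --> c.
  rewrite -[X in _ --> X]subr0; apply: cvgB; first exact: cvg_cst.
  by rewrite -[X in _ --> X](mulr0 (c + 1)); apply: cvgMl_tmp; exact: cvg_harmonic.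
have s0 n : 0 <= s n by rewrite le_max lexx.
have sc n : s n <= c by rewrite ge_max c0 ltW.
have scvg : s n @[n --> \oo] --> c.
  apply: (@squeeze_cvgr _ _ _ _ x (fun=> c)) => //; last exact: cvg_cst.
  by apply: nearW => n; rewrite sc andbT le_max lexx orbT.
have muF n : (mu \o F) n = (weight_ext phi (x n))%:E.
  rewrite /= weight_measure_oc; first by rewrite (weight_ext_lt0 (s := -1)) ?subr0// ltrN10.
  rewrite /x lerBrDr -lerBrDl opprK ler_pdivrMr ?ltr0n// ler_peMr ?ler1n//; lra.
rewrite (_ : mu \o F = (fun n => (weight_ext phi (x n))%:E)); last exact/funext.
apply: cvg_EFin; first exact: nearW.
apply: (@squeeze_cvgr _ _ _ _ (phi \o s) (fun=> phi c)); last exact: cvg_cst.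
  apply: nearW => n /=; rewrite /s; have [x0|x0] := ltP (x n) 0.
    by rewrite weight_ext_lt0// weight0 lexx weight_ge0.
  exact: weight_ext_itv.
exact: weight_cvg.
Qed.

Lemma weight_measure_co c : 0 <= c -> c <= 1 -> mu `[0, c[ = (phi c)%:E.
Proof.
move=> c0 c1.
have := weight_measure_oo c1 c0.
have : `]-1, c[%classic = `]-1, 0[%classic `|` `[0, c[%classic :> set R.
  apply/seteqP; split => x /=; rewrite !in_itv/=.
    by move=> /andP[x1 xc]; have [x0|x0] := ltP x 0; [left|right]; rewrite ?x1 ?xc.
  by case => /andP[? ?]; apply/andP; split; lra.
move=> ->; rewrite measureU//.
- have E := weight_measure_oo (c := 0) ler01 (lexx _).
  by rewrite [X in (X + _)%E]E weight0 add0e.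
- apply/seteqP; split => // x /=; rewrite !in_itv/= => -[/andP[_ x0] /andP[]].
  by rewrite leNgt x0.
Qed.

End lorentz_weight_theory.

(** * Distribution function and decreasing rearrangement *)

Section distribution_theory.
Context (R : realType).
Local Notation lambda := (@lebesgue_measure R).
Implicit Types (f g : R -> R) (s t : R).

Definition dfun f t : R := fine (distribution_function f t).

Variable f : R -> R.
Hypothesis mf : measurable_fun I01 f.

Lemma distribution_le1 t : (distribution_function f t <= 1)%E.
Proof.
rewrite -(lebesgue_I01 R); apply: le_measure; rewrite ?inE//.
exact: measurable_superlevel.
Qed.

Lemma dfunE t : distribution_function f t = (dfun f t)%:E.
Proof.
rewrite /dfun fineK// ge0_fin_numE ?measure_ge0//.
by rewrite (le_lt_trans (distribution_le1 t))// ltry.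
Qed.

Lemma dfun_ge0 t : 0 <= dfun f t.
Proof. by rewrite fine_ge0// measure_ge0. Qed.

Lemma dfun_le1 t : dfun f t <= 1.
Proof. by rewrite -lee_fin -dfunE distribution_le1. Qed.

Lemma dfun_anti s t : s <= t -> dfun f t <= dfun f s.
Proof.
move=> st; rewrite -lee_fin -!dfunE; apply: le_measure; rewrite ?inE.
- exact: measurable_superlevel.
- exact: measurable_superlevel.
- by move=> x [Ix /= tx]; split => //=; exact: le_lt_trans tx.
Qed.

(* Galois connection between [f^*] and the distribution function; it rests on
   the right continuity of the latter. *)
Lemma rearrangement_leP s t : 0 <= t ->
  (rearrangement f s <= t%:E)%E <-> dfun f t <= s.
Proof.
move=> t0; split => [rt|dt]; last first.
  by apply: ereal_inf_lbound; exists t => //; split => //; rewrite dfunE lee_fin.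
have dn n : dfun f (t + n.+1%:R^-1) <= s.
  have /ereal_inf_ltP : (rearrangement f s < (t + n.+1%:R^-1)%:E)%E.
    by apply: le_lt_trans rt _; rewrite lte_fin ltrDl invr_gt0.
  move=> [_ [r [r0 dr] <-]]; rewrite lte_fin => rn.
  by rewrite (le_trans (dfun_anti (ltW rn)))// -lee_fin -dfunE.
pose F n := I01 `&` [set x | t + n.+1%:R^-1 < `|f x|].
have UF : I01 `&` [set x | t < `|f x|] = \bigcup_n F n.
  apply/seteqP; split => x /=.
    move=> [Ix tx]; have tx0 : 0 < `|f x| - t by rewrite subr_gt0.
    have [n _ /(_ n (leqnn n))/= hn] := near_infty_natSinv_lt (PosNum tx0).
    by exists n => //; split => //=; rewrite -ltrBrDl.
  by move=> [n _ [Ix /= nx]]; split => //; apply: lt_trans nx; rewrite ltrDl invr_gt0.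
have mF n : measurable (F n) by exact: measurable_superlevel.
rewrite -lee_fin -dfunE /distribution_function UF.
have Fcvg : (lambda \o F) n @[n --> \oo] --> lambda (\bigcup_n F n).
  apply: nondecreasing_cvg_mu; [exact: mF|by apply: bigcup_measurable => ? _; exact: mF|].
  move=> n m nm; apply/subsetPset => x [Ix /= nx]; split => //=; apply: le_lt_trans nx.
  by rewrite lerD2l lef_pV2 ?posrE ?ltr0n// ler_nat.
rewrite -(cvg_lim _ Fcvg)//; apply: lime_le; first by apply/cvg_ex; eexists; exact: Fcvg.
by apply: nearW => n; rewrite -[leLHS]/(distribution_function f (t + n.+1%:R^-1)) dfunE lee_fin.
Qed.

Lemma rearrangement_ge0 s : (0 <= rearrangement f s)%E.
Proof. by apply: le_ereal_inf_tmp => _ [t [t0 _] <-]; rewrite lee_fin. Qed.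

Lemma rearrangement_superlevel t : 0 <= t ->
  `[0, 1]%classic `&` [set s | (t%:E < rearrangement f s)%E] = `[0, dfun f t[%classic.
Proof.
move=> t0; apply/seteqP; split => s /=; rewrite !in_itv/=.
  move=> [/andP[-> _]]; rewrite ltNge => /negP nle /=; rewrite ltNge; apply/negP.
  by move/(rearrangement_leP _ t0).
move=> /andP[s0 sd]; split; first by rewrite s0 (le_trans (ltW sd))// dfun_le1.
by rewrite ltNge; apply/negP => /(rearrangement_leP _ t0); rewrite leNgt sd.
Qed.

Lemma measurable_rearrangement : measurable_fun (`[0, 1]%classic : set R) (rearrangement f).
Proof.
apply: (measurability (@ErealGenOInfty.G R)); first exact: ErealGenOInfty.measurableE.
move=> _ [_ [t ->] <-].
rewrite (_ : _ @^-1` _ = [set s | (t%:E < rearrangement f s)%E]); last first.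
  by apply/seteqP; split => s /=; rewrite in_itv/= andbT.
have [t0|t0] := leP 0 t; first by rewrite rearrangement_superlevel//; exact: measurable_itv.
suff -> : `[0, 1]%classic `&` [set s | (t%:E < rearrangement f s)%E] = I01.
  exact: measurable_I01.
apply/seteqP; split => s /= [] //; split => //.
by rewrite (lt_le_trans _ (rearrangement_ge0 s))// lte_fin.
Qed.

End distribution_theory.

Section lorentz_layer_cake.
Context (R : realType) (phi : lorentz_weight R).
Implicit Types (f : R -> R).

Lemma measurable_weight_dfun f (D : set R) : measurable_fun I01 f -> measurable D ->
  measurable_fun D (fun t => (phi (dfun f t))%:E).
Proof.
move=> mf mD; apply/measurable_EFinP; apply: nonincreasing_measurable => // s t st.
by apply: weight_le; [exact: dfun_ge0|exact: dfun_anti|exact: dfun_le1].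
Qed.

Lemma lorentz_integralE f : measurable_fun I01 f -> lorentz_integral phi f =
  (\int[lebesgue_measure]_(t in `[0%R, +oo[) (phi (dfun f t))%:E)%E.
Proof.
move=> mf; have mr := measurable_rearrangement mf.
rewrite /lorentz_integral.
transitivity (\int[lebesgue_stieltjes_measure (weight_ext phi)]_(s in `[0%R, 1%R])
    (1 * maxe (rearrangement f s - 0%:E) 0))%E.
  by apply: eq_integral => s _; rewrite mul1e sube0 max_l// rearrangement_ge0.
rewrite layer_cake//=.
apply: eq_integral => t /set_mem; rewrite /= in_itv/= andbT => t0.
rewrite rearrangement_superlevel// integral_cst ?mul1e//.
exact: (weight_measure_co phi (dfun_ge0 f t) (dfun_le1 mf t)).
Qed.

End lorentz_layer_cake.

(** * Subadditivity of the Lorentz functional *)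

Section K_functional.
Context (R : realType).
Local Notation lambda := (@lebesgue_measure R).
Implicit Types (f g : R -> R) (r a s t : R).

Lemma measurable_dfun f (D : set R) : measurable_fun I01 f -> measurable D ->
  measurable_fun D (fun t => (dfun f t)%:E).
Proof.
move=> mf mD; apply/measurable_EFinP; apply: nonincreasing_measurable => // s t.
exact: dfun_anti.
Qed.

Lemma dfun_tailE f a : measurable_fun I01 f ->
  (\int[lambda]_(t in `[a, +oo[) (dfun f t)%:E =
   \int[lambda]_(x in I01) maxe (`|f x|%:E - a%:E) 0)%E.
Proof.
move=> mf; have mnf : measurable_fun I01 (fun x => `|f x|%:E).
  by apply/measurable_EFinP; exact: measurableT_comp.
transitivity (\int[lambda]_(x in I01) (1 * maxe (`|f x|%:E - a%:E) 0))%E; last first.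
  by apply: eq_integral => x _; rewrite mul1e.
have := @layer_cake _ _ _ lambda I01 (fun x => `|f x|%:E) (fun=> 1%E) a
  measurable_I01 mnf (measurable_cst _) (fun _ _ => lee01).
move=> /= ->; apply: eq_integral => t _; have mS := measurable_superlevel t mf.
by rewrite -dfunE// integral_cst// mul1e.
Qed.

Lemma dfun_small f r : measurable_fun I01 f -> 0 < r -> exists2 a, 0 <= a & dfun f a <= r.
Proof.
move=> mf r0.
pose F n := I01 `&` [set x | n%:R < `|f x|].
have mF n : measurable (F n) by exact: measurable_superlevel.
have Fcvg : (lambda \o F) n @[n --> \oo] --> lambda (\bigcap_n F n).
  apply: nonincreasing_cvg_mu.
  - by rewrite (le_lt_trans (distribution_le1 mf _))// ltry.
  - exact: mF.
  - by apply: bigcap_measurable => // ? _; exact: mF.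
  - move=> n m nm; apply/subsetPset => x [Ix /= mx]; split => //=.
    by apply: le_lt_trans mx; rewrite ler_nat.
have F0 : \bigcap_n F n = set0.
  rewrite -subset0 => x Fx.
  by have [_ /=] := Fx (Num.truncn `|f x|).+1 I; rewrite ltNge ltW// truncnS_gt.
rewrite F0 measure0 in Fcvg.
have /fine_cvgP[_ /cvgrPdist_le/(_ _ r0)[n _ /(_ n (leqnn n))]] := Fcvg.
rewrite /= sub0r normrN => hn; exists n%:R => //.
exact: le_trans (ler_norm _) hn.
Qed.

(* The norm of the Lorentz space with weight [min(., r)], that is, Peetre's
   K-functional of the couple (L^1, L^oo).  It is subadditive in [f] because it
   is the minimum over [a >= 0] of [r a] plus the integral of the positive part
   of [|f| - a]. *)
Definition Kfun r f : \bar R :=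
  (\int[lambda]_(t in `[0%R, +oo[) (Num.min (dfun f t) r)%:E)%E.

Lemma measurable_min_dfun f r (D : set R) : measurable_fun I01 f -> measurable D ->
  measurable_fun D (fun t => (Num.min (dfun f t) r)%:E).
Proof.
move=> mf mD; apply/measurable_EFinP; apply: measurable_minr => //.
by apply/measurable_EFinP; exact: measurable_dfun.
Qed.

Lemma Kfun_split f r a : measurable_fun I01 f -> 0 <= r -> 0 <= a ->
  (Kfun r f = \int[lambda]_(t in `[0%R, a[) (Num.min (dfun f t) r)%:E +
   \int[lambda]_(t in `[a, +oo[) (Num.min (dfun f t) r)%:E)%E.
Proof.
move=> mf r0 a0; have U : `[0, +oo[%classic = `[0, a[%classic `|` `[a, +oo[%classic :> set R.
  apply/seteqP; split => t /=; rewrite !in_itv/= !andbT.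
    by move=> ->; have [] := ltP t a; [left|right].
  by case => [/andP[]//|]; exact: le_trans.
rewrite /Kfun U ge0_integral_setU//=.
- by apply: measurable_min_dfun => //; rewrite -U; exact: measurable_itv.
- by move=> t _; rewrite lee_fin le_min dfun_ge0.
- apply/disj_set2P/seteqP; split => // t /=; rewrite !in_itv/= andbT => -[/andP[_ ta]].
  by rewrite leNgt ta.
Qed.

Lemma Kfun_le f r a : measurable_fun I01 f -> 0 <= r -> 0 <= a ->
  (Kfun r f <= (r * a)%:E + \int[lambda]_(t in `[a, +oo[) (dfun f t)%:E)%E.
Proof.
move=> mf r0 a0; rewrite (Kfun_split mf r0 a0); apply: leeD.
  apply: (@le_trans _ _ (\int[lambda]_(t in `[0%R, a[) r%:E)%E).
    apply: ge0_le_integral => //.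
    - by move=> t _; rewrite lee_fin le_min dfun_ge0.
    - by apply: measurable_min_dfun.
    - by move=> t _; rewrite lee_fin ge_min lexx orbT.
  rewrite integral_cst//= lebesgue_measure_itv/= lte_fin.
  case: ifP => _; last by rewrite mule0 lee_fin mulr_ge0.
  by rewrite -EFinB subr0 -EFinM.
apply: ge0_le_integral => //.
- by move=> t _; rewrite lee_fin le_min dfun_ge0.
- by apply: measurable_min_dfun.
- by apply: measurable_dfun.
- by move=> t _; rewrite lee_fin ge_min lexx.
Qed.

(** The optimal level is the value of the rearrangement at r: below it the distribution function
    exceeds r, from it on it is at most r. That value is finite because r > 0. *)
Lemma Kfun_attained f r : measurable_fun I01 f -> 0 < r -> exists2 a, 0 <= a &
  (Kfun r f = (r * a)%:E + \int[lambda]_(t in `[a, +oo[) (dfun f t)%:E)%E.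
Proof.
move=> mf r0; have [b b0 fb] := dfun_small mf r0.
have rb : (rearrangement f r <= b%:E)%E by exact/rearrangement_leP.
have fin : rearrangement f r \is a fin_num.
  by rewrite ge0_fin_numE ?rearrangement_ge0// (le_lt_trans rb)// ltry.
pose a := fine (rearrangement f r).
have aE : rearrangement f r = a%:E by rewrite fineK.
have a0 : 0 <= a by rewrite fine_ge0// rearrangement_ge0.
exists a => //; rewrite (Kfun_split mf (ltW r0) a0); congr (_ + _)%E.
  transitivity (\int[lambda]_(t in `[0%R, a[) r%:E)%E.
    apply: eq_integral => t /set_mem; rewrite /= in_itv/= => /andP[t0 ta].
    rewrite min_r// leNgt; apply/negP => /ltW /(rearrangement_leP mf _ t0).
    by rewrite aE lee_fin leNgt ta.
  rewrite integral_cst//= lebesgue_measure_itv/= lte_fin.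
  case: ltP => a0'; first by rewrite -EFinB subr0 -EFinM.
  by rewrite mule0 (_ : a = 0) ?mulr0//; apply/eqP; rewrite eq_le a0 a0'.
apply: eq_integral => t /set_mem; rewrite /= in_itv/= andbT => at_.
rewrite min_l//; apply/(rearrangement_leP mf _ (le_trans a0 at_)).
by rewrite aE lee_fin.
Qed.

(** With optimal levels a for f and b for g, the level a + b serves for the sum, since the positive
    part of |f + g| - (a + b) is at most the sum of the positive parts of |f| - a and |g| - b. *)
Lemma KfunD f g r : measurable_fun I01 f -> measurable_fun I01 g -> 0 < r ->
  (Kfun r (f \+ g)%R <= Kfun r f + Kfun r g)%E.
Proof.
move=> mf mg r0.
have [a a0 ->] := Kfun_attained mf r0; have [b b0 ->] := Kfun_attained mg r0.
have mfg : measurable_fun I01 (f \+ g) by exact: measurable_funD.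
apply: le_trans (Kfun_le mfg (ltW r0) (addr_ge0 a0 b0)) _.
rewrite !dfun_tailE// mulrDr EFinD [leRHS]addeACA; apply: leeD2l.
have mm (h : R -> R) c : measurable_fun I01 h ->
    measurable_fun I01 (fun x => maxe (`|h x|%:E - c%:E) 0)%E.
  move=> mh; apply: measurable_maxe => //; apply/measurable_EFinP.
  by apply: measurable_funB => //; exact: measurableT_comp.
have m0 (h : R -> R) c x : (0 <= maxe (`|h x|%:E - c%:E) 0)%E by rewrite le_max lexx orbT.
rewrite -ge0_integralD//; [|exact: mm|exact: mm].
apply: ge0_le_integral => //; first exact: mm.
- by apply: emeasurable_funD; exact: mm.
- move=> x _; rewrite -!EFinB -!EFin_max -EFinD lee_fin ge_max; apply/andP; split.
    have := ler_normD (f x) (g x).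
    have : `|f x| - a <= Num.max (`|f x| - a) 0 by rewrite le_max lexx.
    have : `|g x| - b <= Num.max (`|g x| - b) 0 by rewrite le_max lexx.
    by rewrite /=; lra.
  by rewrite addr_ge0// le_max lexx orbT.
Qed.

End K_functional.

Lemma integral_cvg_le d (T : measurableType d) (R : realType)
    (mu : {measure set T -> \bar R}) (D : set T) (F : nat -> T -> \bar R)
    (g : T -> \bar R) (C : \bar R) : measurable D ->
  (forall n, measurable_fun D (F n)) -> (forall n x, D x -> 0 <= F n x)%E ->
  (forall x, D x -> F n x @[n --> \oo] --> g x) ->
  (forall n, \int[mu]_(x in D) F n x <= C)%E -> (\int[mu]_(x in D) g x <= C)%E.
Proof.
move=> mD mF F0 Fg FC.
rewrite (eq_integral (fun x => limn_einf (F^~ x))); last first.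
  by move=> x /set_mem Dx; rewrite (cvg_limn_einf_sup (Fg x Dx)).
apply: (le_trans (fatou mu mD mF F0)).
rewrite limn_einf_lim; apply: lime_le; first exact: is_cvg_einfs.
apply: nearW => n; apply: le_trans (FC n).
by apply: ereal_inf_lbound; exists n => /=.
Qed.

Section lorentz_triangle.
Context (R : realType) (phi : lorentz_weight R).
Local Notation lambda := (@lebesgue_measure R).
Implicit Types (f g : R -> R) (r a s t : R).

(* The chord interpolation of [phi] at the nodes [i / m], written as a
   combination of the functions [min(., i / m)]: concavity of [phi] is the
   nonnegativity of the coefficients. *)
Definition node (m i : nat) : R := phi (clamp01 (i%:R / m%:R)).
Definition slope (m i : nat) : R := m%:R * (node m i.+1 - node m i).
Definition chord (m : nat) s : R :=
  \sum_(i < m) (slope m i - slope m i.+1) * Num.min s (i.+1%:R / m%:R).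

Section chord_theory.
Variable m : nat.
Hypothesis m0 : (0 < m)%N.
Let mR : 0 < m%:R :> R. Proof. by rewrite ltr0n. Qed.

Lemma node_lt i : (i <= m)%N -> node m i = phi (i%:R / m%:R).
Proof.
by move=> im; rewrite /node clamp01_id ?divr_ge0// ler_pdivrMr// mul1r ler_nat.
Qed.

Lemma node_ge i : (m <= i)%N -> node m i = phi 1.
Proof.
move=> im; rewrite /node /clamp01 (min_r _) ?max_r//.
by rewrite ler_pdivlMr// mul1r ler_nat.
Qed.

(** Concavity at the midpoint of two nodes at distance 2/m. From the last cell on the next slope is
    0, and monotonicity of phi suffices. *)
Lemma slope_anti i : slope m i.+1 <= slope m i.
Proof.
rewrite /slope ler_pM2l//.
have [im|mi] := ltnP i.+1 m; last first.
  rewrite (node_ge (leqW mi)) (node_ge mi) subrr subr_ge0 -(node_ge mi).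
  by apply: weight_clamp_homo; rewrite ler_pM2r ?invr_gt0// ler_nat.
rewrite !node_lt ?(ltnW im) ?(ltnW (ltnW im))//.
have itv j : (j <= m)%N -> 0 <= (j%:R / m%:R : R) <= 1.
  by move=> jm; rewrite divr_ge0//= ler_pdivrMr// mul1r ler_nat.
have := weight_concaveE phi (u := 2^-1) _ (itv _ im) (itv _ (ltnW (ltnW im))).
rewrite invr_ge0 invf_le1// ler0n ler1n => /(_ isT).
have -> : 2^-1 * (i.+2%:R / m%:R) + (1 - 2^-1) * (i%:R / m%:R) = i.+1%:R / m%:R :> R.
  by rewrite -!natr1; field; rewrite gt_eqF.
lra.
Qed.

(** Summation by parts: for i < k the minimum is the node and the terms telescope ([T1]); from i = k
    on it is [s], and the differences of slopes telescope ([T2]). *)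
Lemma chord_cell k s : (k < m)%N -> k%:R <= s * m%:R -> s * m%:R <= k.+1%:R ->
  chord m s = node m k + slope m k * (s - k%:R / m%:R).
Proof.
move=> km ks sk.
have T1 n : (n <= k)%N ->
    \sum_(i < n) (slope m i - slope m i.+1) * Num.min s (i.+1%:R / m%:R) =
    node m n - slope m n * (n%:R / m%:R).
  elim: n => [_|n IH nk].
    by rewrite big_ord0 node_lt// !mul0r mulr0 subr0 weight0.
  rewrite big_ord_recr/= IH ?(ltnW nk)// min_r; last first.
    by rewrite ler_pdivrMr// (le_trans _ ks)// ler_nat.
  by rewrite /slope -!natr1; field; rewrite gt_eqF.
have T2 n : (k <= n)%N ->
    \sum_(i < n) (slope m i - slope m i.+1) * Num.min s (i.+1%:R / m%:R) =
    node m k - slope m k * (k%:R / m%:R) + (slope m k - slope m n) * s.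
  elim: n => [|n IH]; first by rewrite leqn0 => /eqP k0; rewrite T1// k0; ring.
  rewrite leq_eqVlt => /predU1P[<-|kn]; first by rewrite T1// subrr mul0r addr0.
  rewrite big_ord_recr/= IH// min_l; last first.
    by rewrite ler_pdivlMr// (le_trans sk)// ler_nat.
  by ring.
rewrite /chord T2 ?(ltnW km)//.
(* The clamp in [node] makes phi constant beyond 1, so the summation by parts leaves no boundary
   term. *)
have -> : slope m m = 0 by rewrite /slope !node_ge ?leqnSn// subrr mulr0.
by ring.
Qed.

Lemma exists_cell s : 0 <= s -> s <= 1 ->
  exists k, [/\ (k < m)%N, k%:R <= s * m%:R & s * m%:R <= k.+1%:R].
Proof.
move=> s0 s1; have sm0 : 0 <= s * m%:R by rewrite mulr_ge0.
have /andP[k1 k2] := truncn_itv sm0.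
have [km|mk] := ltnP (Num.truncn (s * m%:R)) m.
  by exists (Num.truncn (s * m%:R)); split => //; exact: ltW.
exists m.-1; rewrite prednK//; split => //.
  by apply: le_trans k1; rewrite ler_nat (leq_trans _ mk)// leq_pred.
by rewrite -[leRHS]mul1r ler_wpM2r.
Qed.

Lemma chord_le s : 0 <= s -> s <= 1 -> chord m s <= phi s.
Proof.
move=> s0 s1; have [k [km ks sk]] := exists_cell s0 s1.
rewrite (chord_cell km ks sk) /slope !node_lt ?(ltnW km)//.
have itv j : (j <= m)%N -> 0 <= (j%:R / m%:R : R) <= 1.
  by move=> jm; rewrite divr_ge0//= ler_pdivrMr// mul1r ler_nat.
have u01 : 0 <= s * m%:R - k%:R <= 1.
  by rewrite subr_ge0 ks lerBlDl natr1.
have := weight_concaveE phi u01 (itv _ km) (itv _ (ltnW km)).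
have -> : (s * m%:R - k%:R) * (k.+1%:R / m%:R) + (1 - (s * m%:R - k%:R)) * (k%:R / m%:R) = s.
  by rewrite -natr1; field; rewrite gt_eqF.
apply: le_trans; rewrite le_eqVlt; apply/orP; left; apply/eqP.
by field; rewrite gt_eqF.
Qed.

Lemma chord_ge s : 0 <= s -> s <= 1 ->
  exists r, [/\ 0 <= r, r <= s, s - r <= m%:R^-1 & phi r <= chord m s].
Proof.
move=> s0 s1; have [k [km ks sk]] := exists_cell s0 s1.
exists (k%:R / m%:R); split; first by rewrite divr_ge0.
- by rewrite ler_pdivrMr.
- by rewrite lerBlDl -[X in _ + X]mul1r -mulrDl ler_pdivlMr// natr1.
- rewrite (chord_cell km ks sk) node_lt ?(ltnW km)// lerDl mulr_ge0//.
    rewrite mulr_ge0// ?ler0n// subr_ge0; apply: weight_clamp_homo.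
    by rewrite ler_pM2r ?invr_gt0// ler_nat.
  by rewrite subr_ge0 ler_pdivrMr.
Qed.

Lemma chord_ge0 s : 0 <= s -> 0 <= chord m s.
Proof.
move=> s0; apply: sumr_ge0 => i _; rewrite mulr_ge0 ?subr_ge0 ?slope_anti//.
by rewrite le_min s0 divr_ge0.
Qed.

Lemma chord_Kfun f : measurable_fun I01 f ->
  (\int[lambda]_(t in `[0%R, +oo[) (chord m (dfun f t))%:E =
   \sum_(i < m) (slope m i - slope m i.+1)%:E * Kfun (i.+1%:R / m%:R)%R f)%E.
Proof.
move=> mf; rewrite /chord.
under eq_integral do rewrite -sumEFin.
have min0 (i : nat) t : 0 <= Num.min (dfun f t) (i.+1%:R / m%:R).
  by rewrite le_min dfun_ge0 divr_ge0.
rewrite ge0_integral_sum//=.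
- apply: eq_bigr => i _; under eq_integral do rewrite EFinM.
  rewrite ge0_integralZl_EFin//.
  + by move=> t _; rewrite lee_fin min0.
  + exact: measurable_min_dfun.
  + by rewrite subr_ge0 slope_anti.
- move=> i; apply/measurable_EFinP; apply: measurable_funM => //.
  by apply/measurable_EFinP; exact: measurable_min_dfun.
- by move=> i t _; rewrite lee_fin mulr_ge0// subr_ge0 slope_anti.
Qed.

End chord_theory.

Lemma chord_cvg s : 0 <= s -> s <= 1 -> chord n.+1 s @[n --> \oo] --> phi s.
Proof.
move=> s0 s1.
have /choice[r hr] : forall n, exists r,
    [/\ 0 <= r, r <= s, s - r <= n.+1%:R^-1 & phi r <= chord n.+1 s].
  by move=> n; exact: chord_ge.
apply: (@squeeze_cvgr _ _ _ _ (phi \o r) (fun=> phi s)); last exact: cvg_cst.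
  by apply: nearW => n; have [_ _ _ ->] := hr n; exact: chord_le.
apply: weight_cvg => //; [by move=> n; have [] := hr n|by move=> n; have [] := hr n|].
apply: (@squeeze_cvgr _ _ _ _ (fun n => s - n.+1%:R^-1) (fun=> s)); last exact: cvg_cst.
  by apply: nearW => n; have [_ -> + _] := hr n; rewrite lerBlDl -lerBlDr andbT.
rewrite -[X in _ --> X]subr0; apply: cvgB; [exact: cvg_cst|exact: cvg_harmonic].
Qed.

(** The approximation is from below: chords lie under phi, which bounds the right side directly, and
    Fatou recovers the full integral on the left. Convergence is thus needed for [f \+ g] only. *)
Lemma lorentz_integralD f g : measurable_fun I01 f -> measurable_fun I01 g ->
  (lorentz_integral phi (f \+ g)%R <= lorentz_integral phi f + lorentz_integral phi g)%E.
Proof.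
move=> mf mg; have mfg : measurable_fun I01 (f \+ g) by exact: measurable_funD.
have mc (h : R -> R) n : measurable_fun I01 h ->
    measurable_fun (`[0, +oo[%classic : set R) (fun t => (chord n.+1 (dfun h t))%:E).
  move=> mh; apply/measurable_EFinP; apply: nonincreasing_measurable => // x y xy.
  apply: ler_sum => i _; rewrite ler_wpM2l// ?subr_ge0 ?slope_anti//.
  by rewrite le_min !ge_min lexx orbT (dfun_anti mh xy).
have le (h : R -> R) n : measurable_fun I01 h ->
    (\int[lambda]_(t in `[0%R, +oo[) (chord n.+1 (dfun h t))%:E <= lorentz_integral phi h)%E.
  move=> mh; rewrite lorentz_integralE//; apply: ge0_le_integral => //.
  - by move=> t _; rewrite lee_fin chord_ge0// dfun_ge0.
  - exact: mc.
  - exact: measurable_weight_dfun.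
  - by move=> t _; rewrite lee_fin chord_le// ?dfun_ge0 ?dfun_le1.
rewrite [leLHS]lorentz_integralE//.
apply: (@integral_cvg_le _ _ _ lambda `[0, +oo[%classic
  (fun n t => (chord n.+1 (dfun (f \+ g) t))%:E)) => //.
- by move=> n; exact: mc.
- by move=> n t _; rewrite lee_fin chord_ge0// dfun_ge0.
- move=> t _; apply: cvg_EFin; first exact: nearW.
  by apply: chord_cvg; [exact: dfun_ge0|exact: dfun_le1].
move=> n; apply: le_trans (leeD (le _ n mf) (le _ n mg)).
rewrite !chord_Kfun// -big_split/=; apply: lee_sum => i _.
have c0 : (0 <= (slope n.+1 i - slope n.+1 i.+1)%:E)%E.
  by rewrite lee_fin subr_ge0 slope_anti.
rewrite -ge0_muleDr.
- by apply: lee_wpmul2l => //; apply: KfunD => //; rewrite divr_gt0.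
- by apply: integral_ge0 => t _; rewrite lee_fin le_min dfun_ge0 divr_ge0.
- by apply: integral_ge0 => t _; rewrite lee_fin le_min dfun_ge0 divr_ge0.
Qed.

End lorentz_triangle.

Section lorentz_basic.
Context (R : realType) (phi : lorentz_weight R).
Local Notation lambda := (@lebesgue_measure R).
Local Notation L := (lorentz_integral phi).
Implicit Types (f g : R -> R) (r a s t : R).

Lemma lorentz_integral_ge0 f : (0 <= L f)%E.
Proof. by apply: integral_ge0 => s _; exact: rearrangement_ge0. Qed.

Lemma lorentz_integral_le f g : measurable_fun I01 f -> measurable_fun I01 g ->
  (forall s, I01 s -> (rearrangement g s <= rearrangement f s)%E) -> (L g <= L f)%E.
Proof.
move=> mf mg gf; apply: ge0_le_integral => //.
- by move=> s _; exact: rearrangement_ge0.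
- exact: measurable_rearrangement.
- exact: measurable_rearrangement.
Qed.

Lemma distribution_ae_le f g : measurable_fun I01 f -> measurable_fun I01 g ->
  {ae lambda, forall x, I01 x -> `|g x| <= `|f x|} ->
  forall t, (distribution_function g t <= distribution_function f t)%E.
Proof.
move=> mf mg [Z [mZ Z0 gfZ]] t.
have mft := measurable_superlevel t mf; have mgt := measurable_superlevel t mg.
apply: (@le_trans _ _ (lambda ((I01 `&` [set x | t < `|f x|]) `|` Z))).
  apply: le_measure; rewrite ?inE//; first exact: measurableU.
  move=> x [Ix /= tg]; have [tf|ft] := ltP t `|f x|; first by left.
  right; apply: gfZ => /= /(_ Ix) gf; move: tg; rewrite ltNge => /negP; apply.
  exact: le_trans ft.
have := measureU2 lambda mft mZ.
by rewrite [X in (_ <= _ + X)%E -> _]Z0 adde0.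
Qed.

Lemma lorentz_integral_ae_le f g : measurable_fun I01 f -> measurable_fun I01 g ->
  {ae lambda, forall x, I01 x -> `|g x| <= `|f x|} -> (L g <= L f)%E.
Proof.
move=> mf mg gf; apply: lorentz_integral_le => // s _; apply: rearrangement_le => t _.
exact: distribution_ae_le.
Qed.

Lemma lorentz_integral0 : L (fun=> 0) = 0%E.
Proof.
rewrite lorentz_integralE; last exact: measurable_cst.
apply: integral0_eq => t; rewrite /= in_itv/= andbT => t0.
rewrite /dfun /distribution_function (_ : _ `&` _ = set0) ?measure0/= ?weight0//.
by rewrite -subset0 => x [_ /=]; rewrite normr0 ltNge t0.
Qed.

Lemma rearrangementZ a f s : measurable_fun I01 f -> a != 0 ->
  rearrangement (fun x => a * f x) s = (`|a|%:E * rearrangement f s)%E.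
Proof.
move=> mf a0; set af := fun x => a * f x; have na0 : 0 < `|a| by rewrite normr_gt0.
have maf : measurable_fun I01 af by exact: measurable_funM.
(* Both sides are nonnegative extended reals, so it is enough that they have the same nonnegative
   real upper bounds. *)
have key t : 0 <= t -> (rearrangement af s <= t%:E)%E <->
    (`|a|%:E * rearrangement f s <= t%:E)%E.
  move=> t0; rewrite -lee_pdivlMl// -EFinM.
  have ta0 : 0 <= `|a|^-1 * t by rewrite mulr_ge0 ?invr_ge0.
  split => /rearrangement_leP.
    move=> /(_ maf t0) h; apply/rearrangement_leP => //; move: h.
    rewrite /dfun /distribution_function.
    congr (fine (lambda (_ `&` _)) <= _); apply/seteqP; split => x /=.
      by rewrite /af normrM ltr_pdivrMl.
    by rewrite /af normrM ltr_pdivrMl.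
  move=> /(_ mf ta0) h; apply/rearrangement_leP => //; move: h.
  rewrite /dfun /distribution_function.
  congr (fine (lambda (_ `&` _)) <= _); apply/seteqP; split => x /=.
    by rewrite /af normrM ltr_pdivrMl.
  by rewrite /af normrM ltr_pdivrMl.
have r0 := rearrangement_ge0 f s.
have ar0 : (0 <= `|a|%:E * rearrangement f s)%E by rewrite mule_ge0// lee_fin.
have afr0 := rearrangement_ge0 af s.
apply/eqP; rewrite eq_le; apply/andP; split.
  case E : (`|a|%:E * rearrangement f s)%E ar0 => [t| |]//; rewrite ?leey//.
  by rewrite lee_fin => t0; apply/(key t t0); rewrite E.
case E : (rearrangement af s) afr0 => [t| |]//; rewrite ?leey//.
by rewrite lee_fin => t0; apply/(key t t0); rewrite E.
Qed.

Lemma lorentz_integralZ a f : measurable_fun I01 f ->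
  L (fun x => a * f x) = (`|a|%:E * L f)%E.
Proof.
move=> mf; have [->|a0] := eqVneq a 0.
  rewrite normr0 mul0e -lorentz_integral0; congr L.
  by apply/funext => x; rewrite mul0r.
rewrite /lorentz_integral -ge0_integralZl_EFin//.
- by apply: eq_integral => s _; rewrite rearrangementZ.
- by move=> s _; exact: rearrangement_ge0.
- exact: measurable_rearrangement.
Qed.

Lemma lorentz_integral_L1 f : measurable_fun I01 f ->
  ((phi 1)%:E * \int[lambda]_(x in I01) `|f x|%:E <= L f)%E.
Proof.
move=> mf; have p1 : 0 <= phi 1 by exact: weight_ge0.
have -> : (\int[lambda]_(x in I01) `|f x|%:E = \int[lambda]_(t in `[0%R, +oo[) (dfun f t)%:E)%E.
  rewrite dfun_tailE//; apply: eq_integral => x _.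
  by rewrite sube0 max_l// lee_fin.
rewrite lorentz_integralE// -ge0_integralZl_EFin//.
- apply: ge0_le_integral => //.
  + by move=> t _; rewrite mule_ge0// lee_fin// dfun_ge0.
  + by apply: measurable_funeM; exact: measurable_dfun.
  + exact: measurable_weight_dfun.
  + move=> t _; rewrite -EFinM lee_fin mulrC.
    have := weight_star phi (dfun_ge0 f t) (dfun_le1 mf t) (lexx 1).
    by rewrite mul1r.
- by move=> t _; rewrite lee_fin dfun_ge0.
- exact: measurable_dfun.
Qed.

(** Points with |f| > t eventually have |g k| > t, so they lie in the increasing union over m of the
    sets [B m t] on which all |g k| with k >= m exceed t. Left continuity of phi gives convergence
    along this union, and Fatou applies to the integral over t. *)
Lemma lorentz_integral_fatou (g : nat -> R -> R) f (C : \bar R) :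
  (forall k, measurable_fun I01 (g k)) -> measurable_fun I01 f ->
  (forall x, I01 x -> g k x @[k --> \oo] --> f x) ->
  (forall k, (L (g k) <= C)%E) -> (L f <= C)%E.
Proof.
move=> mg mf gf gC.
pose B m t := \bigcap_(k in [set k | (m <= k)%N]) (I01 `&` [set x | t < `|g k x|]).
have mB m t : measurable (B m t).
  apply: bigcap_measurable; first by exists m => /=.
  by move=> k _; exact: measurable_superlevel.
have BI m t : B m t `<=` I01 by move=> x /(_ m (leqnn m))[].
have fin (S : set R) : measurable S -> S `<=` I01 ->
    lambda S = (fine (lambda S))%:E /\ fine (lambda S) <= 1.
  move=> mS SI; have le1 : (lambda S <= 1)%E.
    by rewrite -(lebesgue_I01 R); apply: le_measure; rewrite ?inE.
  have E : lambda S = (fine (lambda S))%:E.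
    by rewrite fineK// ge0_fin_numE// (le_lt_trans le1)// ltry.
  by split => //; rewrite -lee_fin -E.
pose b m t := fine (lambda (B m t)).
have bE m t : lambda (B m t) = (b m t)%:E by have [] := fin _ (mB m t) (@BI m t).
have b1 m t : b m t <= 1 by have [] := fin _ (mB m t) (@BI m t).
have b0 m t : 0 <= b m t by rewrite fine_ge0.
pose c t := fine (lambda (\bigcup_m B m t)).
have mU t : measurable (\bigcup_m B m t) by apply: bigcup_measurable => m _; exact: mB.
have UI t : \bigcup_m B m t `<=` I01 by apply: bigcup_sub => m _; exact: BI.
have cE t : lambda (\bigcup_m B m t) = (c t)%:E by have [] := fin _ (mU t) (UI t).
have c1 t : c t <= 1 by have [] := fin _ (mU t) (UI t).
have c0 t : 0 <= c t by rewrite fine_ge0.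
have bc m t : b m t <= c t.
  rewrite -lee_fin -bE -cE; apply: le_measure; rewrite ?inE; [exact: mB|exact: mU|].
  by move=> x Bx; exists m.
have bcvg t : b m t @[m --> \oo] --> c t.
  have : (lambda \o B^~ t) m @[m --> \oo] --> lambda (\bigcup_m B m t).
    apply: nondecreasing_cvg_mu; [by move=> m; exact: mB|exact: mU|].
    by move=> m n mn; apply/subsetPset => x Bx k /= nk; apply: Bx => /=; exact: leq_trans nk.
  by rewrite cE => /fine_cvgP[].
have anti m s t : s <= t -> B m t `<=` B m s.
  move=> st x Bx k mk; have [Ix /= tx] := Bx k mk; split => //=; exact: le_lt_trans tx.
rewrite lorentz_integralE//.
apply: (@le_trans _ _ (\int[lambda]_(t in `[0%R, +oo[) (phi (c t))%:E)%E).
  apply: ge0_le_integral => //.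
  - by move=> t _; rewrite lee_fin weight_ge0 ?dfun_ge0 ?dfun_le1.
  - exact: measurable_weight_dfun.
  - apply/measurable_EFinP; apply: nonincreasing_measurable => // s t st.
    apply: weight_le => //; rewrite -lee_fin -!cE.
    apply: le_measure; rewrite ?inE; [exact: mU|exact: mU|].
    by move=> x [m _ Bx]; exists m => //; exact: anti st _ Bx.
  - move=> t _; rewrite lee_fin; apply: weight_le; rewrite ?dfun_ge0//.
    rewrite -lee_fin -dfunE// -cE; apply: le_measure; rewrite ?inE;
      [exact: measurable_superlevel|exact: mU|].
    move=> x [Ix /= tx]; have fx0 : 0 < `|f x| - t by rewrite subr_gt0.
    have /cvgrPdist_lt/(_ _ fx0)[m _ hm] := gf x Ix.
    exists m => // k /= mk; split => //=.
    have := hm k mk; have := ler_distD (g k x) (f x) 0; rewrite !subr0; lra.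
apply: (@integral_cvg_le _ _ _ lambda `[0, +oo[%classic (fun m t => (phi (b m t))%:E));
  first exact: measurable_itv.
- move=> m; apply/measurable_EFinP; apply: nonincreasing_measurable => // s t st.
  apply: weight_le => //; rewrite -lee_fin -!bE.
  apply: le_measure; rewrite ?inE; [exact: mB|exact: mB|].
  exact: anti.
- by move=> m t _; rewrite lee_fin weight_ge0.
- move=> t _; apply: cvg_EFin; first exact: nearW.
  exact: weight_cvg.
move=> m; apply: le_trans (gC m); rewrite lorentz_integralE//.
apply: ge0_le_integral => //.
- by move=> t _; rewrite lee_fin weight_ge0.
- apply/measurable_EFinP; apply: nonincreasing_measurable => // s t st.
  apply: weight_le => //; rewrite -lee_fin -!bE.
  apply: le_measure; rewrite ?inE; [exact: mB|exact: mB|].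
  exact: anti.
- exact: measurable_weight_dfun.
- move=> t _; rewrite lee_fin; apply: weight_le; rewrite ?dfun_le1//.
  rewrite -lee_fin -dfunE// -bE; apply: le_measure; rewrite ?inE;
    [exact: mB|exact: measurable_superlevel|].
  by move=> x /(_ m (leqnn m)).
Qed.

End lorentz_basic.

(** * Completeness and rearrangement invariance of Lorentz spaces *)

Section lorentz_ri.
Context (R : realType) (phi : lorentz_weight R).
Hypothesis phi1 : 0 < phi 1.
Local Notation lambda := (@lebesgue_measure R).
Local Notation L := (lorentz_integral phi).
Local Notation X := (lorentz_space phi).
Local Notation N := (lorentz_norm phi).
Implicit Types (f g : R -> R) (r a s t : R).

Lemma lorentz_normE f : X f -> L f = (N f)%:E.
Proof. by move=> [_ Lf]; rewrite fineK// ge0_fin_numE// lorentz_integral_ge0. Qed.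

Lemma lorentz_le f g : X f -> measurable_fun I01 g -> (L g <= L f)%E -> X g /\ N g <= N f.
Proof.
move=> Xf mg gf; have Xg : X g by split => //; apply: le_lt_trans gf _; case: Xf.
split; first exact: Xg.
by move: gf; rewrite (lorentz_normE Xf) (lorentz_normE Xg) lee_fin.
Qed.

Lemma lorentz_add f g : X f -> X g -> X (f \+ g) /\ N (f \+ g) <= N f + N g.
Proof.
move=> Xf Xg; have [mf _] := Xf; have [mg _] := Xg.
have le := lorentz_integralD phi mf mg.
have Xfg : X (f \+ g).
  split; first exact: measurable_funD.
  by apply: le_lt_trans le _; rewrite (lorentz_normE Xf) (lorentz_normE Xg) -EFinD ltry.
split; first exact: Xfg.
by move: le; rewrite (lorentz_normE Xf) (lorentz_normE Xg) (lorentz_normE Xfg) -EFinD lee_fin.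
Qed.

Lemma lorentz_scale a f : X f -> X (fun x => a * f x) /\ N (fun x => a * f x) = `|a| * N f.
Proof.
move=> Xf; have [mf _] := Xf.
have Xa : X (fun x => a * f x).
  split; first exact: measurable_funM.
  by rewrite lorentz_integralZ// (lorentz_normE Xf) -EFinM ltry.
split; first exact: Xa.
have := lorentz_integralZ phi a mf; rewrite (lorentz_normE Xf) (lorentz_normE Xa) -EFinM.
by case.
Qed.

Lemma lorentz_sub f g : X f -> X g -> X (f \- g).
Proof.
move=> Xf Xg; have [X1 _] := lorentz_scale (-1) Xg.
have [+ _] := lorentz_add Xf X1; congr X.
by apply/funext => x /=; rewrite mulN1r.
Qed.

Lemma lorentz_norm_L1 f : X f ->
  (\int[lambda]_(x in I01) `|f x|%:E <= ((phi 1)^-1 * N f)%:E)%E.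
Proof.
move=> Xf; have [mf _] := Xf.
by rewrite EFinM lee_pdivlMl// -(lorentz_normE Xf) lorentz_integral_L1.
Qed.

(** Along a rapidly Cauchy subsequence the increments are summable in L^1, because phi(1) > 0 bounds
    the L^1 norm by the Lorentz norm; the subsequence therefore converges almost everywhere. The
    Cauchy bounds pass to the limit by [lorentz_integral_fatou]. *)
Lemma lorentz_complete (u : nat -> R -> R) : (forall n, X (u n)) ->
  (forall e : R, 0 < e -> exists M : nat, forall m n : nat,
     (M <= m)%N -> (M <= n)%N -> N (u m \- u n) < e) ->
  exists2 f, X f & N (u n \- f) @[n --> \oo] --> (0 : R).
Proof.
move=> Xu cu.
have mu_ n : measurable_fun I01 (u n) by have [] := Xu n.
have e0 k : 0 < (2 ^+ k.+1)^-1 :> R by rewrite invr_gt0 exprn_gt0.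
pose M k := projT1 (cid (cu _ (e0 k))).
have MP k : forall m n, (M k <= m)%N -> (M k <= n)%N -> N (u m \- u n) < (2 ^+ k.+1)^-1.
  exact: projT2 (cid (cu _ (e0 k))).
pose n_ k := (\max_(i < k.+1) M i)%N.
have nM k : (M k <= n_ k)%N.
  by have := leq_bigmax (F := fun i : 'I_k.+1 => M i) ord_max.
have nS k : (n_ k <= n_ k.+1)%N by rewrite /n_ [leqRHS]big_ord_recr/= leq_maxl.
have n_le k j : (n_ k <= n_ (k + j)%N)%N.
  by elim: j => [|j IH]; rewrite ?addn0// addnS (leq_trans IH).
pose w k := u (n_ k.+1) \- u (n_ k).
have Xw k : X (w k) by exact: lorentz_sub.
have mw k : measurable_fun I01 (fun x => `|w k x|%:E).
  by apply/measurable_EFinP; apply: measurableT_comp => //; have [] := Xw k.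
have Nw k : N (w k) < (2 ^+ k.+1)^-1.
  by apply: MP => //; rewrite (leq_trans (nM k)).
pose S x := (\sum_(k <oo) `|w k x|%:E)%E.
have mS : measurable_fun I01 S by apply: ge0_emeasurable_sum.
have S0 x : (0 <= S x)%E by apply: nneseries_ge0.
have iS : lambda.-integrable I01 S.
  apply/integrableP; split => //.
  under eq_integral do rewrite gee0_abs//.
  rewrite integral_nneseries//.
  apply: (@le_lt_trans _ _ (\sum_(k <oo) ((phi 1)^-1 / (2 ^ k.+1)%:R)%:E)%E).
    apply: lee_nneseries => [k *|k *]; first by apply: integral_ge0 => x _; rewrite lee_fin.
    apply: le_trans (lorentz_norm_L1 (Xw k)) _.
    by rewrite lee_fin ler_wpM2l// ?invr_ge0 ?ltW// natrX.
  apply: le_lt_trans (ltry ((phi 1)^-1)).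
  by apply: (epsilon_trick0 xpredT); rewrite invr_ge0 ltW.
pose G := I01 `&` [set x | S x < +oo]%E.
have mG : measurable G by exact: emeasurable_fun_infty_o.
have aeG : {ae lambda, forall x, I01 x -> G x}.
  have aS : {ae lambda, forall x, I01 x -> S x \is a fin_num} by exact: integrable_ae.
  apply: (ae_imply aS) => x + Ix; move/(_ Ix) => Sx.
  by split => //=; rewrite ltey_eq Sx.
(* Replacing the functions by 0 off [G] makes the convergence hold at every point of [0,1] and
   changes them only on a null set. *)
pose v k x := if x \in G then u (n_ k) x else 0.
have mv k : measurable_fun I01 (v k) by exact: measurable_fun_if_mem.
have cv x : I01 x -> cvgn (v ^~ x).
  move=> Ix; case: (asboolP (G x)) => [Gx|nGx]; last first.
    rewrite (_ : v ^~ x = fun=> 0); first exact: is_cvg_cst.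
    by apply/funext => k; rewrite /v memNset.
  have Sfin : S x \is a fin_num by rewrite ge0_fin_numE//; case: Gx.
  have cw : cvgn (series (fun k => w k x)).
    apply: normed_cvg; apply: nondecreasing_is_cvgn.
      apply/nondecreasing_seqP => k; rewrite /= /series/= [leRHS]big_nat_recr//=.
      by rewrite lerDl.
    exists (fine (S x)) => _ [k _ <-] /=.
    rewrite -lee_fin fineK// /series/= -sumEFin.
    by apply: nneseries_lim_ge.
  rewrite (_ : v ^~ x = (fun k => u (n_ 0%N) x + series (fun k => w k x) k)).
    exact: is_cvgD (is_cvg_cst _) cw.
  apply/funext => k; rewrite /v mem_set// /series/= /w telescope_sumr//.
  by rewrite addrC subrK.
pose f (x : R) : R := lim (v k x @[k --> \oo]).
have mf : measurable_fun I01 f.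
  by apply: (measurable_fun_cvg (h := v)) => // x Ix; exact: cv.
have near K j : (n_ K <= j)%N -> (L (u j \- f)%R <= ((2 ^+ K.+1)^-1)%:E)%E.
  move=> Kj; apply: (@lorentz_integral_fatou _ _ (fun k => u j \- v (k + K)%N)).
  - by move=> k; exact: measurable_funB.
  - exact: measurable_funB.
  - move=> x Ix; apply: cvgB; first exact: cvg_cst.
    by rewrite (cvg_shiftn K (v ^~ x)); exact: cv.
  move=> k; have Xuv := lorentz_sub (Xu j) (Xu (n_ (k + K)%N)).
  apply: (@le_trans _ _ (L (u j \- u (n_ (k + K)%N)))).
    apply: lorentz_integral_ae_le; [by have [] := Xuv|exact: measurable_funB|].
    by apply: (ae_imply aeG) => x + Ix; move/(_ Ix) => Gx; rewrite /= /v mem_set.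
  rewrite (lorentz_normE Xuv) lee_fin ltW// MP// ?(leq_trans (nM K))//.
  by rewrite addnC.
have Xuf j : (n_ 0%N <= j)%N -> X (u j \- f).
  move=> j0; split; first exact: measurable_funB.
  by rewrite (le_lt_trans (near _ _ j0))// ltry.
exists f.
  have := lorentz_sub (Xu (n_ 0%N)) (Xuf _ (leqnn _)); congr X.
  by apply/funext => x /=; rewrite opprB addrC subrK.
apply/cvgrPdist_le => e e1.
have [||K hK] := @exists_expr_lt R 2^-1 e _ _ e1; [by rewrite invr_ge0| |].
  by rewrite invf_lt1 ?ltr1n.
exists (n_ K) => // j /= Kj; rewrite sub0r normrN.
have Xj : X (u j \- f) by apply: Xuf; apply: leq_trans Kj; exact: (n_le 0%N).
have := near _ _ Kj; rewrite (lorentz_normE Xj) lee_fin => le.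
rewrite ger0_norm; last by rewrite fine_ge0// lorentz_integral_ge0.
apply: le_trans le _; apply: le_trans (ltW hK).
by rewrite exprVn lef_pV2 ?posrE ?exprn_gt0// exprS ler_peMl ?exprn_ge0// ler1n.
Qed.

Lemma lorentz_indic (A : set R) : measurable A ->
  L (\1_A) = (phi (fine (lambda (I01 `&` A))))%:E.
Proof.
move=> mA; rewrite lorentz_integralE; last exact: measurable_indic.
set c : \bar R := (phi _)%:E.
transitivity (\int[lambda]_(t in `[0%R, +oo[) ((fun _ : R => c) \_ (`[0%R, 1%R[%classic : set R)) t)%E.
  apply: eq_integral => t /set_mem; rewrite /= in_itv/= andbT => t0.
  rewrite patchE mem_setE in_itv/= t0/= /dfun distribution_indic//.
  by case: ifP => // _; rewrite weight0.
rewrite -integral_mkcondr (_ : _ `&` _ = `[0, 1[%classic); last first.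
  by apply/seteqP; split => x /=; rewrite !in_itv/= ?andbT; [case|move=> /andP[-> ->]].
by rewrite integral_cst//= lebesgue_measure_itv/= lte_fin ltr01 oppr0 adde0 mule1.
Qed.

Lemma lorentz_indic_in (A : set R) : measurable A -> X (\1_A).
Proof.
by move=> mA; split; [exact: measurable_indic|rewrite lorentz_indic// ltry].
Qed.

Lemma lorentz_ri_space : ri_space X N.
Proof.
have X0 : X (fun=> 0).
  by split; [exact: measurable_cst|rewrite lorentz_integral0].
split.
- split.
  + by move=> f [].
  + exact: X0.
  + by move=> f g Xf Xg; have [] := lorentz_add Xf Xg.
  + by move=> a f Xf; have [] := lorentz_scale a Xf.
  + by move=> f g Xf Xg; have [] := lorentz_add Xf Xg.
  + by move=> a f Xf; have [] := lorentz_scale a Xf.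
  + move=> f Xf Nf; have [mf _] := Xf.
    have := lorentz_norm_L1 Xf; rewrite Nf mulr0 => le0.
    have mEf : measurable_fun I01 (EFin \o f) by exact/measurable_EFinP.
    have f0 : (\int[lambda]_(x in I01) `|(EFin \o f) x| = 0)%E.
      by apply/eqP; rewrite eq_le le0 integral_ge0.
    have := (ae_eq_integral_abs lambda measurable_I01 mEf).1 f0.
    by move=> h; apply: (ae_imply h) => x /[apply] -[].
  + exact: lorentz_complete.
  + move=> f g Xf mg gf; apply: (lorentz_le Xf mg).
    by apply: lorentz_integral_ae_le => //; have [] := Xf.
- exists (\1_setT); first exact: lorentz_indic_in.
  move=> [Z [mZ Z0 hZ]].
  have : (lambda I01 <= lambda Z)%E.
    apply: le_measure; rewrite ?inE//.
    move=> x Ix; apply: hZ => /= /(_ Ix); rewrite indicE in_setT => /eqP.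
    by rewrite oner_eq0.
  by rewrite Z0 lebesgue_I01 lee_fin ler10.
- move=> f g Xf mg gf; apply: (lorentz_le Xf mg).
  by apply: lorentz_integral_le => //; have [] := Xf.
Qed.

End lorentz_ri.

(** * Dilation indices *)

Section dilation_indices.
Context (R : realType) (phi : lorentz_weight R).
Implicit Types (s t q : R).

(** Where phi(s) = 0 the quotient is 0 by convention and carries no information about phi(st); the
    last hypothesis covers that case. *)
Lemma weight_ratio_sup s t (S : set R) (B : R) : S (phi (s * t) / phi s) ->
  (forall r, S r -> r <= B) -> 0 <= s -> s <= 1 -> 0 <= s * t -> s * t <= 1 ->
  (phi s = 0 -> phi (s * t) = 0) -> phi (s * t) <= sup S * phi s.
Proof.
move=> Sr SB s0 s1 st0 st1 p0.
have p0s := weight_ge0 phi s0 s1.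
have [ps|ps] := eqVneq (phi s) 0; first by rewrite p0// ps mulr0.
rewrite -ler_pdivrMr ?lt_neqAle 1?eq_sym ?ps//.
by apply: ub_le_sup => //; exists B.
Qed.

(** Positivity of the limit makes the quotient of logarithms positive at some t < 1. As ln t < 0,
    the supremum of the ratios phi(st)/phi(s) is then below 1, and it serves as [q]. *)
Lemma lower_dilation_index_gt0 : 0 < lower_dilation_index phi ->
  0 < phi 1 /\ exists t q, [/\ 0 < t < 1, 0 < q < 1 &
    forall s, 0 < s -> s <= 1 -> phi (t * s) <= q * phi s].
Proof.
rewrite /lower_dilation_index; set g := fun t => _ / ln t => g0.
(* A limit that does not exist is 0 by convention, so a positive index certifies convergence. *)
have cg : cvg (g t @[t --> 0^'+]).
  by apply: contrapT => /dvgP gpt; move: g0; rewrite gpt ltxx.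
have [t [/andP[t0 t1] gt]] : exists t, 0 < t < 1 /\ 0 < g t.
  have /cvgrPdist_lt/(_ _ g0) h := cg.
  near (0 : R)^'+ => t.
  exists t; split; first by apply/andP; split; near: t; [exact: nbhs_right_gt|exact: nbhs_right_lt].
  have : `|lim (g t @[t --> 0^'+]) - g t| < lim (g t @[t --> 0^'+]) by near: t.
  by move=> /(le_lt_trans (ler_norm _)); rewrite gtrBl.
pose S := [set phi (s * t) / phi s | s in `]0, 1]].
have SB r : S r -> r <= 1.
  move=> [s /=]; rewrite in_itv/= => /andP[s0 s1] <-.
  have st : s * t <= s by rewrite ler_piMr// ltW.
  have p0 := weight_ge0 phi (ltW s0) s1.
  have [->|ps] := eqVneq (phi s) 0; first by rewrite invr0 mulr0.
  rewrite ler_pdivrMr ?mul1r ?weight_le//; first by rewrite mulr_ge0// ltW.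
  by rewrite lt_neqAle eq_sym ps.
have lnt : ln t < 0 by apply: ln_lt0; rewrite t0 t1.
have lnS : ln (sup S) < 0.
  by move: gt; rewrite /g -/S => h; rewrite -(ltr_nM2r (x := (ln t)^-1)) ?mul0r// invr_lt0.
(* The logarithm is 0 at nonpositive arguments, so a negative value forces a positive argument. This
   also excludes phi(1) = 0 below, where all ratios would be 0. *)
have S0 : 0 < sup S by rewrite ltNge; apply/negP => /ln0 E; move: lnS; rewrite E ltxx.
have S1 : sup S < 1 by rewrite ltNge; apply/negP => /ln_ge0; rewrite leNgt lnS.
split.
  have p1 := weight_ge0 phi ler01 (lexx 1).
  rewrite lt_neqAle p1 andbT eq_sym; apply/eqP => p10.
  have : sup S <= 0.
    apply: ge_sup; first by exists (phi (1 * t) / phi 1), 1 => //=; rewrite in_itv/= ltr01 lexx.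
    move=> r [s /=]; rewrite in_itv/= => /andP[s0 s1] <-.
    suff -> : phi s = 0 by rewrite invr0 mulr0.
    by apply/eqP; rewrite eq_le (weight_ge0 phi (ltW s0) s1) -p10 weight_le// ltW.
  by rewrite leNgt S0.
exists t, (sup S); split; [by rewrite t0 t1|by rewrite S0 S1|].
move=> s s0 s1; rewrite mulrC.
have st0 : 0 <= s * t by rewrite mulr_ge0// ltW.
have st : s * t <= s by rewrite ler_piMr// ltW.
apply: weight_ratio_sup SB _ _ _ _ _ => //; rewrite ?(ltW s0)//.
- by exists s => //=; rewrite in_itv/= s0.
- exact: le_trans s1.
- move=> ps; apply/eqP; rewrite eq_le (weight_ge0 phi st0 (le_trans st s1)) andbT.
  by rewrite -ps weight_le.
Unshelve. all: by end_near. Qed.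

(** An index below 1 gives some t > 1 at which the logarithm of the supremum is below ln t; the
    supremum is [M]. Positivity of the index guarantees that the limit exists, and [weight_scale]
    that the supremum is finite. *)
Lemma upper_dilation_index_lt1 : 0 < upper_dilation_index phi ->
  upper_dilation_index phi < 1 -> exists t M, [/\ 1 < t, 0 <= M < t &
    forall s, 0 < s -> s * t <= 1 -> phi (s * t) <= M * phi s].
Proof.
rewrite /upper_dilation_index; set g := fun t => _ / ln t => g0 g1.
have cg : cvg (g t @[t --> +oo]).
  by apply: contrapT => /dvgP gpt; move: g0; rewrite gpt ltxx.
have [t [t1 gt]] : exists t, 1 < t /\ g t < 1.
  have e0 : 0 < 1 - lim (g t @[t --> +oo]) by rewrite subr_gt0.
  have /cvgrPdist_lt/(_ _ e0) h := cg.
  near (pinfty_nbhs R) => t.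
  exists t; split; first by near: t; exact: nbhs_pinfty_gt.
  have : `|lim (g t @[t --> +oo]) - g t| < 1 - lim (g t @[t --> +oo]) by near: t.
  by rewrite distrC => /(le_lt_trans (ler_norm _)); rewrite ltrD2r.
have t0 : 0 < t by exact: lt_trans t1.
pose S := [set phi (s * t) / phi s | s in `]0, t^-1]].
have itvS s : s \in `]0, t^-1] -> 0 < s /\ s * t <= 1.
  by rewrite in_itv/= => /andP[s0 st]; split => //; rewrite -ler_pdivlMr// mul1r.
have s1 s : 0 < s -> s * t <= 1 -> s <= 1.
  by move=> s0; apply: le_trans; rewrite ler_pMr// ltW.
have sc s : 0 < s -> s * t <= 1 -> phi (s * t) <= t * phi s.
  by move=> s0; rewrite mulrC => st; apply: weight_scale => //; exact: ltW.
have SB r : S r -> r <= t.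
  move=> [s /itvS[s0 st] <-].
  have p0 := weight_ge0 phi (ltW s0) (s1 _ s0 st).
  have [->|ps] := eqVneq (phi s) 0; first by rewrite invr0 mulr0 ltW.
  by rewrite ler_pdivrMr ?sc// lt_neqAle eq_sym ps.
have tS : t^-1 \in `]0, t^-1] by rewrite in_itv/= invr_gt0 t0 lexx.
have S0 : 0 <= sup S.
  apply: (@le_trans _ _ (phi (t^-1 * t) / phi t^-1)).
    by rewrite mulVf ?gt_eqF// divr_ge0// weight_ge0// ?invr_ge0 ?ltW// invf_lt1.
  by apply: ub_le_sup; [exists t|exists t^-1].
have St : sup S < t.
  have lnt : 0 < ln t by rewrite ln_gt0.
  move: gt; rewrite /g -/S ltr_pdivrMr// mul1r.
  have [->//|S1] := eqVneq (sup S) 0.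
  by rewrite ltr_ln// posrE lt_neqAle eq_sym S1.
exists t, (sup S); split => //; first by rewrite S0.
move=> s s0 st; have st0 : 0 <= s * t by rewrite mulr_ge0 ?ltW.
apply: weight_ratio_sup SB _ _ _ _ _ => //.
- by exists s => //=; rewrite in_itv/= s0 -[leRHS]mul1r ler_pdivlMr.
- exact: ltW.
- exact: s1.
- move=> ps; apply/eqP; rewrite eq_le weight_ge0// andbT.
  by rewrite (le_trans (sc s s0 st))// ps mulr0.
Unshelve. all: by end_near. Qed.

End dilation_indices.

Lemma nonincreasing_in_measurable (R : realType) (D : set R) (f : R -> R) :
  is_interval D -> measurable D ->
  (forall x y, D x -> D y -> x <= y -> f y <= f x) -> measurable_fun D f.
Proof.
move=> iD mD anti; apply: (measurability (@RGenCInfty.G R)).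
  exact: RGenCInfty.measurableE.
move=> _ [_ [r ->] <-]; apply: is_interval_measurable => s t /=.
rewrite !in_itv/= !andbT => -[Ds rs] [Dt rt] u /andP[su ut].
have Du : D u by apply: (iD s t) => //; rewrite su ut.
by split => //; rewrite in_itv/= andbT (le_trans rt)// anti.
Qed.

(** * Integrals of phi(y)/y and the lower index *)

Section lorentz_weight_integral.
Context (R : realType) (phi : lorentz_weight R).
Local Notation lambda := (@lebesgue_measure R).
Implicit Types (f : R -> R) (s t q y a : R).

Definition wratio y : R := phi y / y.

Lemma wratio_ge0 y : 0 <= y -> y <= 1 -> 0 <= wratio y.
Proof. by move=> y0 y1; rewrite divr_ge0// weight_ge0. Qed.

Lemma wratio_anti x y : 0 < x -> x <= y -> y <= 1 -> wratio y <= wratio x.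
Proof.
move=> x0 xy y1; have y0 := lt_le_trans x0 xy.
rewrite /wratio ler_pdivrMr// mulrAC ler_pdivlMr// mulrC [leRHS]mulrC.
exact: weight_star (ltW x0) xy y1.
Qed.

Lemma measurable_wratio : measurable_fun (`]0, 1]%classic : set R) wratio.
Proof.
apply: nonincreasing_in_measurable => //; first exact: interval_is_interval.
by move=> x y; rewrite /= !in_itv/= => /andP[x0 _] /andP[_ y1] xy; exact: wratio_anti.
Qed.

Variables (t0 q : R).
Hypothesis t01 : 0 < t0 < 1.
Hypothesis q01 : 0 < q < 1.
Hypothesis phit : forall s, 0 < s -> s <= 1 -> phi (t0 * s) <= q * phi s.

(** The solution of c q + 1/t0 = c, which is the recursion in [wratio_dyadic]. *)
Let c := (t0 * (1 - q))^-1.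

Let c0 : 0 <= c.
Proof.
have /andP[? _] := t01; have /andP[_ q1] := q01.
by rewrite invr_ge0 mulr_ge0 ?subr_ge0 ?ltW.
Qed.

(** On ]t0 a, a] the integrand is at most phi(a)/(t0 a) and the length at most a, which contributes
    phi(a)/t0. The rest is the same integral with t0 a in place of a, where phi(t0 a) <= q
    phi(a). *)
Lemma wratio_dyadic n a : 0 < a -> a <= 1 ->
  (\int[lambda]_(y in `](t0 ^+ n * a)%R, a]) (wratio y)%:E <= (c * phi a)%:E)%E.
Proof.
have /andP[t00 t11] := t01; have /andP[q0 q1] := q01.
have mW (x y : R) : 0 <= x -> y <= 1 ->
    measurable_fun (`]x, y]%classic : set R) (fun y => (wratio y)%:E).
  move=> x0 y1; apply/measurable_EFinP; apply: measurable_funS measurable_wratio => //.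
  by move=> z; rewrite /= !in_itv/= => /andP[xz zy]; rewrite (le_lt_trans x0 xz) (le_trans zy y1).
elim: n a => [|n IH] a a0 a1.
  by rewrite expr0 mul1r set_itvoc0 integral_set0 lee_fin mulr_ge0 ?weight_ge0 ?(ltW a0).
have ta0 : 0 < t0 * a by rewrite mulr_gt0.
have taa : t0 * a <= a by rewrite ger_pMl// ltW.
have ta1 : t0 * a <= 1 by exact: le_trans a1.
have tna0 : 0 < t0 ^+ n.+1 * a by rewrite mulr_gt0// exprn_gt0.
have tnta : t0 ^+ n.+1 * a <= t0 * a.
  by rewrite ler_pM2r// exprS ger_pMr// exprn_ile1// ltW.
have U : `]t0 ^+ n.+1 * a, a]%classic =
    `]t0 ^+ n.+1 * a, t0 * a]%classic `|` `]t0 * a, a]%classic :> set R.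
  apply/seteqP; split => x /=; rewrite !in_itv/=.
    by move=> /andP[tx xa]; have [xt|xt] := leP x (t0 * a); [left|right]; rewrite ?tx ?xa.
  by case => /andP[? ?]; apply/andP; split => //; [exact: le_trans taa|exact: le_lt_trans tnta _].
rewrite U ge0_integral_setU//=; first last.
- apply/disj_set2P/seteqP; split => // x /=; rewrite !in_itv/= => -[/andP[_ xt] /andP[tx _]].
  by move: tx; rewrite ltNge xt.
- move=> x; rewrite !in_itv/= => -[/andP[x0 x1]|/andP[x0 x1]]; rewrite lee_fin wratio_ge0//.
  + by rewrite ltW// (lt_trans tna0).
  + exact: le_trans ta1.
  + by rewrite ltW// (lt_trans ta0).
  + exact: le_trans a1.
- by rewrite -U; exact: mW (ltW tna0) a1.
apply: (@le_trans _ _ ((c * phi (t0 * a))%:E + (t0^-1 * phi a)%:E)%E); last first.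
  rewrite -EFinD lee_fin; apply: (@le_trans _ _ (c * (q * phi a) + t0^-1 * phi a)).
    by rewrite lerD2r ler_wpM2l// phit.
  rewrite le_eqVlt; apply/orP; left; apply/eqP; rewrite /c; field.
  by rewrite subr_eq0 !gt_eqF.
apply: leeD.
  have := IH (t0 * a) ta0 ta1; by rewrite mulrA -exprSr.
apply: (@le_trans _ _ (\int[lambda]_(y in `](t0 * a)%R, a]) (phi a / (t0 * a))%:E)%E).
  apply: ge0_le_integral => //.
  - move=> x /=; rewrite in_itv/= => /andP[x0 x1]; rewrite lee_fin wratio_ge0//.
      by rewrite ltW// (lt_trans ta0).
    exact: le_trans a1.
  - exact: mW (ltW ta0) a1.
  - move=> x /=; rewrite in_itv/= => /andP[x0 x1]; rewrite lee_fin.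
    have xp := lt_trans ta0 x0.
    apply: ler_pM; rewrite ?invr_ge0 ?(ltW xp)//.
    + by apply: weight_ge0; [exact: ltW|exact: le_trans a1].
    + by apply: weight_le => //; exact: ltW.
    + by rewrite lef_pV2 ?posrE// ltW.
rewrite integral_cst//= lebesgue_measure_itv/= lte_fin.
have pa := weight_ge0 phi (ltW a0) a1.
case: ifPn => _; last by rewrite mule0 lee_fin mulr_ge0// invr_ge0 ltW.
rewrite -EFinB -EFinM lee_fin.
apply: (@le_trans _ _ (phi a / (t0 * a) * a)).
  by rewrite ler_wpM2l ?divr_ge0 ?(ltW ta0)// gerBl ltW.
by rewrite le_eqVlt; apply/orP; left; apply/eqP; field; rewrite !gt_eqF.
Qed.

Lemma wratio_initial a : 0 < a -> a <= 1 ->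
  (\int[lambda]_(y in `]0%R, a]) (wratio y)%:E <= (c * phi a)%:E)%E.
Proof.
move=> a0 a1; have /andP[t00 t11] := t01.
pose F n := `]t0 ^+ n * a, a]%classic : set R.
have UF : `]0, a]%classic = \bigcup_n F n.
  apply/seteqP; split => x /=.
    rewrite in_itv/= => /andP[x0 xa].
    have [n hn] := exists_expr_lt (ltW t00) t11 (divr_gt0 x0 a0).
    by exists n => //; rewrite /F/= in_itv/= xa andbT -ltr_pdivlMr.
  move=> [n _]; rewrite /F/= !in_itv/= => /andP[tx ->]; rewrite andbT.
  by apply: lt_trans tx; rewrite mulr_gt0// exprn_gt0.
have mF n : measurable (F n) by exact: measurable_itv.
have ndF : nondecreasing_seq F.
  move=> n m nm; apply/subsetPset => x; rewrite /F/= !in_itv/= => /andP[tx ->].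
  rewrite andbT (le_lt_trans _ tx)// ler_pM2r//.
  by apply: ler_wiXn2l => //; exact: ltW.
have mW n : measurable_fun (F n) (fun y => (wratio y)%:E).
  apply/measurable_EFinP; apply: measurable_funS measurable_wratio => // x.
  have : `]0, a]%classic `<=` `]0, 1]%classic.
    by move=> z /=; rewrite !in_itv/= => /andP[-> za]; exact: le_trans a1.
  by rewrite UF => + Fx; apply; exists n.
have W0 n x : F n x -> (0 <= (wratio x)%:E)%E.
  rewrite /F/= in_itv/= => /andP[tx xa]; rewrite lee_fin wratio_ge0//.
    by rewrite ltW// (lt_trans _ tx)// mulr_gt0// exprn_gt0.
  exact: le_trans a1.
have cv : (\int[lambda]_(y in F n) (wratio y)%:E)%E @[n --> \oo] -->
    (\int[lambda]_(y in `]0%R, a]) (wratio y)%:E)%E.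
  by rewrite UF; exact: ge0_nondecreasing_set_cvg_integral.
rewrite -(cvg_lim _ cv)//.
apply: lime_le; first by apply/cvg_ex; eexists; exact: cv.
by apply: nearW => n; exact: wratio_dyadic.
Qed.

(* [y |-> phi y / y] decreases, so among sets of given measure its integral is
   largest on an initial interval. *)
Lemma wratio_integral (A : set R) : measurable A -> A `<=` `]0, 1]%classic ->
  (\int[lambda]_(y in A) (wratio y)%:E <= ((c + 1) * phi (fine (lambda A)))%:E)%E.
Proof.
move=> mA A01; set a := fine (lambda A).
have A1 : (lambda A <= 1)%E.
  rewrite -(lebesgue_I01 R); apply: le_measure; rewrite ?inE//.
  by move=> x /A01; rewrite /= in_itv/= I01E => /andP[/ltW -> ->].
have aE : lambda A = a%:E by rewrite fineK// ge0_fin_numE// (le_lt_trans A1)// ltry.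
have a1 : a <= 1 by rewrite -lee_fin -aE.
have a0 : 0 <= a by rewrite fine_ge0.
have mW : measurable_fun A (fun y => (wratio y)%:E).
  by apply/measurable_EFinP; exact: measurable_funS measurable_wratio.
have W0 x : A x -> (0 <= (wratio x)%:E)%E.
  by move=> /A01; rewrite /= in_itv/= => /andP[/ltW x0 x1]; rewrite lee_fin wratio_ge0.
move: a0; rewrite le_eqVlt => /predU1P[a00|a0].
  have -> : (\int[lambda]_(y in A) (wratio y)%:E = 0)%E.
    apply: (@null_set_integral _ _ _ lambda A); [exact: mA|exact: mW|].
    by rewrite -[LHS]/(lambda A) aE -a00.
  by rewrite lee_fin -a00 weight0 mulr0.
have mI1 : measurable (A `&` `]0, a]%classic) by apply: measurableI => //; exact: measurable_itv.
have mI2 : measurable (A `&` `]a, 1]%classic) by apply: measurableI => //; exact: measurable_itv.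
have U : A = (A `&` `]0, a]%classic) `|` (A `&` `]a, 1]%classic).
  rewrite -setIUr; apply/seteqP; split => x; last by case.
  move=> Ax; split => //; have := A01 _ Ax; rewrite /= !in_itv/= => /andP[x0 x1].
  by have [xa|xa] := leP x a; [left|right]; rewrite ?x0 ?x1.
rewrite [X in (\int[_]_(_ in X) _)%E]U ge0_integral_setU//; first last.
- apply/disj_set2P/seteqP; split => // x /=.
  rewrite !in_itv/= => -[[_ /andP[_ xa]] [_ /andP[ax _]]].
  by move: ax; rewrite ltNge xa.
- by rewrite -U.
- by rewrite -U.
(* The part of [A] in ]0, a] costs c phi(a). On the part beyond a the integrand is at most phi(a)/a
   and the measure at most a, which adds one phi(a). *)
rewrite mulrDl EFinD mul1r; apply: leeD.
  apply: le_trans (wratio_initial a0 a1); apply: ge0_subset_integral => //.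
  - apply/measurable_EFinP; apply: measurable_funS measurable_wratio => // x /=.
    by rewrite !in_itv/= => /andP[-> xa]; exact: le_trans a1.
  - move=> x /=; rewrite in_itv/= => /andP[x0 xa].
    by rewrite lee_fin wratio_ge0 ?(ltW x0)// (le_trans xa).
apply: (@le_trans _ _ (\int[lambda]_(y in A `&` `]a, 1%R]) (wratio a)%:E)%E).
  apply: ge0_le_integral => //.
  - by move=> x [/W0].
  - by apply: measurable_funS mW.
  - by move=> x [_ /=]; rewrite in_itv/= => /andP[ax x1]; rewrite lee_fin wratio_anti// ltW.
rewrite integral_cst//; apply: (@le_trans _ _ ((wratio a)%:E * lambda A)%E).
  by apply: lee_wpmul2l; [rewrite lee_fin wratio_ge0// ltW|apply: le_measure; rewrite ?inE].
by rewrite aE -EFinM lee_fin /wratio divfK// gt_eqF.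
Qed.

(** This puts phi(y)/y in the associate space of the Lorentz space, with constant c + 1:
    [wratio_integral] is applied to each superlevel set of |f|, and the results are integrated over
    the levels. *)
Lemma wratio_lorentz f : measurable_fun I01 f ->
  (\int[lambda]_(y in `]0%R, 1%R]) ((wratio y)%:E * `|f y|%:E) <=
   (c + 1)%:E * lorentz_integral phi f)%E.
Proof.
move=> mf.
have sub : `]0, 1]%classic `<=` (I01 : set R).
  by move=> x; rewrite /= in_itv/= I01E => /andP[/ltW -> ->].
have mf1 : measurable_fun (`]0, 1]%classic : set R) (fun y => `|f y|%:E).
  by apply/measurable_EFinP; apply: measurableT_comp => //; exact: measurable_funS mf.
have mW : measurable_fun (`]0, 1]%classic : set R) (fun y => (wratio y)%:E).
  by apply/measurable_EFinP; exact: measurable_wratio.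
have W0 y : `]0, 1]%classic y -> (0 <= (wratio y)%:E)%E.
  by rewrite /= in_itv/= => /andP[/ltW y0 y1]; rewrite lee_fin wratio_ge0.
pose A t : set R := `]0, 1]%classic `&` [set y | (t%:E < `|f y|%:E)%E].
pose I t := (\int[lambda]_(y in A t) (wratio y)%:E)%E.
have -> : (\int[lambda]_(y in `]0%R, 1%R]) ((wratio y)%:E * `|f y|%:E) =
    \int[lambda]_(t in `[0%R, +oo[) I t)%E.
  transitivity (\int[lambda]_(y in `]0%R, 1%R]) ((wratio y)%:E * maxe (`|f y|%:E - 0%:E) 0))%E.
    by apply: eq_integral => y _; rewrite sube0 max_l// lee_fin.
  have := @layer_cake _ _ _ lambda _ (fun y => `|f y|%:E) (fun y => (wratio y)%:E) 0
    (measurable_itv _) mf1 mW W0.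
  exact.
rewrite lorentz_integralE// -ge0_integralZl_EFin//; last 3 first.
- by move=> t _; rewrite lee_fin weight_ge0 ?dfun_ge0 ?dfun_le1.
- exact: measurable_weight_dfun.
- by rewrite addr_ge0.
have mA t : measurable (A t).
  rewrite /A -(setIidl sub) -setIA; apply: measurableI; first exact: measurable_itv.
  exact: measurable_superlevel.
have I0 t : (0 <= I t)%E by apply: integral_ge0 => y [/W0].
have Ile t : (I t <= ((c + 1) * phi (dfun f t))%:E)%E.
  apply: le_trans (wratio_integral (mA t) _) _; first by move=> y [].
  rewrite lee_fin ler_wpM2l ?addr_ge0//.
  have le : (lambda (A t) <= distribution_function f t)%E.
    apply: le_measure; rewrite ?inE; [exact: mA|exact: measurable_superlevel|].
    by move=> y [/sub ? ?]; split.
  apply: weight_le (dfun_le1 mf t); first by rewrite fine_ge0.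
  by rewrite -lee_fin -dfunE// fineK// ge0_fin_numE// (le_lt_trans le)// dfunE// ltry.
have IE t : I t = (fine (I t))%:E.
  by rewrite fineK// ge0_fin_numE// (le_lt_trans (Ile t))// ltry.
have mI : measurable_fun (`[0, +oo[%classic : set R) I.
  rewrite (_ : I = EFin \o (fine \o I)); last by apply/funext => t; exact: IE.
  apply/measurable_EFinP; apply: nonincreasing_measurable; first exact: measurable_itv.
  move=> s t st; rewrite -lee_fin -!IE; apply: ge0_subset_integral; [exact: mA|exact: mA|..].
  - by apply: measurable_funS mW => // y [].
  - by move=> y [/W0].
  - by move=> y [? /= ty]; split => //=; apply: le_lt_trans ty; rewrite lee_fin.
apply: ge0_le_integral => //.
- by apply: emeasurable_funM; [exact: measurable_cst|exact: measurable_weight_dfun].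
Qed.

End lorentz_weight_integral.

(** * Lorentz spaces satisfy the hypotheses on N(F_y) *)

Section lorentz_Cesaro_hypotheses.
Context (R : realType) (phi : lorentz_weight R).
Hypothesis phi1 : 0 < phi 1.
Local Notation lambda := (@lebesgue_measure R).
Local Notation X := (lorentz_space phi).
Local Notation N := (lorentz_norm phi).
Implicit Types (f : R -> R) (s t q y b : R).

Let rX : ri_space X N := lorentz_ri_space phi1.
Let bX := ri_bfs rX.

Lemma lorentz_norm_indic_le (A : set R) b : measurable A -> b <= 1 ->
  (lambda (I01 `&` A) <= b%:E)%E -> N (\1_A) <= phi b.
Proof.
move=> mA b1 Ab; rewrite /lorentz_norm lorentz_indic//=; apply: weight_le => //.
  by rewrite fine_ge0.
by rewrite -lee_fin fineK// ge0_fin_numE// (le_lt_trans Ab)// ltry.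
Qed.

Lemma lebesgue_I01_itv_le (a b : R) : a <= b ->
  (lambda (I01 `&` `[a, b]) <= (b - a)%:E)%E.
Proof.
move=> ab; apply: (@le_trans _ _ (lambda `[a, b]%classic)).
  apply: le_measure; rewrite ?inE; last by move=> x [].
  - by apply: measurableI; [exact: measurable_I01|exact: measurable_itv].
  - exact: measurable_itv.
rewrite lebesgue_measure_itv/= lte_fin; case: ifP => _; first by rewrite -EFinB.
by rewrite lee_fin subr_ge0.
Qed.

(** F_y is at most F_(yt) plus 1/y times the indicator of [y, yt]. Since phi(yt)/(yt) <= (M/t)
    phi(y)/y, a constant K for yt becomes K M/t + t for y, and K = t^2/(t - M) is the fixed point
    because M < t. The induction is on the number of multiplications by t that carry y past 1. *)
Lemma lorentz_F_le t M : 1 < t -> 0 <= M < t ->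
  (forall s, 0 < s -> s * t <= 1 -> phi (s * t) <= M * phi s) ->
  exists2 K, 0 <= K & forall y, 0 < y -> y <= 1 -> N (F_ y) <= K * wratio phi y.
Proof.
move=> t1 /andP[M0 Mt] phit.
have t0 : 0 < t by apply: lt_trans t1.
have tM : 0 < t - M by rewrite subr_gt0.
pose K := t * t / (t - M).
have K0 : 0 <= K by rewrite divr_ge0 ?mulr_ge0 ?ltW.
have tK : t <= K by rewrite ler_pdivlMr// ler_wpM2l ?(ltW t0)// gerBl.
have KE : K * (M / t) + t = K.
  by rewrite /K; field; rewrite !gt_eqF.
exists K => // y y0 y1.
have [n] : exists n, t^-1 ^+ n < y.
  by apply: exists_expr_lt => //; rewrite ?invr_ge0 ?(ltW t0)// invf_lt1.
elim: n y y0 y1 => [|n IH] y y0 y1.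
  by rewrite expr0 ltNge y1.
move=> ny; have XF := F_in rX y0.
have py : 0 <= phi y by exact: weight_ge0 (ltW y0) y1.
have mI (a b : R) : measurable (`[a, b]%classic : set R) by exact: measurable_itv.
have scale A : measurable A -> X (fun x => y^-1 * \1_A x) /\
    N (fun x => y^-1 * \1_A x) = y^-1 * N (\1_A).
  move=> mA; have XA := lorentz_indic_in phi mA.
  split; first exact: (bfs_scale bX _ XA).
  by rewrite (bfs_normZ bX _ XA) ger0_norm// invr_ge0 ltW.
have absF x : I01 x -> `|F_ y x| = F_ y x.
  by rewrite I01E => /andP[x0 _]; rewrite ger0_norm// F_ge0.
(* When yt > 1 no dilation is available: F_y is at most 1/y throughout, and y phi(1) <= phi(y) gives
   phi(1) <= t phi(y). *)
have [yt|yt] := leP (y * t) 1; last first.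
  have [Xs Ns] := scale _ (mI 0 1).
  have [|_ le] := bfs_le bX Xs (measurable_F y).
    move=> x Ix; rewrite absF//; move: Ix; rewrite I01E => /andP[x0 x1].
    rewrite F_E indicE mem_set//= ?in_itv/= ?x0 ?x1// mulr1 ger0_norm ?invr_ge0 ?(ltW y0)//.
    case: ifPn => [/andP[yx _]|_]; last by rewrite invr_ge0 ltW.
    by rewrite lef_pV2// posrE (lt_le_trans y0).
  apply: (le_trans le); rewrite Ns /wratio mulrA mulrC.
  apply: ler_wpM2r; first by rewrite invr_ge0 ltW.
  apply: (@le_trans _ _ (phi 1)).
    by apply: lorentz_norm_indic_le => //; rewrite (le_trans (lebesgue_I01_itv_le ler01))// subr0.
  have := weight_star phi (ltW y0) y1 (lexx 1); rewrite mul1r => star.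
  apply: (@le_trans _ _ (t * phi y)); last by rewrite ler_wpM2r.
  rewrite -(ler_pM2l y0); apply: (le_trans star); rewrite mulrA ler_peMl// ltW//.
have z0 : 0 < y * t by rewrite mulr_gt0.
have yz : y <= y * t by rewrite ler_peMr ?ltW.
have XFz := F_in rX z0; have [Xs Ns] := scale _ (mI y (y * t)).
have [|_ le] := bfs_le bX (bfs_add bX XFz Xs) (measurable_F y).
  move=> x Ix; rewrite absF//; move: Ix; rewrite I01E => /andP[x0 x1].
  apply: le_trans (ler_norm _); rewrite /= !F_E x1 !andbT indicE.
  have [zx|xz] := leP (y * t) x.
    by rewrite (le_trans yz zx) lerDl mulr_ge0// invr_ge0 ltW.
  rewrite add0r; case: ifPn => [yx|_]; last by rewrite mulr_ge0// invr_ge0 ltW.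
  rewrite mem_set//= ?in_itv/= ?yx ?(ltW xz)// mulr1.
  by rewrite lef_pV2// posrE (lt_le_trans y0).
apply: (le_trans le); apply: le_trans (bfs_normD bX XFz Xs) _; rewrite Ns.
have IHz : N (F_ (y * t)) <= K * wratio phi (y * t).
  by apply: IH => //; move: ny; rewrite exprS mulrC ltr_pdivrMr.
have pz := phit y y0 yt.
have NI : N (\1_(`[y, y * t]%classic : set R)) <= t * phi y.
  apply: le_trans (_ : M * phi y <= _); last by rewrite ler_wpM2r// ltW.
  apply: le_trans pz; apply: lorentz_norm_indic_le => //.
  by apply: (le_trans (lebesgue_I01_itv_le yz)); rewrite lee_fin gerBl ltW.
have W : wratio phi (y * t) <= M / t * wratio phi y.
  rewrite /wratio ler_pdivrMr//; apply: le_trans pz _.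
  by rewrite le_eqVlt; apply/orP; left; apply/eqP; field; rewrite !gt_eqF.
rewrite -[in leRHS]KE mulrDl; apply: lerD.
  by apply: (le_trans IHz); rewrite -[leRHS]mulrA ler_wpM2l.
by rewrite /wratio mulrA [leRHS]mulrC ler_wpM2l// invr_ge0 ltW.
Qed.

Lemma lorentz_associate t q t' M : 0 < t < 1 -> 0 < q < 1 ->
  (forall s, 0 < s -> s <= 1 -> phi (t * s) <= q * phi s) ->
  1 < t' -> 0 <= M < t' ->
  (forall s, 0 < s -> s * t' <= 1 -> phi (s * t') <= M * phi s) ->
  associate_space X (fun y => N (F_ y)).
Proof.
move=> t01 q01 phit t'1 Mt' phit'.
have [K K0 FK] := lorentz_F_le t'1 Mt' phit'.
have sub : `]0, 1]%classic `<=` (I01 : set R).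
  by move=> x; rewrite /= in_itv/= I01E => /andP[/ltW -> ->].
have mF : measurable_fun I01 (fun y => N (F_ y)).
  (* Monotonicity of N(F_y) holds for y > 0 only, and the single point 0 does not affect
     measurability. *)
  apply/measurable_fun_itv_obnd_cbndP.
  apply: nonincreasing_in_measurable; [exact: interval_is_interval|exact: measurable_itv|].
  by move=> x y; rewrite /= !in_itv/= => /andP[x0 _] _; exact: (F_anti rX).
split=> // f Xf; have [mf Lf] := Xf.
have mfF : measurable_fun I01 (fun y => `|f y * N (F_ y)|%:E).
  by apply/measurable_EFinP; apply: measurableT_comp => //; exact: measurable_funM.
rewrite /I01 -integral_itv_obnd_cbnd; last exact: measurable_funS mfF.
have mW : measurable_fun (`]0, 1]%classic : set R) (fun y => ((wratio phi y)%:E * `|f y|%:E)%E).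
  apply: emeasurable_funM; first by apply/measurable_EFinP; exact: measurable_wratio.
  by apply/measurable_EFinP; apply: measurableT_comp => //; exact: measurable_funS mf.
have W0 y : `]0, 1]%classic y -> 0 <= wratio phi y.
  by rewrite /= in_itv/= => /andP[/ltW y0 y1]; exact: wratio_ge0.
apply: (@le_lt_trans _ _
    (\int[lambda]_(y in `]0%R, 1%R]) (K%:E * ((wratio phi y)%:E * `|f y|%:E)))%E).
  apply: ge0_le_integral => //.
  - exact: measurable_funS mfF.
  - by apply: emeasurable_funM => //; exact: measurable_cst.
  - move=> y y01; rewrite -!EFinM lee_fin normrM mulrA [leRHS]mulrC ler_wpM2l//.
    move: y01; rewrite /= in_itv/= => /andP[y0 y1].
    by rewrite (ger0_norm (bfs_N_ge0 bX (F_in rX y0))); exact: FK.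
rewrite ge0_integralZl_EFin//; last first.
  by move=> y /W0 ?; rewrite -EFinM lee_fin mulr_ge0.
rewrite -ge0_fin_numE; last first.
  apply: mule_ge0; first by rewrite lee_fin.
  by apply: integral_ge0 => y /W0 ?; rewrite -EFinM lee_fin mulr_ge0.
rewrite fin_numM// ge0_fin_numE; last first.
  by apply: integral_ge0 => y /W0 ?; rewrite -EFinM lee_fin mulr_ge0.
apply: le_lt_trans (wratio_lorentz t01 q01 phit mf) _.
by rewrite (lorentz_normE Xf) -EFinM ltry.
Qed.

(** The indicators of [0, t^k] have norms at most q^k phi(1), which are summable, so some member of
    the space dominates all their partial sums. It is at least n almost everywhere on [0, t^n] and
    hence not essentially bounded. *)
Lemma lorentz_neq_Linfty t q : 0 < t < 1 -> 0 < q < 1 ->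
  (forall s, 0 < s -> s <= 1 -> phi (t * s) <= q * phi s) -> X <> Linfty.
Proof.
move=> /andP[t0 t1] /andP[q0 q1] phit.
have tn0 n : 0 < t ^+ n by rewrite exprn_gt0.
have tn1 n : t ^+ n <= 1 by rewrite exprn_ile1 ?ltW.
pose u k : R -> R := \1_(`[0, t ^+ k]%classic : set R).
have phin k : phi (t ^+ k) <= q ^+ k * phi 1.
  elim: k => [|k IH]; first by rewrite !expr0 mul1r.
  by rewrite !exprS; apply: le_trans (phit _ (tn0 k) (tn1 k)) _; rewrite -mulrA ler_pM2l.
have Nu k : N (u k) <= q ^+ k * phi 1.
  apply: le_trans (phin k); apply: lorentz_norm_indic_le => //.
  by rewrite (le_trans (lebesgue_I01_itv_le (ltW (tn0 k))))// subr0.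
have [|k x _|n|S [XS _ uS]] := @bfs_series_bound R X N bX u (phi 1 / (1 - q)).
- by move=> k; apply: lorentz_indic_in; exact: measurable_itv.
- by rewrite /u indicE.
- apply: (@le_trans _ _ (\sum_(k < n) q ^+ k * phi 1)); first exact: ler_sum.
  rewrite -mulr_suml mulrC ler_wpM2l ?(ltW phi1)// -[leRHS]mul1r ler_pdivlMr ?subr_gt0//.
  have := subrX1 q n; have := exprn_ge0 n (ltW q0); lra.
move=> XE; move: XS; rewrite XE => -[_ [M SM]].
have [n Mn] : exists n, M < n%:R by exists (Num.truncn M).+1; exact: truncnS_gt.
have [Z [mZ Z0 hZ]] := ae_imply2 (uS n) SM
  (fun x h1 h2 Ix => le_trans (h1 Ix) (le_trans (ler_norm _) (h2 Ix))).
have : (lambda `[0%R, (t ^+ n)%R] <= lambda Z)%E.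
  apply: le_measure; rewrite ?inE; [exact: measurable_itv|exact: mZ|].
  move=> x /=; rewrite in_itv/= => /andP[x0 xn]; apply: hZ => /= hx.
  have : \sum_(k < n) u k x <= M by apply: hx; rewrite I01E x0 (le_trans xn).
  rewrite (eq_bigr (fun=> 1)) => [|k _]; last first.
    rewrite /u indicE mem_set//= in_itv/= x0 (le_trans xn)//.
    by apply: ler_wiXn2l; rewrite ?(ltW t0) ?(ltW t1)// ltnW.
  by rewrite sumr_const card_ord leNgt Mn.
rewrite [leRHS]Z0 lebesgue_measure_itv/= lte_fin tn0 oppr0 adde0 lee_fin leNgt.
by rewrite tn0.
Qed.

End lorentz_Cesaro_hypotheses.

Theorem proposition4p3 (R : realType) :
  (forall (X : set (R -> R)) (N : (R -> R) -> R),
     ri_space X N -> X <> Linfty ->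
     associate_space X (fun y => N (F_ y)) ->
     completely_continuous X N Cesaro) /\
  (forall phi : lorentz_weight R,
     0 < lower_dilation_index phi ->
     lower_dilation_index phi <= upper_dilation_index phi ->
     upper_dilation_index phi < 1 ->
     [/\ ri_space (lorentz_space phi) (lorentz_norm phi),
         lorentz_space phi <> Linfty,
         associate_space (lorentz_space phi)
           (fun y => lorentz_norm phi (F_ y)) &
         completely_continuous (lorentz_space phi) (lorentz_norm phi) Cesaro]).
Proof.
split=> [X N rX _ XF|phi gamma0 gamma_delta delta1].
  exact: Cesaro_completely_continuous.
have [phi1 [t [q [t01 q01 phit]]]] := lower_dilation_index_gt0 gamma0.
have [t' [M [t'1 Mt' phit']]] :=
  upper_dilation_index_lt1 (lt_le_trans gamma0 gamma_delta) delta1.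
have rX := lorentz_ri_space phi1.
have XF := lorentz_associate phi1 t01 q01 phit t'1 Mt' phit'.
have XL := lorentz_neq_Linfty phi1 t01 q01 phit.
by split; [exact: rX|exact: XL|exact: XF|exact: Cesaro_completely_continuous rX XF].
Qed.
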